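(* Let $X$ be a separable real Banach space. The following are equivalent: (i) $X$ has property (au$^*$); (ii) for every $\delta>0$ there exist a Banach space $Y$ with a shrinking 1-unconditional basis and a subspace $X_\delta$ of $Y$ such that $d(X,X_\delta)<1+\delta$.
   Context: All Banach spaces are real. A separable Banach space $X$ has property (au$^*$) if $\lim_{n\to\infty}(\|x^*+x_n^*\|-\|x^*-x_n^*\|)=0$ whenever $x^*\in X^*$ and $(x_n^* )_{n\ge1}$ is a weak$^*$-null sequence in $X^*$. $d(X,Z)=\inf\{\|T\|\|T^{-1}\|: T:X\to Z \text{ an onto isomorphism}\}$ is the Banach–Mazur distance. A basis $(e_j)$ is 1-unconditional if $\|\sum\epsilon_ja_je_j\|\le\|\sum a_je_j\|$ for all finitely supported scalars and signs $\epsilon_j=\pm1$; it is shrinking if the biorthogonal functionals form a basis of $Y^*$. *)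

(* Defs.v *)
From Stdlib Require Import Reals Lra ClassicalEpsilon.
Open Scope R_scope.
Set Implicit Arguments.

Record Banach := {
  car :> Type;
  bzero : car;
  badd : car -> car -> car;
  bopp : car -> car;
  bscal : R -> car -> car;
  bnorm : car -> R;
  badd_assoc : forall x y z, badd x (badd y z) = badd (badd x y) z;
  badd_comm : forall x y, badd x y = badd y x;
  badd_0 : forall x, badd x bzero = x;
  badd_opp : forall x, badd x (bopp x) = bzero;
  bscal_1 : forall x, bscal 1 x = x;
  bscal_assoc : forall a b x, bscal a (bscal b x) = bscal (a * b) x;
  bscal_distr_v : forall a x y, bscal a (badd x y) = badd (bscal a x) (bscal a y);
  bscal_distr_s : forall a b x, bscal (a + b) x = badd (bscal a x) (bscal b x);
  bnorm_eq0 : forall x, bnorm x = 0 -> x = bzero;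
  bnorm_scal : forall a x, bnorm (bscal a x) = Rabs a * bnorm x;
  bnorm_triangle : forall x y, bnorm (badd x y) <= bnorm x + bnorm y;
  bcomplete : forall u : nat -> car,
    (forall eps, eps > 0 -> exists N, forall m n, (m >= N)%nat -> (n >= N)%nat ->
       bnorm (badd (u m) (bopp (u n))) < eps) ->
    exists l, Un_cv (fun n => bnorm (badd (u n) (bopp l))) 0
}.

Arguments bzero {_}.
Arguments badd {_}.
Arguments bopp {_}.
Arguments bscal {_}.
Arguments bnorm {_}.

Definition bsub {X : Banach} (x y : X) : X := badd x (bopp y).

Definition conv_to {X : Banach} (u : nat -> X) (l : X) : Prop :=
  Un_cv (fun n => bnorm (bsub (u n) l)) 0.

Fixpoint vsum {X : Banach} (f : nat -> X) (n : nat) : X :=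
  match n with
  | O => f O
  | S k => badd (vsum f k) (f (S k))
  end.

Definition separable (X : Banach) : Prop :=
  exists d : nat -> X, forall (x : X) (eps : R), eps > 0 ->
    exists n, bnorm (bsub x (d n)) < eps.

Definition is_linear {X Y : Banach} (T : X -> Y) : Prop :=
  (forall x y, T (badd x y) = badd (T x) (T y)) /\
  (forall a x, T (bscal a x) = bscal a (T x)).

Definition in_dual {X : Banach} (f : X -> R) : Prop :=
  (forall x y, f (badd x y) = f x + f y) /\
  (forall a x, f (bscal a x) = a * f x) /\
  (exists C, forall x, Rabs (f x) <= C * bnorm x).

(** Dual norm  ||f|| = sup_{||x|| <= 1} |f x|  (the least upper bound; for
    f in X^star this supremum exists, otherwise the value is irrelevant). *)
Definition dual_norm {X : Banach} (f : X -> R) : R :=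
  epsilon (inhabits 0%R)
    (fun r => is_lub (fun t => exists x : X, bnorm x <= 1 /\ t = Rabs (f x)) r).

Definition weak_star_null {X : Banach} (xn : nat -> X -> R) : Prop :=
  (forall n, in_dual (xn n)) /\ (forall x : X, Un_cv (fun n => xn n x) 0).

Definition property_au_star (X : Banach) : Prop :=
  forall (xs : X -> R) (xn : nat -> X -> R),
    in_dual xs -> weak_star_null xn ->
    Un_cv (fun n => dual_norm (fun x => xs x + xn n x)
                    - dual_norm (fun x => xs x - xn n x)) 0.

Definition schauder_basis {Y : Banach} (e : nat -> Y) (ef : nat -> Y -> R) : Prop :=
  forall y : Y,
    conv_to (vsum (fun j => bscal (ef j y) (e j))) y /\
    (forall a : nat -> R, conv_to (vsum (fun j => bscal (a j) (e j))) y ->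
       forall j, a j = ef j y).

Definition one_unconditional {Y : Banach} (e : nat -> Y) : Prop :=
  forall (N : nat) (a eps : nat -> R),
    (forall j, eps j = 1 \/ eps j = -1) ->
    bnorm (vsum (fun j => bscal (eps j * a j) (e j)) N)
      <= bnorm (vsum (fun j => bscal (a j) (e j)) N).

Definition shrinking {Y : Banach} (ef : nat -> Y -> R) : Prop :=
  (forall j, in_dual (ef j)) /\
  forall f : Y -> R, in_dual f ->
    exists b : nat -> R,
      Un_cv (fun n => dual_norm (fun y => f y - sum_f_R0 (fun j => b j * ef j y) n)) 0 /\
      (forall b' : nat -> R,
         Un_cv (fun n => dual_norm (fun y => f y - sum_f_R0 (fun j => b' j * ef j y) n)) 0 ->
         forall j, b' j = b j).

Definition has_shrinking_1unc_basis (Y : Banach) : Prop :=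
  exists (e : nat -> Y) (ef : nat -> Y -> R),
    schauder_basis e ef /\ one_unconditional e /\ shrinking ef.

Definition is_subspace {Y : Banach} (S : Y -> Prop) : Prop :=
  S bzero /\ (forall x y, S x -> S y -> S (badd x y)) /\
  (forall a x, S x -> S (bscal a x)).

(** d(X, S) < c for a subspace S of Y (with the induced norm): there is an
    onto isomorphism T : X -> S with ||T|| ||T^{-1}|| < c.  Here M1 bounds
    ||T|| and M2 bounds ||T^{-1}|| (operator norms are the least such bounds,
    so this is exactly "some isomorphism has ||T|| ||T^-1|| < c"). *)
Definition BM_dist_lt (X Y : Banach) (S : Y -> Prop) (c : R) : Prop :=
  exists (T : X -> Y) (M1 M2 : R),
    is_linear T /\
    (forall x, S (T x)) /\ (forall y, S y -> exists x, T x = y) /\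
    0 <= M1 /\ 0 <= M2 /\
    (forall x, bnorm (T x) <= M1 * bnorm x) /\
    (forall x, bnorm x <= M2 * bnorm (T x)) /\
    M1 * M2 < c.

(* Main.v *)
(** From embeddings to (au-star): if [X] is (1 + delta)-isomorphic to a subspace of [Y], extend
    the functionals [x* - x_n*] to [Y] by Hahn-Banach and pass to a weak-star limit; on [Y]
    the contractions [2 P_m - I] exchange [f + g_n] and [f - g_n] up to small errors.

    From (au-star) to embeddings: let (d_i) be dense in [X].  By weak-star compactness one finds
    finite sets L_0, L_1, ... of functionals, those of L_k vanishing on d_i for i < k, such
    that each [x*] in the dual ball is nearly a weak-star sum of z_k in L_k all of whose sign
    changes have norm at most 1 + 2 eta.  Enumerate the union of the L_k as (D_j) and let [Y]
    be the sequence space whose norm is dual to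
    sup over the unit ball of the sums of |c_j| (|D_j x| + omega_j), with (omega_j) small and
    summable.  Then x |-> (D_j x) embeds [X] almost isometrically.  The unit vector basis of
    [Y] is shrinking because property (au-star) forbids weak-star null blocks in the dual of [X]
    that are bounded below and whose signed sums are all bounded. *)

(* Property (au-star) compares two signs for one functional and one sequence, whereas an
   unconditional basis needs control of all sign changes at once. The bridge is that, for fixed [A],
   flipping [w] in [A + w] is almost free uniformly over bounded [w] vanishing on enough of the d_i.
   Compactness leaves finitely many choices per level, hence finitely many signed sums [A], so the
   flips can be budgeted with summable errors. The obstacle is that the number of d_i to annihilate
   depends on the choice made; the finite cover must therefore use neighbourhoods whose size varies
   with their centre.

   Control of all signs bounds the sum of the |z_k x| by (1 + 2 eta) ||x||. With the total mass eta
   of (omega_j), this makes the 0-1 weights of a branch, divided by 1 + 3 eta, a competitor in the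
   norm of Y, whence the lower estimate.

   For a functional f on Y, all signed sums of the f(e_j) D_j are bounded by ||f||. These are the
   series to which the c_0 argument applies, and uniformly small tails are exactly norm convergence
   of the expansion of f.

   Separability replaces Zorn's lemma and nets: all extensions and limits are built along a
   countable total sequence. *)
Require Import Defs.
From Stdlib Require Import Reals Lra Lia List Classical ClassicalEpsilon.
From Stdlib Require Import FunctionalExtensionality ProofIrrelevance Cantor.
Import ListNotations.
Open Scope R_scope.

(** * Linear identities in a Banach space *)

Lemma bscal_0 (X : Banach) (x : X) : bscal 0 x = bzero.
Proof.
  assert (H : badd (bscal 0 x) (bscal 0 x) = bscal 0 x)
    by (rewrite <- bscal_distr_s, Rplus_0_r; reflexivity).
  apply (f_equal (fun y => badd y (bopp (bscal 0 x)))) in H.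
  rewrite <- badd_assoc, badd_opp, badd_0 in H; exact H.
Qed.

Lemma bopp_scal (X : Banach) (x : X) : bopp x = bscal (-1) x.
Proof.
  assert (H : badd x (bscal (-1) x) = bzero).
  { rewrite <- (bscal_1 X x) at 1; rewrite <- bscal_distr_s.
    replace (1 + -1) with 0 by ring; apply bscal_0. }
  rewrite <- (badd_0 X (bopp x)), <- H, badd_assoc, (badd_comm X (bopp x)).
  rewrite badd_opp, badd_comm, badd_0; reflexivity.
Qed.

Lemma bscal_zero (X : Banach) (a : R) : bscal a (@bzero X) = bzero.
Proof.
  rewrite <- (bscal_0 X bzero), bscal_assoc, Rmult_0_r; reflexivity.
Qed.

(** Syntax for a reflective decision procedure. The vector operations are fields of a record, out of
    reach of [ring] and [field]; [vec] reduces a vector identity to identities between scalar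
    coefficients. *)
Inductive vexp :=
| VVar (n : nat) | VZero | VAdd (e f : vexp) | VOpp (e : vexp) | VScal (a : R) (e : vexp).

Fixpoint veval {X : Banach} (env : list X) (e : vexp) : X :=
  match e with
  | VVar n => nth n env bzero
  | VZero => bzero
  | VAdd e f => badd (veval env e) (veval env f)
  | VOpp e => bopp (veval env e)
  | VScal a e => bscal a (veval env e)
  end.

Fixpoint vcoef (e : vexp) (i : nat) : R :=
  match e with
  | VVar n => if Nat.eqb n i then 1 else 0
  | VZero => 0
  | VAdd e f => vcoef e i + vcoef f i
  | VOpp e => - vcoef e i
  | VScal a e => a * vcoef e i
  end.

Fixpoint vlin {X : Banach} (env : list X) (c : nat -> R) : X :=
  match env with
  | nil => bzero
  | x :: t => badd (bscal (c O) x) (vlin t (fun i => c (S i)))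
  end.

Lemma vlin_0 (X : Banach) (env : list X) : vlin env (fun _ => 0) = bzero.
Proof.
  induction env as [|x t IH]; simpl; [reflexivity|].
  rewrite IH, bscal_0, badd_0; reflexivity.
Qed.

Lemma vlin_add (X : Banach) (env : list X) : forall c d,
  vlin env (fun i => c i + d i) = badd (vlin env c) (vlin env d).
Proof.
  induction env as [|x t IH]; intros c d; simpl; [symmetry; apply badd_0|].
  rewrite (IH (fun i => c (S i)) (fun i => d (S i))), bscal_distr_s.
  rewrite !badd_assoc; f_equal.
  rewrite <- !badd_assoc; f_equal; apply badd_comm.
Qed.

Lemma vlin_scal (X : Banach) (env : list X) : forall a c,
  vlin env (fun i => a * c i) = bscal a (vlin env c).
Proof.
  induction env as [|x t IH]; intros a c; simpl; [symmetry; apply bscal_zero|].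
  rewrite (IH a (fun i => c (S i))), bscal_distr_v, bscal_assoc; reflexivity.
Qed.

Lemma vlin_var (X : Banach) (env : list X) : forall n,
  vlin env (fun i => if Nat.eqb n i then 1 else 0) = nth n env bzero.
Proof.
  induction env as [|x t IH]; intros [|n]; simpl; try reflexivity.
  - rewrite vlin_0, bscal_1, badd_0; reflexivity.
  - rewrite IH, bscal_0, badd_comm, badd_0; reflexivity.
Qed.

Lemma veval_vlin (X : Banach) (env : list X) (e : vexp) :
  veval env e = vlin env (vcoef e).
Proof.
  induction e as [n| |e IHe f IHf|e IHe|a e IHe]; simpl.
  - symmetry; apply vlin_var.
  - symmetry; apply vlin_0.
  - rewrite IHe, IHf, <- vlin_add; reflexivity.
  - rewrite IHe, bopp_scal, <- vlin_scal; f_equal.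
    apply functional_extensionality; intro; ring.
  - rewrite IHe, <- vlin_scal; reflexivity.
Qed.

(** Recursion over the environment lets the comparison compute to a finite conjunction of scalar
    equations. *)
Fixpoint vsame {X : Banach} (env : list X) (c d : nat -> R) : Prop :=
  match env with
  | nil => True
  | _ :: t => c O = d O /\ vsame t (fun i => c (S i)) (fun i => d (S i))
  end.

Lemma vlin_same (X : Banach) (env : list X) : forall c d,
  vsame env c d -> vlin env c = vlin env d.
Proof.
  induction env as [|x t IH]; simpl; intros c d H; [reflexivity|].
  destruct H as [H0 H]; rewrite H0, (IH _ _ H); reflexivity.
Qed.

Lemma veval_same (X : Banach) (env : list X) (e f : vexp) :
  vsame env (vcoef e) (vcoef f) -> veval env e = veval env f.
Proof. intro H; rewrite !veval_vlin; apply vlin_same, H. Qed.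

Ltac vindex x env :=
  lazymatch env with
  | x :: _ => constr:(O)
  | _ :: ?t => let n := vindex x t in constr:(S n)
  end.

Ltac vinsert x env :=
  let rec mem l :=
    lazymatch l with
    | nil => constr:(false)
    | x :: _ => constr:(true)
    | _ :: ?t => mem t
    end in
  lazymatch mem env with
  | true => env
  | false => constr:(x :: env)
  end.

Ltac vatoms t env :=
  lazymatch t with
  | bzero => env
  | badd ?a ?b => let env' := vatoms a env in vatoms b env'
  | bopp ?a => vatoms a env
  | bscal _ ?a => vatoms a env
  | _ => vinsert t env
  end.

Ltac vreify t env :=
  lazymatch t with
  | bzero => constr:(VZero)
  | badd ?a ?b =>
      let e := vreify a env in let f := vreify b env in constr:(VAdd e f)
  | bopp ?a => let e := vreify a env in constr:(VOpp e)
  | bscal ?r ?a => let e := vreify a env in constr:(VScal r e)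
  | _ => let n := vindex t env in constr:(VVar n)
  end.

(* Decides equalities between linear combinations, coefficient by coefficient. *)
Ltac vec :=
  unfold bsub;
  lazymatch goal with
  | |- @eq (car ?X) ?s ?t =>
      let env0 := vatoms s (@nil (car X)) in
      let env := vatoms t env0 in
      let e := vreify s env in
      let f := vreify t env in
      apply (@veval_same X env e f);
      cbv [vsame vcoef Nat.eqb]; repeat split; field
  end.

Lemma bnorm_zero (X : Banach) : bnorm (@bzero X) = 0.
Proof. rewrite <- (bscal_0 X bzero), bnorm_scal, Rabs_R0; ring. Qed.

Lemma bnorm_opp (X : Banach) (x : X) : bnorm (bopp x) = bnorm x.
Proof. rewrite bopp_scal, bnorm_scal, Rabs_left by lra; ring. Qed.

Lemma bnorm_ge0 (X : Banach) (x : X) : 0 <= bnorm x.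
Proof.
  pose proof (bnorm_triangle X x (bopp x)) as H.
  rewrite badd_opp, bnorm_zero, bnorm_opp in H; lra.
Qed.

Lemma bnorm_sub_sym (X : Banach) (x y : X) : bnorm (bsub x y) = bnorm (bsub y x).
Proof. rewrite <- bnorm_opp; f_equal; vec. Qed.

Lemma bnorm_sub_le (X : Banach) (x y : X) : bnorm (bsub x y) <= bnorm x + bnorm y.
Proof. rewrite <- (bnorm_opp X y); apply bnorm_triangle. Qed.

Lemma bnorm_sub_trans (X : Banach) (x y z : X) :
  bnorm (bsub x z) <= bnorm (bsub x y) + bnorm (bsub y z).
Proof.
  replace (bsub x z) with (badd (bsub x y) (bsub y z)) by vec.
  apply bnorm_triangle.
Qed.

Lemma bnorm_le_sub (X : Banach) (x y : X) : bnorm x <= bnorm y + bnorm (bsub x y).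
Proof.
  replace x with (badd y (bsub x y)) at 1 by vec.
  apply bnorm_triangle.
Qed.

(** * Functionals and dual norms *)

Definition linear_form {X : Banach} (f : X -> R) : Prop :=
  (forall x y, f (badd x y) = f x + f y) /\ (forall a x, f (bscal a x) = a * f x).

Definition bounded_by {X : Banach} (f : X -> R) (M : R) : Prop :=
  forall x, Rabs (f x) <= M * bnorm x.

Lemma in_dual_linear (X : Banach) (f : X -> R) : in_dual f -> linear_form f.
Proof. intros [H1 [H2 _]]; split; assumption. Qed.

Lemma in_dual_intro (X : Banach) (f : X -> R) (M : R) :
  linear_form f -> bounded_by f M -> in_dual f.
Proof. intros [H1 H2] H3; repeat split; eauto. Qed.

Lemma linear_form_0 (X : Banach) (f : X -> R) : linear_form f -> f bzero = 0.
Proof. intros [_ H]; rewrite <- (bscal_0 X bzero), H; ring. Qed.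

Lemma linear_form_opp (X : Banach) (f : X -> R) (x : X) :
  linear_form f -> f (bopp x) = - f x.
Proof. intros [_ H]; rewrite bopp_scal, H; ring. Qed.

Lemma linear_form_sub (X : Banach) (f : X -> R) (x y : X) :
  linear_form f -> f (bsub x y) = f x - f y.
Proof.
  intros H; unfold bsub; rewrite (proj1 H), linear_form_opp by exact H; ring.
Qed.

Lemma linear_form_comb (X : Banach) (f g : X -> R) (a b : R) :
  linear_form f -> linear_form g -> linear_form (fun x => a * f x + b * g x).
Proof.
  intros [F1 F2] [G1 G2]; split; intros.
  - rewrite F1, G1; ring.
  - rewrite F2, G2; ring.
Qed.

Lemma linear_form_plus (X : Banach) (f g : X -> R) :
  linear_form f -> linear_form g -> linear_form (fun x => f x + g x).
Proof.
  intros [F1 F2] [G1 G2]; split; intros.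
  - rewrite F1, G1; ring.
  - rewrite F2, G2; ring.
Qed.

Lemma linear_form_minus (X : Banach) (f g : X -> R) :
  linear_form f -> linear_form g -> linear_form (fun x => f x - g x).
Proof.
  intros [F1 F2] [G1 G2]; split; intros.
  - rewrite F1, G1; ring.
  - rewrite F2, G2; ring.
Qed.

Lemma linear_form_neg (X : Banach) (f : X -> R) :
  linear_form f -> linear_form (fun x => - f x).
Proof.
  intros [F1 F2]; split; intros.
  - rewrite F1; ring.
  - rewrite F2; ring.
Qed.

Lemma bounded_by_plus (X : Banach) (f g : X -> R) (M N : R) :
  bounded_by f M -> bounded_by g N -> bounded_by (fun x => f x + g x) (M + N).
Proof.
  intros F G x; specialize (F x); specialize (G x).
  pose proof (Rabs_triang (f x) (g x)); lra.
Qed.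

Lemma bounded_by_minus (X : Banach) (f g : X -> R) (M N : R) :
  bounded_by f M -> bounded_by g N -> bounded_by (fun x => f x - g x) (M + N).
Proof.
  intros F G x; specialize (F x); specialize (G x).
  pose proof (Rabs_triang (f x) (- g x)) as H; rewrite Rabs_Ropp in H.
  unfold Rminus; lra.
Qed.

Lemma bounded_by_neg (X : Banach) (f : X -> R) (M : R) :
  bounded_by f M -> bounded_by (fun x => - f x) M.
Proof. intros F x; rewrite Rabs_Ropp; apply F. Qed.

Lemma bounded_by_weaken (X : Banach) (f : X -> R) (M N : R) :
  M <= N -> bounded_by f M -> bounded_by f N.
Proof.
  intros H F x; specialize (F x); pose proof (bnorm_ge0 X x); nra.
Qed.

Lemma in_dual_plus (X : Banach) (f g : X -> R) :
  in_dual f -> in_dual g -> in_dual (fun x => f x + g x).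
Proof.
  intros F G; pose proof (in_dual_linear _ _ F); pose proof (in_dual_linear _ _ G).
  destruct F as [_ [_ [C F]]], G as [_ [_ [D G]]].
  apply in_dual_intro with (C + D);
    [apply linear_form_plus | apply bounded_by_plus]; assumption.
Qed.

Lemma in_dual_neg (X : Banach) (f : X -> R) : in_dual f -> in_dual (fun x => - f x).
Proof.
  intros F; pose proof (in_dual_linear _ _ F).
  destruct F as [_ [_ [C F]]].
  apply in_dual_intro with C;
    [apply linear_form_neg | apply bounded_by_neg]; assumption.
Qed.

Lemma in_dual_minus (X : Banach) (f g : X -> R) :
  in_dual f -> in_dual g -> in_dual (fun x => f x - g x).
Proof. intros F G; exact (in_dual_plus _ _ _ F (in_dual_neg _ _ G)). Qed.

Lemma dual_norm_lub (X : Banach) (f : X -> R) : in_dual f ->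
  is_lub (fun t => exists x : X, bnorm x <= 1 /\ t = Rabs (f x)) (dual_norm f).
Proof.
  intros F; unfold dual_norm; apply epsilon_spec.
  pose proof (linear_form_0 _ _ (in_dual_linear _ _ F)) as F0.
  destruct F as [_ [_ [C F]]].
  destruct (completeness (fun t => exists x : X, bnorm x <= 1 /\ t = Rabs (f x)))
    as [r Hr]; [| |exists r; exact Hr].
  - exists (Rabs C); intros t [x [Hx ->]].
    specialize (F x); pose proof (bnorm_ge0 X x).
    pose proof (Rle_abs C); pose proof (Rabs_pos C); nra.
  - exists (Rabs (f bzero)), bzero; rewrite bnorm_zero; split; [lra|reflexivity].
Qed.

Lemma bounded_by_unit (X : Banach) (f : X -> R) (M : R) : linear_form f ->
  (forall x, bnorm x <= 1 -> Rabs (f x) <= M) -> bounded_by f M.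
Proof.
  intros F H x.
  destruct (Req_dec (bnorm x) 0) as [Hx|Hx].
  - rewrite (bnorm_eq0 X x Hx), linear_form_0, Rabs_R0, bnorm_zero by exact F; lra.
  - pose proof (bnorm_ge0 X x) as P.
    assert (Q : bnorm (bscal (/ bnorm x) x) = 1).
    { rewrite bnorm_scal, Rabs_right; [field; exact Hx|].
      apply Rle_ge, Rlt_le, Rinv_0_lt_compat; lra. }
    specialize (H (bscal (/ bnorm x) x)); rewrite Q in H.
    rewrite (proj2 F), Rabs_mult, (Rabs_right (/ bnorm x)) in H
      by (apply Rle_ge, Rlt_le, Rinv_0_lt_compat; lra).
    assert (H1 : / bnorm x * Rabs (f x) <= M) by (apply H; lra).
    apply Rmult_le_compat_r with (r := bnorm x) in H1; [|exact P].
    replace (/ bnorm x * Rabs (f x) * bnorm x) with (Rabs (f x)) in H1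
      by (field; exact Hx).
    exact H1.
Qed.

Lemma dual_norm_bound (X : Banach) (f : X -> R) :
  in_dual f -> bounded_by f (dual_norm f).
Proof.
  intros F; apply bounded_by_unit; [apply in_dual_linear, F|].
  intros x Hx; apply (dual_norm_lub X f F); exists x; split; [exact Hx|reflexivity].
Qed.

Lemma dual_norm_le (X : Banach) (f : X -> R) (M : R) :
  in_dual f -> 0 <= M -> bounded_by f M -> dual_norm f <= M.
Proof.
  intros F HM H; apply (dual_norm_lub X f F); intros t [x [Hx ->]].
  specialize (H x); pose proof (bnorm_ge0 X x); nra.
Qed.

Lemma dual_norm_ge0 (X : Banach) (f : X -> R) : in_dual f -> 0 <= dual_norm f.
Proof.
  intros F; pose proof (linear_form_0 _ _ (in_dual_linear _ _ F)) as F0.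
  apply Rle_trans with (Rabs (f bzero)); [apply Rabs_pos|].
  apply (dual_norm_lub X f F); exists bzero; rewrite bnorm_zero; split; [lra|reflexivity].
Qed.

Definition closed_subspace {X : Banach} (P : X -> Prop) : Prop :=
  (forall x y, P x -> P y -> P (badd x y)) /\
  (forall a x, P x -> P (bscal a x)) /\
  (forall x, (forall eps, eps > 0 -> exists y, P y /\ bnorm (bsub x y) < eps) -> P x).

(** Density of the linear span, phrased as an induction principle. It covers dense sequences and
    Schauder bases alike, and it is the form in which linearity or convergence is propagated from a
    sequence to the whole space. *)
Definition total {X : Banach} (v : nat -> X) : Prop :=
  forall P, closed_subspace P -> (forall n, P (v n)) -> forall x, P x.

Lemma dense_total (X : Banach) (d : nat -> X) :
  (forall x eps, eps > 0 -> exists n, bnorm (bsub x (d n)) < eps) -> total d.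
Proof.
  intros H P [_ [_ C]] Hd x; apply C; intros eps He.
  destruct (H x eps He) as [n Hn]; exists (d n); auto.
Qed.

(** * The Hahn-Banach theorem for spaces with a total sequence *)

Definition Rinf (E : R -> Prop) : R :=
  epsilon (inhabits 0%R)
    (fun m => (forall t, E t -> m <= t) /\ forall b, (forall t, E t -> b <= t) -> b <= m).

Lemma Rinf_spec (E : R -> Prop) (b : R) :
  (exists t, E t) -> (forall t, E t -> b <= t) ->
  (forall t, E t -> Rinf E <= t) /\ forall b', (forall t, E t -> b' <= t) -> b' <= Rinf E.
Proof.
  intros [t0 Ht0] Hb; unfold Rinf; apply epsilon_spec.
  destruct (completeness (fun s => E (- s))) as [m [Hm1 Hm2]].
  - exists (- b); intros s Hs; specialize (Hb _ Hs); lra.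
  - exists (- t0); rewrite Ropp_involutive; exact Ht0.
  - exists (- m); split.
    + intros t Ht; specialize (Hm1 (- t)); cbv beta in Hm1.
      rewrite Ropp_involutive in Hm1; specialize (Hm1 Ht); lra.
    + intros b' Hb'; enough (m <= - b') by lra.
      apply Hm2; intros s Hs; specialize (Hb' _ Hs); lra.
Qed.

(** For positive [a], the inequality with [/ a] gives back the reverse one, so this is full positive
    homogeneity. *)
Definition sublinear {X : Banach} (p : X -> R) : Prop :=
  (forall x y, p (badd x y) <= p x + p y) /\
  (forall a x, 0 <= a -> p (bscal a x) <= a * p x).

Lemma sublinear_0 (X : Banach) (p : X -> R) : sublinear p -> p bzero = 0.
Proof.
  intros [P1 P2].
  pose proof (P1 bzero bzero) as H; rewrite badd_0 in H.
  pose proof (P2 0 bzero (Rle_refl 0)) as H'; rewrite bscal_0 in H'; lra.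
Qed.

Lemma sublinear_opp (X : Banach) (p : X -> R) (x : X) :
  sublinear p -> - p (bopp x) <= p x.
Proof.
  intros P; pose proof (proj1 P x (bopp x)) as H.
  rewrite badd_opp, (sublinear_0 X p P) in H; lra.
Qed.

(* The largest sublinear minorant of [p] that is linear along the line of [v]. *)
Definition hb_step {X : Banach} (p : X -> R) (v x : X) : R :=
  Rinf (fun r => exists t, 0 <= t /\ r = p (badd x (bscal t v)) - t * p v).

(** The infimum is finite: [t * p v <= p (t v) <= p (x + t v) + p (- x)] bounds every term below by
    [- p (- x)]. *)
Lemma hb_step_spec (X : Banach) (p : X -> R) (v x : X) : sublinear p ->
  (forall t, 0 <= t -> hb_step p v x <= p (badd x (bscal t v)) - t * p v) /\
  (forall b, (forall t, 0 <= t -> b <= p (badd x (bscal t v)) - t * p v) ->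
     b <= hb_step p v x).
Proof.
  intros P; unfold hb_step.
  destruct (Rinf_spec
    (fun r => exists t, 0 <= t /\ r = p (badd x (bscal t v)) - t * p v)
    (- p (bopp x))) as [H1 H2].
  - exists (p (badd x (bscal 0 v)) - 0 * p v), 0; split; [lra|reflexivity].
  - intros r [t [Ht ->]].
    pose proof (proj1 P (badd x (bscal t v)) (bopp x)) as H.
    replace (badd (badd x (bscal t v)) (bopp x)) with (bscal t v) in H by vec.
    assert (H' : t * p v <= p (bscal t v)); [|lra].
    destruct (Req_dec t 0) as [->|Ht0].
    + rewrite bscal_0, (sublinear_0 X p P); lra.
    + pose proof (proj2 P (/ t) (bscal t v)) as H'.
      rewrite bscal_assoc, Rinv_l, bscal_1 in H' by exact Ht0.
      assert (Hi : 0 <= / t) by (apply Rlt_le, Rinv_0_lt_compat; lra).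
      specialize (H' Hi).
      apply Rmult_le_compat_l with (r := t) in H'; [|exact Ht].
      rewrite <- Rmult_assoc, Rinv_r, Rmult_1_l in H' by exact Ht0; exact H'.
  - split; [intros t Ht; apply H1; exists t; auto|].
    intros b Hb; apply H2; intros r [t [Ht ->]]; apply Hb, Ht.
Qed.

Lemma hb_step_le (X : Banach) (p : X -> R) (v x : X) :
  sublinear p -> hb_step p v x <= p x.
Proof.
  intros P; pose proof (proj1 (hb_step_spec X p v x P) 0 (Rle_refl 0)) as H.
  rewrite bscal_0, badd_0 in H; lra.
Qed.

(** The term [t = 1] of the infimum at [- v] is [p 0 - p v]. Since the new functional is at most
    [p v] at [v], it is odd along the line of [v]. *)
Lemma hb_step_opp (X : Banach) (p : X -> R) (v : X) :
  sublinear p -> hb_step p v (bopp v) <= - p v.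
Proof.
  intros P; pose proof (proj1 (hb_step_spec X p v (bopp v) P) 1) as H.
  replace (badd (bopp v) (bscal 1 v)) with (@bzero X) in H by vec.
  rewrite (sublinear_0 X p P) in H; specialize (H ltac:(lra)); lra.
Qed.

Lemma hb_step_sublinear (X : Banach) (p : X -> R) (v : X) :
  sublinear p -> sublinear (hb_step p v).
Proof.
  intros P; split.
  - intros x y.
    enough (hb_step p v (badd x y) - hb_step p v x <= hb_step p v y) by lra.
    apply (hb_step_spec X p v y P); intros t Ht.
    enough (hb_step p v (badd x y) - (p (badd y (bscal t v)) - t * p v)
            <= hb_step p v x) by lra.
    apply (hb_step_spec X p v x P); intros s Hs.
    pose proof (proj1 (hb_step_spec X p v (badd x y) P) (s + t) ltac:(lra)) as H.
    pose proof (proj1 P (badd x (bscal s v)) (badd y (bscal t v))) as H'.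
    replace (badd (badd x (bscal s v)) (badd y (bscal t v)))
      with (badd (badd x y) (bscal (s + t) v)) in H' by vec.
    lra.
  - intros a x Ha; destruct (Req_dec a 0) as [->|Ha0].
    + rewrite bscal_0; pose proof (hb_step_le X p v bzero P) as H.
      rewrite (sublinear_0 X p P) in H; lra.
    + enough (H : / a * hb_step p v (bscal a x) <= hb_step p v x).
      { apply Rmult_le_compat_l with (r := a) in H; [|exact Ha].
        rewrite <- Rmult_assoc, Rinv_r, Rmult_1_l in H by exact Ha0; exact H. }
      apply (hb_step_spec X p v x P); intros t Ht.
      pose proof (proj1 (hb_step_spec X p v (bscal a x) P) (a * t) ltac:(nra)) as H.
      pose proof (proj2 P a (badd x (bscal t v)) Ha) as H'.
      replace (bscal a (badd x (bscal t v)))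
        with (badd (bscal a x) (bscal (a * t) v)) in H' by vec.
      apply Rmult_le_reg_l with a; [lra|].
      rewrite <- Rmult_assoc, Rinv_r, Rmult_1_l by exact Ha0; lra.
Qed.

Fixpoint hb_seq {X : Banach} (p : X -> R) (v : nat -> X) (n : nat) : X -> R :=
  match n with
  | O => p
  | S k => hb_step (hb_seq p v k) (v k)
  end.

Lemma hb_seq_sublinear (X : Banach) (p : X -> R) (v : nat -> X) (n : nat) :
  sublinear p -> sublinear (hb_seq p v n).
Proof. intros P; induction n; simpl; [exact P|apply hb_step_sublinear, IHn]. Qed.

Lemma hb_seq_decr (X : Banach) (p : X -> R) (v : nat -> X) (x : X) (m n : nat) :
  sublinear p -> (m <= n)%nat -> hb_seq p v n x <= hb_seq p v m x.
Proof.
  intros P H; induction H as [|n H IH]; [lra|].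
  apply Rle_trans with (2 := IH); simpl; apply hb_step_le, hb_seq_sublinear, P.
Qed.

(** Linearising along [v 0, v 1, ...] in turn and taking the infimum [q] of the decreasing sequence
    gives a sublinear minorant with [q (v n) + q (- v n) <= 0] for all [n]. The bound by [C] makes
    [q] Lipschitz, so the vectors with [q x + q (- x) <= 0] form a closed subspace. By totality [q]
    is odd, and an odd sublinear functional is linear. *)
Lemma hahn_banach (X : Banach) (v : nat -> X) (p : X -> R) (C : R) :
  total v -> sublinear p -> (forall x, p x <= C * bnorm x) ->
  exists f, linear_form f /\ forall x, f x <= p x.
Proof.
  intros V P PC.
  set (q := fun x => Rinf (fun r => exists n, r = hb_seq p v n x)).
  assert (Q : forall x, (forall n, q x <= hb_seq p v n x) /\
    (forall b, (forall n, b <= hb_seq p v n x) -> b <= q x)).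
  { intros x; destruct (Rinf_spec (fun r => exists n, r = hb_seq p v n x) (- p (bopp x)))
      as [H1 H2].
    - exists (p x), O; reflexivity.
    - intros r [n ->].
      pose proof (sublinear_opp X _ x (hb_seq_sublinear X p v n P)).
      pose proof (hb_seq_decr X p v (bopp x) 0 n P ltac:(lia)) as H'; simpl in H'; lra.
    - split; [intros n; apply H1; exists n; reflexivity|].
      intros b Hb; apply H2; intros r [n ->]; apply Hb. }
  assert (QP : forall x, q x <= p x) by (intros x; exact (proj1 (Q x) O)).
  assert (S : sublinear q).
  { split.
    - intros x y; enough (q (badd x y) - q x <= q y) by lra.
      apply (Q y); intros n; enough (q (badd x y) - hb_seq p v n y <= q x) by lra.
      apply (Q x); intros m.
      pose proof (proj1 (Q (badd x y)) (Nat.max m n)).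
      pose proof (proj1 (hb_seq_sublinear X p v (Nat.max m n) P) x y).
      pose proof (hb_seq_decr X p v x m (Nat.max m n) P ltac:(lia)).
      pose proof (hb_seq_decr X p v y n (Nat.max m n) P ltac:(lia)); lra.
    - intros a x Ha; destruct (Req_dec a 0) as [->|Ha0].
      + rewrite bscal_0; specialize (QP bzero).
        rewrite (sublinear_0 X p P) in QP; lra.
      + enough (H : / a * q (bscal a x) <= q x).
        { apply Rmult_le_compat_l with (r := a) in H; [|exact Ha].
          rewrite <- Rmult_assoc, Rinv_r, Rmult_1_l in H by exact Ha0; exact H. }
        apply (Q x); intros n.
        pose proof (proj1 (Q (bscal a x)) n).
        pose proof (proj2 (hb_seq_sublinear X p v n P) a x Ha).
        apply Rmult_le_reg_l with a; [lra|].
        rewrite <- Rmult_assoc, Rinv_r, Rmult_1_l by exact Ha0; lra. }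
  assert (C0 : forall x, q x <= Rabs C * bnorm x).
  { intros x; pose proof (QP x); pose proof (PC x); pose proof (Rle_abs C).
    pose proof (bnorm_ge0 X x); nra. }
  assert (L : forall x, q x + q (bopp x) <= 0).
  { apply V.
    - split; [|split].
      + intros x y Hx Hy; pose proof (proj1 S x y).
        pose proof (proj1 S (bopp x) (bopp y)) as H'.
        replace (badd (bopp x) (bopp y)) with (bopp (badd x y)) in H' by vec; lra.
      + intros a x Hx; destruct (Rle_or_lt 0 a) as [Ha|Ha].
        * pose proof (proj2 S a x Ha); pose proof (proj2 S a (bopp x) Ha) as H'.
          replace (bscal a (bopp x)) with (bopp (bscal a x)) in H' by vec; nra.
        * pose proof (proj2 S (- a) (bopp x) ltac:(lra)) as H.
          pose proof (proj2 S (- a) x ltac:(lra)) as H'.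
          replace (bscal (- a) (bopp x)) with (bscal a x) in H by vec.
          replace (bscal (- a) x) with (bopp (bscal a x)) in H' by vec; nra.
      + intros x H; apply Rnot_lt_le; intro N.
        pose proof (Rabs_pos C).
        destruct (H ((q x + q (bopp x)) / (2 * Rabs C + 1))) as [y [Hy Hxy]].
        { apply Rdiv_lt_0_compat; lra. }
        pose proof (proj1 S y (bsub x y)) as H1.
        replace (badd y (bsub x y)) with x in H1 by vec.
        pose proof (proj1 S (bopp y) (bsub y x)) as H2.
        replace (badd (bopp y) (bsub y x)) with (bopp x) in H2 by vec.
        pose proof (C0 (bsub x y)) as Ha; pose proof (C0 (bsub y x)) as Hb.
        rewrite bnorm_sub_sym in Hb.
        apply Rmult_lt_compat_l with (r := 2 * Rabs C + 1) in Hxy; [|lra].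
        replace ((2 * Rabs C + 1) * ((q x + q (bopp x)) / (2 * Rabs C + 1)))
          with (q x + q (bopp x)) in Hxy by (field; lra).
        pose proof (bnorm_ge0 X (bsub x y)); lra.
    - intros n; pose proof (proj1 (Q (bopp (v n))) (Datatypes.S n)) as H1.
      simpl in H1.
      pose proof (hb_step_opp X _ (v n) (hb_seq_sublinear X p v n P)).
      pose proof (proj1 (Q (v n)) n); lra. }
  assert (O : forall x, q (bopp x) = - q x).
  { intros x; pose proof (L x); pose proof (sublinear_opp X q x S); lra. }
  exists q; split; [split|exact QP].
  - intros x y; apply Rle_antisym; [apply S|].
    pose proof (proj1 S (bopp x) (bopp y)) as H.
    replace (badd (bopp x) (bopp y)) with (bopp (badd x y)) in H by vec.
    rewrite !O in H; lra.
  - assert (A : forall a x, 0 <= a -> q (bscal a x) = a * q x).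
    { intros a x Ha; apply Rle_antisym; [apply S, Ha|].
      pose proof (proj2 S a (bopp x) Ha) as H.
      replace (bscal a (bopp x)) with (bopp (bscal a x)) in H by vec.
      rewrite !O in H; lra. }
    intros a x; destruct (Rle_or_lt 0 a) as [Ha|Ha]; [apply A, Ha|].
    replace (bscal a x) with (bopp (bscal (- a) x)) by vec.
    rewrite O, A by lra; ring.
Qed.

Lemma bounded_by_of_le (X : Banach) (f : X -> R) (C : R) :
  linear_form f -> (forall x, f x <= C * bnorm x) -> bounded_by f C.
Proof.
  intros L H x; apply Rabs_le; split; [|apply H].
  specialize (H (bopp x)); rewrite linear_form_opp, bnorm_opp in H by exact L; lra.
Qed.

(** One linearisation of the norm along [x] already has value at most [- bnorm x] at [- x]; every
    linear functional below it is forced to norm [x]. *)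
Lemma norming_functional (X : Banach) (v : nat -> X) (x : X) : total v ->
  exists f, linear_form f /\ bounded_by f 1 /\ f x = bnorm x.
Proof.
  intros V.
  assert (N : sublinear (@bnorm X)).
  { split; [apply bnorm_triangle|].
    intros a y Ha; rewrite bnorm_scal, Rabs_right; lra. }
  destruct (hahn_banach X v (hb_step bnorm x) 1) as [f [L H]].
  - exact V.
  - apply hb_step_sublinear, N.
  - intros y; rewrite Rmult_1_l; apply hb_step_le, N.
  - assert (B : forall y, f y <= 1 * bnorm y).
    { intros y; specialize (H y); pose proof (hb_step_le X _ x y N); lra. }
    exists f; split; [exact L|split; [apply bounded_by_of_le; assumption|]].
    apply Rle_antisym; [specialize (B x); lra|].
    specialize (H (bopp x)); rewrite linear_form_opp in H by exact L.
    pose proof (hb_step_opp X _ x N); lra.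
Qed.

(** The sublinear functional is the infimum over [x] of [K * M * ||y - T x|| + g x]. Taking [x = 0]
    bounds it by [K * M * ||y||], and [y = T x] bounds it by [g x] on the range, so a linear
    minorant extends [g]. It is finite because [M] bounds the inverse of [T], so that
    [g x >= - K * M * ||T x||]. *)
Lemma functional_extension (X Y : Banach) (v : nat -> Y) (T : X -> Y) (g : X -> R) (M K : R) :
  total v -> is_linear T -> (forall x, bnorm x <= M * bnorm (T x)) ->
  linear_form g -> bounded_by g K -> 0 <= K -> 0 <= M ->
  exists f, linear_form f /\ bounded_by f (K * M) /\ forall x, f (T x) = g x.
Proof.
  intros V [T1 T2] TM G GK HK HM.
  assert (T0 : T bzero = bzero) by (rewrite <- (bscal_0 X bzero), T2; apply bscal_0).
  set (E := fun y r => exists x, r = K * M * bnorm (bsub y (T x)) + g x).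
  assert (Q : forall y, (forall x, Rinf (E y) <= K * M * bnorm (bsub y (T x)) + g x) /\
    (forall b, (forall x, b <= K * M * bnorm (bsub y (T x)) + g x) -> b <= Rinf (E y))).
  { intros y; destruct (Rinf_spec (E y) (- (K * M * bnorm y))) as [H1 H2].
    - exists (K * M * bnorm (bsub y (T bzero)) + g bzero), bzero; reflexivity.
    - intros r [x ->].
      pose proof (GK x) as H1; pose proof (TM x) as H2.
      pose proof (bnorm_le_sub Y (T x) y) as H3; rewrite bnorm_sub_sym in H3.
      pose proof (Rle_abs (- g x)) as H4; rewrite Rabs_Ropp in H4.
      apply Rmult_le_compat_l with (r := K) in H2; [|exact HK].
      apply Rmult_le_compat_l with (r := K * M) in H3; [|nra]. nra.
    - split; [intros x; apply H1; exists x; reflexivity|].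
      intros b Hb; apply H2; intros r [x ->]; apply Hb. }
  assert (U : forall y, Rinf (E y) <= K * M * bnorm y).
  { intros y; pose proof (proj1 (Q y) bzero) as H.
    rewrite T0, linear_form_0, Rplus_0_r in H by exact G.
    replace (bsub y bzero) with y in H by vec; exact H. }
  destruct (hahn_banach Y v (fun y => Rinf (E y)) (K * M)) as [f [L F]].
  - exact V.
  - split.
    + intros y z; enough (Rinf (E (badd y z)) - Rinf (E y) <= Rinf (E z)) by lra.
      apply (Q z); intros x.
      enough (Rinf (E (badd y z)) - (K * M * bnorm (bsub z (T x)) + g x)
              <= Rinf (E y)) by lra.
      apply (Q y); intros w.
      pose proof (proj1 (Q (badd y z)) (badd w x)) as H.
      rewrite T1, (proj1 G) in H.
      pose proof (bnorm_triangle Y (bsub y (T w)) (bsub z (T x))) as H'.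
      replace (badd (bsub y (T w)) (bsub z (T x)))
        with (bsub (badd y z) (badd (T w) (T x))) in H' by vec.
      apply Rmult_le_compat_l with (r := K * M) in H'; [|nra]. lra.
    + intros a y Ha; destruct (Req_dec a 0) as [->|Ha0].
      * rewrite bscal_0; specialize (U bzero); rewrite bnorm_zero in U; lra.
      * enough (H : / a * Rinf (E (bscal a y)) <= Rinf (E y)).
        { apply Rmult_le_compat_l with (r := a) in H; [|exact Ha].
          rewrite <- Rmult_assoc, Rinv_r, Rmult_1_l in H by exact Ha0; exact H. }
        apply (Q y); intros x.
        pose proof (proj1 (Q (bscal a y)) (bscal a x)) as H.
        rewrite T2, (proj2 G) in H.
        replace (bsub (bscal a y) (bscal a (T x)))
          with (bscal a (bsub y (T x))) in H by vec.
        rewrite bnorm_scal, Rabs_right in H by lra.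
        apply Rmult_le_reg_l with a; [lra|].
        rewrite <- Rmult_assoc, Rinv_r, Rmult_1_l by exact Ha0; lra.
  - exact U.
  - assert (FT : forall x, f (T x) <= g x).
    { intros x; pose proof (F (T x)); pose proof (proj1 (Q (T x)) x) as H'.
      replace (bsub (T x) (T x)) with (@bzero Y) in H' by vec.
      rewrite bnorm_zero in H'; lra. }
    exists f; split; [exact L|split].
    + apply bounded_by_of_le; [exact L|].
      intros y; specialize (F y); specialize (U y); cbv beta in F; lra.
    + intros x; apply Rle_antisym; [apply FT|].
      specialize (FT (bopp x)); rewrite (linear_form_opp X g) in FT by exact G.
      rewrite bopp_scal, T2, (proj2 L) in FT; lra.
Qed.

(** * Weak-star sequential compactness and uniform boundedness *)

Definition extraction (phi : nat -> nat) : Prop := forall n, (phi n < phi (S n))%nat.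

Lemma extraction_ge (phi : nat -> nat) (n : nat) : extraction phi -> (n <= phi n)%nat.
Proof. intros H; induction n; [lia|]; specialize (H n); lia. Qed.

Lemma bounded_subsequence (u : nat -> R) (B : R) : (forall n, Rabs (u n) <= B) ->
  exists phi, extraction phi /\ exists l, Un_cv (fun n => u (phi n)) l.
Proof.
  intros H.
  destruct (Bolzano_Weierstrass u (fun c => - B <= c <= B)) as [l Hl].
  - apply compact_P3.
  - intros n; specialize (H n); pose proof (Rle_abs (u n)).
    pose proof (Rle_abs (- u n)) as H'; rewrite Rabs_Ropp in H'; lra.
  - assert (C : forall k N, exists p, (N <= p)%nat /\ Rabs (u p - l) < / INR (S k)).
    { intros k N.
      destruct (Hl (fun y => Rabs (y - l) < / INR (S k)) N) as [p Hp].
      - assert (P : 0 < / INR (S k)) by (apply Rinv_0_lt_compat, lt_0_INR; lia).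
        exists (mkposreal _ P); intros y Hy; exact Hy.
      - exists p; exact Hp. }
    set (c := fun k N => proj1_sig (constructive_indefinite_description _ (C k N))).
    assert (Hc : forall k N, (N <= c k N)%nat /\ Rabs (u (c k N) - l) < / INR (S k)).
    { intros k N; exact (proj2_sig (constructive_indefinite_description _ (C k N))). }
    set (phi := fix phi k := match k with
                             | O => c O O | S j => c (S j) (S (phi j)) end).
    exists phi; split; [intros n; exact (proj1 (Hc (S n) (S (phi n))))|].
    exists l; intros eps He.
    destruct (archimed_cor1 eps He) as [N [HN HN0]].
    exists N; intros n Hn.
    assert (Hp : Rabs (u (phi n) - l) < / INR (S n)).
    { destruct n; [exact (proj2 (Hc O O))|exact (proj2 (Hc (S n) (S (phi n))))]. }
    apply Rlt_trans with (1 := Hp), Rle_lt_trans with (2 := HN).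
    apply Rinv_le_contravar; [apply lt_0_INR; lia|apply le_INR; lia].
Qed.

Lemma diagonal_subsequence (u : nat -> nat -> R) (B : nat -> R) :
  (forall k n, Rabs (u k n) <= B k) ->
  exists phi, extraction phi /\ forall k, exists l, Un_cv (fun n => u k (phi n)) l.
Proof.
  intros H.
  assert (C : forall k psi, exists phi, extraction phi /\
    exists l, Un_cv (fun n => u k (psi (phi n))) l).
  { intros k psi.
    apply (bounded_subsequence (fun n => u k (psi n)) (B k)); intros n; apply H. }
  set (c := fun k psi => proj1_sig (constructive_indefinite_description _ (C k psi))).
  assert (Hc : forall k psi, extraction (c k psi) /\
    exists l, Un_cv (fun n => u k (psi (c k psi n))) l).
  { intros k psi; exact (proj2_sig (constructive_indefinite_description _ (C k psi))). }
  set (Phi := fix Phi k := match k with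
              | O => c O (fun n => n) | S j => fun n => Phi j (c (S j) (Phi j) n) end).
  assert (HPhi : forall k, extraction (Phi k) /\ exists l, Un_cv (fun n => u k (Phi k n)) l).
  { induction k as [|k [IH _]]; [exact (Hc O (fun n => n))|].
    destruct (Hc (S k) (Phi k)) as [H1 H2]; split; [|exact H2].
    intros n; simpl; specialize (H1 n).
    revert H1; generalize (c (S k) (Phi k) n), (c (S k) (Phi k) (S n)).
    intros a b Hab; induction Hab as [|b Hab IHab]; [apply IH|].
    apply Nat.lt_trans with (1 := IHab), IH. }
  (* Entries of a later extraction occur in each earlier one at an index at least as large; hence
     the diagonal inherits every limit. *)
  assert (HS : forall k j m, exists m', (m <= m')%nat /\ Phi (k + j)%nat m = Phi k m').
  { intros k j; induction j as [|j IHj]; intros m.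
    - exists m; rewrite Nat.add_0_r; auto.
    - rewrite Nat.add_succ_r; simpl.
      destruct (IHj (c (S (k + j)) (Phi (k + j)%nat) m)) as [m' [Hm' E]].
      exists m'; split; [|exact E].
      apply Nat.le_trans with (2 := Hm'), extraction_ge, Hc. }
  exists (fun n => Phi n n); split.
  - intros n; simpl.
    apply Nat.lt_le_trans with (Phi n (S n)); [apply HPhi|].
    set (m := c (S n) (Phi n) (S n)).
    assert (Hm : (S n <= m)%nat) by (apply extraction_ge, Hc).
    clearbody m; induction Hm as [|m Hm IH]; [lia|].
    pose proof (proj1 (HPhi n) m); lia.
  - intros k; destruct (HPhi k) as [_ [l Hl]]; exists l.
    intros eps He; destruct (Hl eps He) as [N HN]; exists (Nat.max N k); intros n Hn.
    destruct (HS k (n - k)%nat n) as [m' [Hm' E]].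
    replace (k + (n - k))%nat with n in E by lia.
    rewrite E; apply HN; lia.
Qed.

Lemma Un_cv_lin (u v : nat -> R) (a b l m : R) :
  Un_cv u l -> Un_cv v m -> Un_cv (fun n => a * u n + b * v n) (a * l + b * m).
Proof.
  assert (K : forall c w z, Un_cv w z -> Un_cv (fun n => c * w n) (c * z)).
  { intros c w z Hw; apply (CV_mult (fun _ => c) w c z); [|exact Hw].
    intros eps He; exists O; intros n _.
    unfold Rdist; rewrite Rminus_diag, Rabs_R0; exact He. }
  intros Hu Hv; apply (CV_plus (fun n => a * u n) (fun n => b * v n)); apply K; assumption.
Qed.

Lemma Un_cv_ext (u v : nat -> R) (l : R) : (forall n, u n = v n) -> Un_cv u l -> Un_cv v l.
Proof.
  intros E H eps He; destruct (H eps He) as [N HN]; exists N; intros n Hn.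
  rewrite <- E; apply HN, Hn.
Qed.

Lemma Un_cv_const (a : R) : Un_cv (fun _ => a) a.
Proof.
  intros eps He; exists O; intros n _; unfold Rdist; rewrite Rminus_diag, Rabs_R0; exact He.
Qed.

Lemma Un_cv_abs_le (u : nat -> R) (l a M : R) :
  Un_cv u l -> (exists N, forall n, (n >= N)%nat -> Rabs (u n - a) <= M) -> Rabs (l - a) <= M.
Proof.
  intros H [N HN]; apply Rnot_lt_le; intro C.
  destruct (H (Rabs (l - a) - M)) as [N' HN']; [lra|].
  specialize (HN (Nat.max N N') ltac:(lia)); specialize (HN' (Nat.max N N') ltac:(lia)).
  unfold Rdist in HN'; rewrite Rabs_minus_sym in HN'.
  pose proof (Rabs_triang (l - u (Nat.max N N')) (u (Nat.max N N') - a)) as T.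
  replace (l - u (Nat.max N N') + (u (Nat.max N N') - a)) with (l - a) in T by ring; lra.
Qed.

(** Equiboundedness allows a three-epsilon argument, so weak-star convergence of bounded sequences
    need only be checked on a total sequence. *)
Lemma equibounded_cv_closed (X : Banach) (f : nat -> X -> R) (g : X -> R) (M : R) :
  (forall n, linear_form (f n)) -> (forall n, bounded_by (f n) M) ->
  linear_form g -> bounded_by g M ->
  closed_subspace (fun x => Un_cv (fun n => f n x) (g x)).
Proof.
  intros FL FB GL GB; split; [|split].
  - intros x y Hx Hy; rewrite (proj1 GL).
    apply Un_cv_ext with (fun n => f n x + f n y); [|apply CV_plus; assumption].
    intros n; symmetry; apply FL.
  - intros a x Hx; rewrite (proj2 GL).
    apply Un_cv_ext with (fun n => a * f n x + 0 * f n x).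
    { intros n; rewrite (proj2 (FL n)); ring. }
    replace (a * g x) with (a * g x + 0 * g x) by ring.
    apply Un_cv_lin; exact Hx.
  - intros x H eps He; pose proof (Rabs_pos M); pose proof (Rle_abs M).
    destruct (H (eps / (2 * (2 * Rabs M + 1)))) as [y [Hy Hxy]].
    { apply Rdiv_lt_0_compat; lra. }
    destruct (Hy (eps / 2)) as [N HN]; [lra|].
    exists N; intros n Hn; specialize (HN n Hn); unfold Rdist in *.
    pose proof (FB n (bsub x y)) as HF; rewrite (linear_form_sub _ _ _ _ (FL n)) in HF.
    pose proof (GB (bsub x y)) as HG; rewrite (linear_form_sub _ _ _ _ GL) in HG.
    apply Rmult_lt_compat_l with (r := 2 * Rabs M + 1) in Hxy; [|lra].
    replace ((2 * Rabs M + 1) * (eps / (2 * (2 * Rabs M + 1)))) with (eps / 2) in Hxy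
      by (field; lra).
    pose proof (bnorm_ge0 X (bsub x y)).
    pose proof (Rabs_triang (f n x - f n y) (f n y - g y)) as T1.
    pose proof (Rabs_triang (f n x - f n y + (f n y - g y)) (- (g x - g y))) as T2.
    rewrite Rabs_Ropp in T2.
    replace (f n x - f n y + (f n y - g y) + - (g x - g y)) with (f n x - g x) in T2 by ring.
    nra.
Qed.

(** Sequential Banach-Alaoglu: a diagonal extraction converges on [v], and the points where the
    extracted functionals are Cauchy form a closed subspace. *)
Lemma weak_star_compact (X : Banach) (v : nat -> X) (f : nat -> X -> R) (M : R) :
  total v -> 0 <= M -> (forall n, linear_form (f n)) -> (forall n, bounded_by (f n) M) ->
  exists phi g, extraction phi /\ linear_form g /\ bounded_by g M /\
    forall x, Un_cv (fun n => f (phi n) x) (g x).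
Proof.
  intros V HM FL FB.
  destruct (diagonal_subsequence (fun k n => f n (v k)) (fun k => M * bnorm (v k)))
    as [phi [Hphi Hv]]; [intros k n; apply FB|].
  assert (Cx : forall x, exists l, Un_cv (fun n => f (phi n) x) l).
  { intros x; enough (K : Cauchy_crit (fun n => f (phi n) x)).
    { destruct (R_complete _ K) as [l Hl]; exists l; exact Hl. }
    revert x; apply V.
    - split; [|split].
      + intros x y Hx Hy; apply CV_Cauchy.
        destruct (R_complete _ Hx) as [l Hl], (R_complete _ Hy) as [m Hm].
        exists (l + m); apply Un_cv_ext with (fun n => f (phi n) x + f (phi n) y);
          [intros n; symmetry; apply FL|apply CV_plus; assumption].
      + intros a x Hx; apply CV_Cauchy; destruct (R_complete _ Hx) as [l Hl].
        exists (a * l + 0 * l).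
        apply Un_cv_ext with (fun n => a * f (phi n) x + 0 * f (phi n) x);
          [intros n; rewrite (proj2 (FL _)); ring|apply Un_cv_lin; assumption].
      + intros x H eps He.
        destruct (H (eps / (4 * (M + 1)))) as [y [Hy Hxy]]; [apply Rdiv_lt_0_compat; lra|].
        destruct (Hy (eps / 2)) as [N HN]; [lra|].
        exists N; intros n m Hn Hm; specialize (HN n m Hn Hm); unfold Rdist in *.
        pose proof (FB (phi n) (bsub x y)) as H1.
        pose proof (FB (phi m) (bsub x y)) as H2.
        rewrite (linear_form_sub _ _ _ _ (FL _)) in H1.
        rewrite (linear_form_sub _ _ _ _ (FL _)) in H2.
        apply Rmult_lt_compat_l with (r := M + 1) in Hxy; [|lra].
        replace ((M + 1) * (eps / (4 * (M + 1)))) with (eps / 4) in Hxy by (field; lra).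
        pose proof (bnorm_ge0 X (bsub x y)).
        pose proof (Rabs_triang (f (phi n) x - f (phi n) y) (f (phi n) y - f (phi m) y)) as T1.
        pose proof (Rabs_triang (f (phi n) x - f (phi n) y + (f (phi n) y - f (phi m) y))
          (- (f (phi m) x - f (phi m) y))) as T2.
        rewrite Rabs_Ropp in T2.
        replace (f (phi n) x - f (phi n) y + (f (phi n) y - f (phi m) y)
          + - (f (phi m) x - f (phi m) y)) with (f (phi n) x - f (phi m) x) in T2 by ring.
        nra.
    - intros k; apply CV_Cauchy.
      destruct (constructive_indefinite_description _ (Hv k)) as [l Hl]; exists l; exact Hl. }
  set (g := fun x => proj1_sig (constructive_indefinite_description _ (Cx x))).
  assert (G : forall x, Un_cv (fun n => f (phi n) x) (g x)).
  { intros x; exact (proj2_sig (constructive_indefinite_description _ (Cx x))). }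
  exists phi, g; split; [exact Hphi|split; [|split; [|exact G]]].
  - split.
    + intros x y; apply UL_sequence with (1 := G _).
      apply Un_cv_ext with (fun n => f (phi n) x + f (phi n) y);
        [intros n; symmetry; apply FL|apply CV_plus; apply G].
    + intros a x; apply UL_sequence with (1 := G _).
      replace (a * g x) with (a * g x + 0 * g x) by ring.
      apply Un_cv_ext with (fun n => a * f (phi n) x + 0 * f (phi n) x);
        [intros n; rewrite (proj2 (FL _)); ring|apply Un_cv_lin; apply G].
  - intros x; rewrite <- (Rminus_0_r (g x)).
    apply Un_cv_abs_le with (1 := G x); exists O; intros n _.
    rewrite Rminus_0_r; apply FB.
Qed.

(** A substitute for Baire's theorem: half of each radius pays for the move of the centre and the
    other half contains the next radius, so the closed balls are nested. *)
Lemma nested_balls (X : Banach) (x : nat -> X) (r : nat -> R) :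
  (forall k, 0 < r k) -> (forall k, r (S k) <= r k / 2) ->
  (forall k, bnorm (bsub (x (S k)) (x k)) <= r k / 2) ->
  exists l, forall k, bnorm (bsub l (x k)) <= r k.
Proof.
  intros R0 R1 X1.
  assert (A : forall j k, bnorm (bsub (x (k + j)%nat) (x k)) <= r k).
  { induction j as [|j IH]; intros k.
    - rewrite Nat.add_0_r; replace (bsub (x k) (x k)) with (@bzero X) by vec.
      rewrite bnorm_zero; apply Rlt_le, R0.
    - pose proof (bnorm_sub_trans X (x (k + S j)%nat) (x (S k)) (x k)) as T.
      specialize (IH (S k)); replace (S k + j)%nat with (k + S j)%nat in IH by lia.
      pose proof (R1 k); pose proof (X1 k); lra. }
  assert (B : forall k, r k <= r O * (/ 2) ^ k).
  { induction k as [|k IH]; simpl; [lra|]; specialize (R1 k); lra. }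
  assert (C : forall eps, eps > 0 -> exists N, r N < eps).
  { intros eps He.
    destruct (pow_lt_1_zero (/ 2) ltac:(rewrite Rabs_right; lra) (eps / r O)) as [N HN].
    { apply Rdiv_lt_0_compat; [exact He|apply R0]. }
    exists N; apply Rle_lt_trans with (1 := B N).
    specialize (HN N ltac:(lia)); pose proof (Rle_abs ((/ 2) ^ N)).
    specialize (R0 O); apply Rmult_lt_reg_r with (/ r O); [apply Rinv_0_lt_compat; lra|].
    replace (r O * (/ 2) ^ N * / r O) with ((/ 2) ^ N) by (field; lra).
    unfold Rdiv in HN; lra. }
  destruct (bcomplete X x) as [l Hl].
  { intros eps He; destruct (C (eps / 2)) as [N HN]; [lra|].
    exists N; intros m n Hm Hn; fold (bsub (x m) (x n)).
    pose proof (bnorm_sub_trans X (x m) (x N) (x n)) as T.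
    pose proof (A (m - N)%nat N) as H1; replace (N + (m - N))%nat with m in H1 by lia.
    pose proof (A (n - N)%nat N) as H2; replace (N + (n - N))%nat with n in H2 by lia.
    rewrite bnorm_sub_sym in H2; lra. }
  exists l; intros k; apply Rnot_lt_le; intro N.
  destruct (Hl (bnorm (bsub l (x k)) - r k)) as [M HM]; [lra|].
  specialize (HM (k + M)%nat ltac:(lia)); unfold Rdist in HM.
  fold (bsub (x (k + M)%nat) l) in HM.
  rewrite Rminus_0_r, Rabs_right in HM by apply Rle_ge, bnorm_ge0.
  rewrite bnorm_sub_sym in HM; specialize (A M k).
  pose proof (bnorm_sub_trans X l (x (k + M)%nat) (x k)); lra.
Qed.

(** If no common bound exists, every ball contains a smaller one on which some [f n] is at least [k]
    in absolute value. At the common point of such balls for all [k] the values are unbounded. *)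
Lemma uniform_boundedness (X : Banach) (f : nat -> X -> R) :
  (forall n, in_dual (f n)) -> (forall x, exists B, forall n, Rabs (f n x) <= B) ->
  exists M, 0 <= M /\ forall n, bounded_by (f n) M.
Proof.
  intros FD FB; apply NNPP; intro N.
  assert (St : forall (k : nat) (s : X * R), exists s' : X * R, 0 < snd s ->
    0 < snd s' /\ snd s' <= snd s / 2 /\ bnorm (bsub (fst s') (fst s)) <= snd s / 2 /\
    exists n, forall y, bnorm (bsub y (fst s')) <= snd s' -> INR k <= Rabs (f n y)).
  { intros k [x r]; simpl.
    destruct (Rlt_or_le 0 r) as [Hr|Hr]; [|exists (x, r); lra].
    pose proof (pos_INR k) as Hk.
    (* The constant is such that a vector violating it, rescaled to norm [r / 2], has value above
       [k + 1]. *)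
    assert (Hn : exists n, ~ bounded_by (f n) (2 / r * (INR k + 1))).
    { apply NNPP; intro H; apply N; exists (2 / r * (INR k + 1)); split.
      - apply Rmult_le_pos; [apply Rlt_le, Rdiv_lt_0_compat|]; lra.
      - intros n; apply NNPP; intro H'; apply H; exists n; exact H'. }
    destruct Hn as [n Hn]; apply not_all_ex_not in Hn; destruct Hn as [y Hy].
    apply Rnot_le_lt in Hy.
    pose proof (in_dual_linear _ _ (FD n)) as L.
    assert (Py : 0 < bnorm y).
    { destruct (bnorm_ge0 X y) as [H|H]; [exact H|].
      rewrite (bnorm_eq0 X y (eq_sym H)), (linear_form_0 X _ L), Rabs_R0, bnorm_zero in Hy.
      lra. }
    set (a := r / (2 * bnorm y)).
    assert (Ha : 0 < a) by (apply Rdiv_lt_0_compat; lra).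
    assert (Hz : INR k + 1 < Rabs (f n (bscal a y))).
    { rewrite (proj2 L), Rabs_mult, (Rabs_right a) by lra.
      apply Rmult_lt_compat_l with (r := a) in Hy; [|exact Ha].
      replace (a * (2 / r * (INR k + 1) * bnorm y)) with (INR k + 1) in Hy
        by (unfold a; field; lra); exact Hy. }
    assert (Nz : bnorm (bscal a y) = r / 2).
    { rewrite bnorm_scal, Rabs_right by lra; unfold a; field; lra. }
    (* One of [x + z] and [x - z], with [z] the rescaled vector, keeps the value of [z], because
       [f n z] is half the difference of the values at these two points. *)
    assert (Hw : exists w, bnorm (bsub w x) = r / 2 /\ INR k + 1 < Rabs (f n w)).
    { destruct (Rlt_or_le (INR k + 1) (Rabs (f n (badd x (bscal a y))))) as [H|H].
      - exists (badd x (bscal a y)); split; [|exact H].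
        rewrite <- Nz; f_equal; vec.
      - exists (bsub x (bscal a y)); split.
        + rewrite <- Nz, <- (bnorm_opp X (bscal a y)); f_equal; vec.
        + rewrite (proj1 L) in H; rewrite linear_form_sub by exact L.
          revert Hz H; unfold Rabs; repeat destruct Rcase_abs; lra. }
    destruct Hw as [w [Hw1 Hw2]].
    set (D := dual_norm (f n)).
    pose proof (dual_norm_ge0 _ _ (FD n)) as HD; fold D in HD.
    (* On a ball of radius [/ (D + 1)] the functional varies by at most 1, which uses up the surplus
       in [k + 1]. *)
    exists (w, Rmin (r / 2) (/ (D + 1))); intros _; simpl.
    assert (P : 0 < / (D + 1)) by (apply Rinv_0_lt_compat; lra).
    split; [apply Rmin_glb_lt; lra|].
    split; [apply Rmin_l|split; [lra|]].
    exists n; intros z Hz'.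
    pose proof (dual_norm_bound _ _ (FD n) (bsub w z)) as H; fold D in H.
    rewrite linear_form_sub in H by exact L; rewrite bnorm_sub_sym in H.
    pose proof (Rmin_r (r / 2) (/ (D + 1))).
    assert (D * bnorm (bsub z w) <= 1).
    { pose proof (bnorm_ge0 X (bsub z w)).
      apply Rle_trans with ((D + 1) * / (D + 1)); [|rewrite Rinv_r; lra].
      apply Rmult_le_compat; lra. }
    pose proof (Rabs_triang (f n z) (f n w - f n z)) as T.
    replace (f n z + (f n w - f n z)) with (f n w) in T by ring; lra. }
  set (nx := fun k s => proj1_sig (constructive_indefinite_description _ (St k s))).
  assert (Hnx := fun k s => proj2_sig (constructive_indefinite_description _ (St k s))).
  set (sq := fix sq k := match k with O => (@bzero X, 1) | S j => nx j (sq j) end).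
  assert (Pos : forall k, 0 < snd (sq k)).
  { induction k as [|k IH]; [simpl; lra|]. exact (proj1 (Hnx k (sq k) IH)). }
  destruct (nested_balls X (fun k => fst (sq k)) (fun k => snd (sq k))) as [l Hl].
  - exact Pos.
  - intros k; exact (proj1 (proj2 (Hnx k (sq k) (Pos k)))).
  - intros k; exact (proj1 (proj2 (proj2 (Hnx k (sq k) (Pos k))))).
  - destruct (FB l) as [B HB].
    destruct (INR_unbounded B) as [k Hk].
    destruct (proj2 (proj2 (proj2 (Hnx k (sq k) (Pos k))))) as [n Hn].
    specialize (Hn l (Hl (S k))); specialize (HB n); lra.
Qed.
(** * Almost isometric subspaces of spaces with a shrinking 1-unconditional basis *)

Lemma vsum_ext (X : Banach) (f g : nat -> X) (n : nat) :
  (forall j, (j <= n)%nat -> f j = g j) -> vsum f n = vsum g n.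
Proof.
  induction n as [|n IH]; intros H; simpl; [apply H; lia|].
  rewrite IH, (H (S n)) by auto with arith; reflexivity.
Qed.

Lemma vsum_form (X : Banach) (f : X -> R) (g : nat -> X) (n : nat) :
  linear_form f -> f (vsum g n) = sum_f_R0 (fun j => f (g j)) n.
Proof.
  intros L; induction n as [|n IH]; simpl; [reflexivity|].
  rewrite (proj1 L), IH; reflexivity.
Qed.

Lemma vsum_closed (X : Banach) (P : X -> Prop) (f : nat -> X) (n : nat) :
  closed_subspace P -> (forall j, P (f j)) -> P (vsum f n).
Proof.
  intros C H; induction n as [|n IH]; simpl; [apply H|apply (proj1 C); auto].
Qed.

Lemma sum_indicator (i : nat) (f : nat -> R) (n : nat) :
  sum_f_R0 (fun j => if Nat.eqb j i then f j else 0) n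
  = if Nat.leb i n then f i else 0.
Proof.
  induction n as [|n IH]; [destruct i; reflexivity|].
  rewrite tech5, IH.
  destruct (Nat.eqb_spec (S n) i) as [<-|H];
    [destruct (Nat.leb_spec (S n) n), (Nat.leb_spec (S n) (S n))
    |destruct (Nat.leb_spec i n), (Nat.leb_spec i (S n))]; try lia; ring.
Qed.

Lemma schauder_basis_total (Y : Banach) (e : nat -> Y) (ef : nat -> Y -> R) :
  schauder_basis e ef -> total e.
Proof.
  intros B P C He y; apply C; intros eps Heps.
  destruct (B y) as [H _]; destruct (H eps Heps) as [N HN].
  specialize (HN N (le_n N)); unfold Rdist in HN.
  rewrite Rminus_0_r, Rabs_right in HN by apply Rle_ge, bnorm_ge0.
  exists (vsum (fun j => bscal (ef j y) (e j)) N); split.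
  - apply vsum_closed; [exact C|]; intros j; apply (proj1 (proj2 C)), He.
  - rewrite bnorm_sub_sym; exact HN.
Qed.

Lemma vsum_delta (Y : Banach) (e : nat -> Y) (i n : nat) :
  vsum (fun j => bscal (if Nat.eqb j i then 1 else 0) (e j)) n
  = if Nat.leb i n then e i else bzero.
Proof.
  induction n as [|n IH].
  - simpl; destruct i; simpl; [apply bscal_1|apply bscal_0].
  - change (badd (vsum (fun j => bscal (if Nat.eqb j i then 1 else 0) (e j)) n)
              (bscal (if Nat.eqb (S n) i then 1 else 0) (e (S n)))
            = if Nat.leb i (S n) then e i else bzero).
    rewrite IH.
    destruct (Nat.eqb_spec (S n) i) as [<-|H];
      [destruct (Nat.leb_spec (S n) n), (Nat.leb_spec (S n) (S n))
      |destruct (Nat.leb_spec i n), (Nat.leb_spec i (S n))]; try lia; vec.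
Qed.

Lemma schauder_basis_biorthogonal (Y : Banach) (e : nat -> Y) (ef : nat -> Y -> R) (i j : nat) :
  schauder_basis e ef -> ef j (e i) = if Nat.eqb j i then 1 else 0.
Proof.
  intros B; symmetry; revert j; apply (proj2 (B (e i))).
  intros eps He; exists i; intros n Hn.
  rewrite (vsum_delta Y e i n); destruct (Nat.leb_spec i n); [|lia].
  replace (bsub (e i) (e i)) with (@bzero Y) by vec.
  rewrite bnorm_zero; unfold Rdist; rewrite Rminus_0_r, Rabs_R0; exact He.
Qed.

Lemma vsum_reflect (Y : Banach) (e : nat -> Y) (a : nat -> R) (m N : nat) : (m <= N)%nat ->
  vsum (fun j => bscal ((if Nat.leb j m then 1 else -1) * a j) (e j)) N
  = bsub (bscal 2 (vsum (fun j => bscal (a j) (e j)) m)) (vsum (fun j => bscal (a j) (e j)) N).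
Proof.
  intros H; induction H as [|N H IH].
  - rewrite (vsum_ext Y _ (fun j => bscal (a j) (e j))).
    + vec.
    + intros j Hj; destruct (Nat.leb_spec j m); [f_equal; ring|lia].
  - cbn [vsum]; rewrite IH.
    destruct (Nat.leb_spec (S N) m); [lia|vec].
Qed.

(** Signs 1 up to [m] and -1 beyond turn the partial sum [P n] into [2 P m - P n]. Unconditionality
    applies to these finite sums, and [P n] tends to [y]. *)
Lemma reflection_contractive (Y : Banach) (e : nat -> Y) (ef : nat -> Y -> R) (m : nat) (y : Y) :
  schauder_basis e ef -> one_unconditional e ->
  bnorm (bsub (bscal 2 (vsum (fun j => bscal (ef j y) (e j)) m)) y) <= bnorm y.
Proof.
  intros B U; apply Rnot_lt_le; intro C.
  set (P := fun n => vsum (fun j => bscal (ef j y) (e j)) n).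
  fold (P m) in C.
  destruct (proj1 (B y) ((bnorm (bsub (bscal 2 (P m)) y) - bnorm y) / 2)) as [N HN]; [lra|].
  specialize (HN (Nat.max N m) ltac:(lia)); unfold Rdist in HN.
  rewrite Rminus_0_r, Rabs_right in HN by apply Rle_ge, bnorm_ge0.
  fold (P (Nat.max N m)) in HN; set (n := Nat.max N m) in *.
  pose proof (U n (fun j => ef j y) (fun j => if Nat.leb j m then 1 else -1)) as H.
  cbv beta in H; rewrite (vsum_reflect Y e (fun j => ef j y) m n) in H by lia.
  fold (P m) (P n) in H.
  assert (H' : bnorm (bsub (bscal 2 (P m)) (P n)) <= bnorm (P n)).
  { apply H; intros j; destruct (Nat.leb j m); auto. }
  pose proof (bnorm_sub_trans Y (bscal 2 (P m)) (P n) y).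
  pose proof (bnorm_le_sub Y (P n) y); lra.
Qed.

Lemma in_dual_sum (Y : Banach) (b : nat -> R) (ef : nat -> Y -> R) (n : nat) :
  (forall j, in_dual (ef j)) -> in_dual (fun y => sum_f_R0 (fun j => b j * ef j y) n).
Proof.
  intros E.
  assert (S1 : forall j, in_dual (fun y => b j * ef j y)).
  { intros j; pose proof (in_dual_linear _ _ (E j)) as L.
    destruct (E j) as [_ [_ [C HC]]]; apply in_dual_intro with (Rabs (b j) * C).
    - split; intros; [rewrite (proj1 L)|rewrite (proj2 L)]; ring.
    - intros y; rewrite Rabs_mult, Rmult_assoc.
      apply Rmult_le_compat_l; [apply Rabs_pos|apply HC]. }
  induction n as [|n IH]; simpl; [apply S1|].
  exact (in_dual_plus _ _ _ IH (S1 (S n))).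
Qed.

(* The contraction [2 P_m - I] almost fixes [f] and almost flips weak-star null [g k]. *)
Lemma basis_asymptotically_unconditional (Y : Banach) (f : Y -> R) (g : nat -> Y -> R) (eps : R) :
  has_shrinking_1unc_basis Y -> in_dual f -> weak_star_null g -> eps > 0 ->
  exists K, forall k, (k >= K)%nat ->
    bounded_by (fun y => f y - g k y) (dual_norm (fun y => f y + g k y) + eps).
Proof.
  intros [e [ef [B [U [E Sh]]]]] F [G G0] He.
  destruct (Sh f F) as [b [Hb _]].
  destruct (Hb (eps / 4)) as [m Hm]; [lra|].
  specialize (Hm m (le_n m)); unfold Rdist in Hm; rewrite Rminus_0_r in Hm.
  set (r := fun y => f y - sum_f_R0 (fun j => b j * ef j y) m) in *.
  assert (Rr : in_dual r) by (apply in_dual_minus; [exact F|apply in_dual_sum, E]).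
  (* Taken at [m], this sum bounds the norm of [g k] composed with the projection onto the first
     basis vectors; on that finite-dimensional range, weak-star null means norm null. *)
  assert (Hs : forall n, Un_cv (fun k => sum_f_R0 (fun j => dual_norm (ef j) * Rabs (g k (e j))) n) 0).
  { assert (H1 : forall j, Un_cv (fun k => dual_norm (ef j) * Rabs (g k (e j))) 0).
    { intros j; replace 0 with (dual_norm (ef j) * 0 + 0 * 0) by ring.
      apply Un_cv_ext with (fun k => dual_norm (ef j) * Rabs (g k (e j)) + 0 * 0);
        [intros; ring|].
      apply (Un_cv_lin _ (fun _ => 0)); [|apply Un_cv_const].
      rewrite <- Rabs_R0; apply cv_cvabs, G0. }
    induction n as [|n IH]; [apply H1|].
    rewrite <- (Rplus_0_r 0); exact (CV_plus _ _ _ _ IH (H1 (S n))). }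
  destruct (Hs m (eps / 4)) as [K HK]; [lra|].
  exists K; intros k Hk y; specialize (HK k Hk); unfold Rdist in HK.
  rewrite Rminus_0_r in HK; pose proof (Rle_abs (sum_f_R0
    (fun j => dual_norm (ef j) * Rabs (g k (e j))) m)) as HK'.
  set (P := vsum (fun j => bscal (ef j y) (e j)) m).
  set (w := bsub (bscal 2 P) y).
  assert (Hw : bnorm w <= bnorm y) by (apply (reflection_contractive Y e ef m y B U)).
  pose proof (in_dual_linear _ _ F) as FL; pose proof (in_dual_linear _ _ (G k)) as GL.
  pose proof (in_dual_linear _ _ Rr) as RL.
  assert (H1 : Rabs (f w + g k w) <= dual_norm (fun y => f y + g k y) * bnorm y).
  { pose proof (in_dual_plus _ _ _ F (G k)) as D.
    pose proof (dual_norm_bound _ _ D w) as H; cbv beta in H.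
    pose proof (dual_norm_ge0 _ _ D); nra. }
  assert (H2 : Rabs (g k P) <= eps / 4 * bnorm y).
  { unfold P; rewrite (vsum_form Y (g k) _ m GL).
    apply Rle_trans with (sum_f_R0 (fun j => (dual_norm (ef j) * Rabs (g k (e j))) * bnorm y) m).
    - apply Rle_trans with (1 := Rsum_abs _ _), sum_Rle; intros j _.
      rewrite (proj2 GL), Rabs_mult.
      pose proof (dual_norm_bound _ _ (E j) y); pose proof (Rabs_pos (g k (e j))); nra.
    - rewrite <- scal_sum; pose proof (bnorm_ge0 Y y); nra. }
  (* The coordinates of [y - P] up to [m] vanish, so [f] agrees there with its small remainder
     [r]. *)
  assert (H3 : f (bsub y P) = r (bsub y P)).
  { unfold r; enough (sum_f_R0 (fun j => b j * ef j (bsub y P)) m = 0) by lra.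
    rewrite (sum_eq _ (fun _ => 0)); [rewrite sum_cte; ring|].
    intros j Hj; pose proof (in_dual_linear _ _ (E j)) as EL.
    rewrite linear_form_sub by exact EL; unfold P.
    rewrite (vsum_form Y (ef j) _ m EL).
    rewrite (sum_eq _ (fun i => if Nat.eqb i j then ef i y else 0)).
    - rewrite sum_indicator; destruct (Nat.leb_spec j m); [ring|lia].
    - intros i _; rewrite (proj2 EL), (schauder_basis_biorthogonal Y e ef i j B).
      rewrite Nat.eqb_sym; destruct (Nat.eqb i j); ring. }
  assert (H4 : Rabs (f (bsub y P)) <= eps / 4 * bnorm y).
  { rewrite H3; pose proof (dual_norm_bound _ _ Rr (bsub y P)) as H.
    assert (bnorm (bsub y P) <= bnorm y).
    { replace (bsub y P) with (bscal (/ 2) (bsub y w)) by (unfold w; vec).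
      rewrite bnorm_scal, Rabs_right by lra.
      pose proof (bnorm_sub_le Y y w); lra. }
    pose proof (Rle_abs (dual_norm r)); pose proof (bnorm_ge0 Y (bsub y P)); nra. }
  (* The value at [w = 2 P - y] has the opposite sign on [g]; the two corrections cost [eps / 2]
     each, whence the quarters above. *)
  assert (H5 : f y - g k y = (f w + g k w) + (2 * f (bsub y P) - 2 * g k P)).
  { unfold w; rewrite !linear_form_sub, (proj2 FL), (proj2 GL) by assumption; ring. }
  rewrite H5.
  pose proof (Rabs_triang (f w + g k w) (2 * f (bsub y P) - 2 * g k P)) as T1.
  pose proof (Rabs_triang (2 * f (bsub y P)) (- (2 * g k P))) as T2.
  rewrite Rabs_Ropp, !Rabs_mult, (Rabs_right 2) in T2 by lra.
  unfold Rminus in *; lra.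
Qed.

Lemma weak_star_null_bounded (X : Banach) (xn : nat -> X -> R) : weak_star_null xn ->
  exists M, 0 <= M /\ forall n, bounded_by (xn n) M.
Proof.
  intros [D N]; apply uniform_boundedness; [exact D|].
  intros x; destruct (maj_by_pos (fun n => xn n x)) as [B [_ HB]]; [|exists B; exact HB].
  exists 0; apply N.
Qed.

(** Arguing by contradiction supplies a subsequence [s] that is bad at every index, so the
    contradiction may be reached along any further extraction, in particular along the one given by
    weak-star compactness in the dual of [Y]. The limit [g] of the extensions restricts to [xs],
    since [xn] is weak-star null. *)
Lemma au_star_of_embeddings (X : Banach) :
  (forall delta : R, delta > 0 ->
     exists (Y : Banach) (Xd : Y -> Prop),
       has_shrinking_1unc_basis Y /\ is_subspace Xd /\ BM_dist_lt X Y Xd (1 + delta)) ->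
  property_au_star X.
Proof.
  intros H.
  assert (Half : forall (xs : X -> R) (xn : nat -> X -> R) (eps : R),
    in_dual xs -> weak_star_null xn -> eps > 0 ->
    exists N, forall n, (n >= N)%nat ->
      dual_norm (fun x => xs x + xn n x) <= dual_norm (fun x => xs x - xn n x) + eps).
  { intros xs xn eps D W He; apply NNPP; intro C.
    assert (Cn : forall N, exists n, (n >= N)%nat /\
      dual_norm (fun x => xs x - xn n x) + eps < dual_norm (fun x => xs x + xn n x)).
    { intros N; apply NNPP; intro C'; apply C; exists N; intros n Hn.
      apply Rnot_lt_le; intro C''; apply C'; exists n; auto. }
    set (s := fun N => proj1_sig (constructive_indefinite_description _ (Cn N))).
    assert (Hs : forall N, (s N >= N)%nat /\
      dual_norm (fun x => xs x - xn (s N) x) + eps < dual_norm (fun x => xs x + xn (s N) x)).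
    { intros N; exact (proj2_sig (constructive_indefinite_description _ (Cn N))). }
    clearbody s.
    destruct (weak_star_null_bounded X xn W) as [M [HM Mb]].
    destruct W as [Wd W0].
    set (L := dual_norm xs + M).
    assert (HL : 0 <= L) by (pose proof (dual_norm_ge0 _ _ D); unfold L; lra).
    assert (Lb : forall n, dual_norm (fun x => xs x - xn n x) <= L).
    { intros n; apply dual_norm_le; [apply in_dual_minus; auto|exact HL|].
      apply bounded_by_minus; [apply dual_norm_bound, D|apply Mb]. }
    (* [L] bounds all norms of [xs - xn], so the distortion [M1 * M2] costs at most [eps / 4]. The
       tolerance [eps / (4 * (M1 + 1))] on [Y], pulled back through [T], costs another [eps / 4]. *)
    destruct (H (eps / (4 * (L + 1)))) as [Y [Xd [HY [_ HT]]]];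
      [apply Rdiv_lt_0_compat; lra|].
    destruct HT as [T [M1 [M2 [TL [_ [_ [P1 [P2 [T1 [T2 T3]]]]]]]]]].
    assert (V : exists v : nat -> Y, total v).
    { destruct HY as [e [ef [B _]]]; exists e; exact (schauder_basis_total Y e ef B). }
    destruct V as [v V].
    assert (Ex : forall N, exists f, linear_form f /\
      bounded_by f (dual_norm (fun x => xs x - xn (s N) x) * M2) /\
      forall x, f (T x) = xs x - xn (s N) x).
    { intros N; pose proof (in_dual_minus _ _ _ D (Wd (s N))) as D'.
      apply (functional_extension X Y v T _ M2 _ V TL T2
        (in_dual_linear _ _ D') (dual_norm_bound _ _ D') (dual_norm_ge0 _ _ D') P2). }
    set (f := fun N => proj1_sig (constructive_indefinite_description _ (Ex N))).
    assert (Hf : forall N, linear_form (f N) /\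
      bounded_by (f N) (dual_norm (fun x => xs x - xn (s N) x) * M2) /\
      forall x, f N (T x) = xs x - xn (s N) x).
    { intros N; exact (proj2_sig (constructive_indefinite_description _ (Ex N))). }
    clearbody f.
    destruct (weak_star_compact Y v f (L * M2)) as [phi [g [Hphi [GL [GB Gcv]]]]].
    - exact V.
    - apply Rmult_le_pos; assumption.
    - intros n; apply Hf.
    - intros n; apply bounded_by_weaken with (2 := proj1 (proj2 (Hf n))).
      apply Rmult_le_compat_r; [exact P2|apply Lb].
    - assert (FD : forall n, in_dual (f n)).
      { intros n; exact (in_dual_intro _ _ _ (proj1 (Hf n)) (proj1 (proj2 (Hf n)))). }
      pose proof (in_dual_intro _ _ _ GL GB) as GD.
      assert (GT : forall x, g (T x) = xs x).
      { intros x; apply UL_sequence with (1 := Gcv (T x)).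
        apply Un_cv_ext with (fun n => 1 * xs x + (-1) * xn (s (phi n)) x).
        { intros n; rewrite (proj2 (proj2 (Hf (phi n)))); ring. }
        replace (xs x) with (1 * xs x + (-1) * 0) at 1 by ring.
        apply (Un_cv_lin (fun _ => xs x)); [apply Un_cv_const|].
        intros eta Heta; destruct (W0 x eta Heta) as [N HN]; exists N; intros n Hn.
        apply HN; pose proof (proj1 (Hs (phi n))).
        pose proof (extraction_ge phi n Hphi); lia. }
      (* The two signs are [g + (f - g) = f] and [g - (f - g) = 2 g - f]; composed with [T] they
         become [xs - xn] and [xs + xn]. *)
      destruct (basis_asymptotically_unconditional Y g
        (fun n y => f (phi n) y - g y) (eps / (4 * (M1 + 1)))) as [K HK].
      + exact HY.
      + exact GD.
      + split; [intros n; apply in_dual_minus; auto|].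
        intros y; apply Un_cv_ext with (fun n => 1 * f (phi n) y + (-1) * g y);
          [intros; ring|].
        replace 0 with (1 * g y + (-1) * g y) by ring.
        apply (Un_cv_lin _ (fun _ => g y)); [apply Gcv|apply Un_cv_const].
      + apply Rdiv_lt_0_compat; lra.
      + specialize (HK K (le_n K)); set (n := s (phi K)) in *.
        destruct (Hs (phi K)) as [_ Hbad]; fold n in Hbad.
        destruct (Hf (phi K)) as [FL [FB FT]]; fold n in FB, FT.
        set (a := dual_norm (fun x => xs x - xn n x)) in *.
        assert (Ha : 0 <= a) by (apply dual_norm_ge0, in_dual_minus; auto).
        assert (Hsum : dual_norm (fun y => g y + (f (phi K) y - g y)) <= a * M2).
        { replace (fun y => g y + (f (phi K) y - g y)) with (f (phi K))
            by (apply functional_extensionality; intros; ring).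
          apply dual_norm_le; [apply FD|nra|exact FB]. }
        set (eta := eps / (4 * (M1 + 1))) in *.
        assert (Heta : M1 * eta <= eps / 4).
        { assert (E : (M1 + 1) * eta = eps / 4) by (unfold eta; field; lra).
          assert (0 < eta) by (apply Rdiv_lt_0_compat; lra). nra. }
        assert (H0 : 0 < eta) by (apply Rdiv_lt_0_compat; lra).
        assert (Hgood : dual_norm (fun x => xs x + xn n x) <= M1 * (a * M2 + eta)).
        { assert (Hq : 0 <= a * M2 + eta) by nra.
          apply dual_norm_le; [apply in_dual_plus; auto|apply Rmult_le_pos; assumption|].
          intros x; specialize (HK (T x)); cbv beta in HK.
          rewrite FT, GT in HK.
          replace (xs x - (xs x - xn n x - xs x)) with (xs x + xn n x) in HK by ring.
          apply Rle_trans with (1 := HK).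
          apply Rle_trans with ((a * M2 + eta) * bnorm (T x)).
          - apply Rmult_le_compat_r; [apply bnorm_ge0|lra].
          - rewrite (Rmult_comm M1), Rmult_assoc.
            apply Rmult_le_compat_l; [exact Hq|apply T1]. }
        assert (Hd : a * (eps / (4 * (L + 1))) <= eps / 4).
        { pose proof (Lb n) as Ln; fold a in Ln.
          apply Rle_trans with ((L + 1) * (eps / (4 * (L + 1)))).
          - apply Rmult_le_compat_r; [apply Rlt_le, Rdiv_lt_0_compat|]; lra.
          - right; field; lra. }
        assert (Hm : a * (M1 * M2) <= a * (1 + eps / (4 * (L + 1))))
          by (apply Rmult_le_compat_l; lra).
        lra. }
  intros xs xn D W eps He.
  destruct (Half xs xn (eps / 2) D W) as [N1 H1]; [lra|].
  (* Negating the sequence gives the opposite inequality. *)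
  destruct (Half xs (fun n x => - xn n x) (eps / 2) D) as [N2 H2].
  - split; [intros n; apply in_dual_neg, W|].
    intros x; rewrite <- Ropp_0; apply CV_opp, W.
  - lra.
  - exists (Nat.max N1 N2); intros n Hn.
    specialize (H1 n ltac:(lia)); specialize (H2 n ltac:(lia)).
    replace (fun x => xs x - - xn n x) with (fun x => xs x + xn n x) in H2
      by (apply functional_extensionality; intros; ring).
    unfold Rdist; rewrite Rminus_0_r; apply Rabs_def1; [lra|].
    change (fun x => xs x + - xn n x) with (fun x => xs x - xn n x) in H2; lra.
Qed.
(** * Consequences of asymptotic unconditionality of the dual *)

Lemma bounded_by_ext (X : Banach) (f g : X -> R) (M : R) :
  (forall x, f x = g x) -> bounded_by f M -> bounded_by g M.
Proof. intros E H x; rewrite <- E; apply H. Qed.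

(** The ball of radius [C] in the annihilator of [d 0, ..., d (n - 1)]. These balls replace
    weak-star neighbourhoods of 0: choosing one element for each [n] gives a weak-star null sequence
    when [d] is total. *)
Definition tail_ball {X : Banach} (d : nat -> X) (C : R) (n : nat) (w : X -> R) : Prop :=
  linear_form w /\ bounded_by w C /\ forall i, (i < n)%nat -> w (d i) = 0.

Lemma tail_ball_mono (X : Banach) (d : nat -> X) (C : R) (m n : nat) (w : X -> R) :
  (m <= n)%nat -> tail_ball d C n w -> tail_ball d C m w.
Proof.
  intros H [L [B Z]]; split; [exact L|split; [exact B|]].
  intros i Hi; apply Z; lia.
Qed.

Lemma tail_ball_neg (X : Banach) (d : nat -> X) (C : R) (n : nat) (w : X -> R) :
  tail_ball d C n w -> tail_ball d C n (fun x => - w x).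
Proof.
  intros [L [B Z]]; split; [apply linear_form_neg, L|].
  split; [apply bounded_by_neg, B|].
  intros i Hi; rewrite Z by exact Hi; ring.
Qed.

Lemma pointwise_null (X : Banach) (d : nat -> X) (f : nat -> X -> R) (M : R) :
  total d -> (forall n, linear_form (f n)) -> (forall n, bounded_by (f n) M) ->
  (forall i, exists N, forall n, (n >= N)%nat -> f n (d i) = 0) ->
  forall x, Un_cv (fun n => f n x) 0.
Proof.
  intros V FL FB Z.
  apply (V (fun x => Un_cv (fun n => f n x) 0)).
  - apply (equibounded_cv_closed X f (fun _ => 0) (Rabs M)).
    + exact FL.
    + intros n; apply bounded_by_weaken with M; [apply Rle_abs|apply FB].
    + split; intros; ring.
    + intros x; rewrite Rabs_R0; apply Rmult_le_pos; [apply Rabs_pos|apply bnorm_ge0].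
  - intros i eps He; destruct (Z i) as [N HN]; exists N; intros n Hn.
    rewrite HN by exact Hn; unfold Rdist; rewrite Rminus_0_r, Rabs_R0; exact He.
Qed.

(** Otherwise each [N] has a counterexample in its annihilator ball. Together these form a weak-star
    null sequence violating (au-star) at [A]. *)
Lemma au_star_uniform (X : Banach) (d : nat -> X) (A : X -> R) (C eps : R) :
  property_au_star X -> total d -> in_dual A -> eps > 0 ->
  exists N, forall w, tail_ball d C N w ->
    dual_norm (fun x => A x + w x) <= dual_norm (fun x => A x - w x) + eps.
Proof.
  intros au V D He; apply NNPP; intro H.
  assert (Hw : forall N, exists w, tail_ball d C N w /\
    dual_norm (fun x => A x - w x) + eps < dual_norm (fun x => A x + w x)).
  { intros N; apply NNPP; intro H'; apply H; exists N; intros w Hw.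
    apply Rnot_lt_le; intro H''; apply H'; exists w; auto. }
  set (w := fun N => proj1_sig (constructive_indefinite_description _ (Hw N))).
  assert (W : forall N, tail_ball d C N (w N) /\
    dual_norm (fun x => A x - w N x) + eps < dual_norm (fun x => A x + w N x)).
  { intros N; exact (proj2_sig (constructive_indefinite_description _ (Hw N))). }
  clearbody w.
  destruct (au A w D) with (eps := eps) as [N HN]; [|exact He|].
  - split.
    + intros n; exact (in_dual_intro _ _ _ (proj1 (proj1 (W n))) (proj1 (proj2 (proj1 (W n))))).
    + apply (pointwise_null X d w C V); [intros n; apply W|intros n; apply W|].
      intros i; exists (S i); intros n Hn; apply (proj1 (W n)); lia.
  - specialize (HN N (le_n N)); unfold Rdist in HN; rewrite Rminus_0_r in HN.
    apply Rabs_def2 in HN; destruct (W N) as [_ HW]; lra.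
Qed.

(** A finite list admits a common [N], and [w |-> - w] gives the second implication. Bounds [M]
    replace norms so that the estimates can be chained. *)
Lemma au_star_uniform_list (X : Banach) (d : nat -> X) (l : list (X -> R)) (C eps : R) :
  property_au_star X -> total d -> (forall A, In A l -> in_dual A) -> eps > 0 ->
  exists N, forall w A M, tail_ball d C N w -> In A l -> 0 <= M ->
    (bounded_by (fun x => A x - w x) M -> bounded_by (fun x => A x + w x) (M + eps)) /\
    (bounded_by (fun x => A x + w x) M -> bounded_by (fun x => A x - w x) (M + eps)).
Proof.
  intros au V D He; induction l as [|A l IH]; [exists O; intros w A M _ []|].
  destruct IH as [N1 H1]; [intros; apply D; right; assumption|].
  destruct (au_star_uniform X d A C eps au V (D A (or_introl eq_refl)) He) as [N2 H2].
  exists (Nat.max N1 N2); intros w B M W [<-|HB] HM.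
  - assert (K : forall w, tail_ball d C N2 w -> bounded_by (fun x => A x - w x) M ->
      bounded_by (fun x => A x + w x) (M + eps)).
    { intros v Hv HB.
      pose proof (in_dual_intro _ _ _ (proj1 Hv) (proj1 (proj2 Hv))) as Dv.
      pose proof (D A (or_introl eq_refl)) as DA.
      apply bounded_by_weaken with (2 := dual_norm_bound _ _ (in_dual_plus _ _ _ DA Dv)).
      apply Rle_trans with (1 := H2 v Hv), Rplus_le_compat_r.
      apply dual_norm_le; [apply in_dual_minus; assumption|exact HM|exact HB]. }
    assert (W2 : tail_ball d C N2 w) by (apply tail_ball_mono with (2 := W); lia).
    split; [apply K, W2|intros HB].
    apply (K (fun x => - w x)).
    + apply tail_ball_neg, W2.
    + apply bounded_by_ext with (2 := HB); intros x; ring.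
  - apply H1; [apply tail_ball_mono with (2 := W); lia|exact HB|exact HM].
Qed.

(** * Finite weak-star nets of annihilator balls *)

Definition abs_sum {X : Banach} (u : X -> R) (l : list X) : R :=
  fold_right (fun y s => Rabs (u y) + s) 0 l.

Lemma abs_sum_ge0 (X : Banach) (u : X -> R) (l : list X) : 0 <= abs_sum u l.
Proof.
  unfold abs_sum; induction l as [|y l IH]; simpl; [lra|]; pose proof (Rabs_pos (u y)).
  lra.
Qed.

Lemma abs_sum_cv (X : Banach) (u : nat -> X -> R) (l : list X) :
  (forall x, Un_cv (fun n => u n x) 0) -> Un_cv (fun n => abs_sum (u n) l) 0.
Proof.
  intros H; induction l as [|y l IH]; simpl; [apply Un_cv_const|].
  rewrite <- (Rplus_0_r 0); apply (CV_plus (fun n => Rabs (u n y))); [|exact IH].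
  rewrite <- Rabs_R0; apply cv_cvabs, H.
Qed.

(* Composing with [Q] projects functionals onto the annihilator of the first [n]
   vectors, at a cost controlled by finitely many evaluations. *)
Definition corank_data {X : Banach} (d : nat -> X) (n : nat)
    (Q : X -> X) (l : list X) (D : R) : Prop :=
  is_linear Q /\ (forall i, (i < n)%nat -> Q (d i) = bzero) /\ 0 <= D /\
  forall u, linear_form u -> forall x, Rabs (u x - u (Q x)) <= D * abs_sum u l * bnorm x.

(** [Q] is followed by [y |-> y - phi y r], where [r = Q (d n)] and [phi r = 1] ([phi = 0] when
    [r = 0]), which kills [r]. The new error [phi (Q x) * u r] is paid for by adding [r] to the
    list. The bound on [phi] after [Q] comes from the induction hypothesis applied to [phi]
    itself. *)
Lemma corank_exists (X : Banach) (d : nat -> X) (n : nat) : total d ->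
  exists Q l D, corank_data d n Q l D.
Proof.
  intros V; induction n as [|n [Q [l [D [[QA QS] [QZ [HD HQ]]]]]]].
  - exists (fun x => x), nil, 0; split; [split; reflexivity|].
    split; [lia|split; [lra|]].
    intros u _ x; rewrite Rminus_diag, Rabs_R0; lra.
  - set (r := Q (d n)).
    assert (Hphi : exists phi, linear_form phi /\ (exists C, 0 <= C /\ bounded_by phi C) /\
      bsub r (bscal (phi r) r) = bzero).
    { destruct (Req_dec (bnorm r) 0) as [Hr|Hr].
      - exists (fun _ => 0); split; [split; intros; ring|split].
        + exists 0; split; [lra|]; intros x; rewrite Rabs_R0; lra.
        + rewrite (bnorm_eq0 X r Hr); vec.
      - destruct (norming_functional X d r V) as [f [FL [FB Fr]]].
        assert (Hi : 0 <= / bnorm r).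
        { pose proof (bnorm_ge0 X r); apply Rlt_le, Rinv_0_lt_compat; lra. }
        exists (fun x => / bnorm r * f x); split; [|split].
        + split; intros; [rewrite (proj1 FL)|rewrite (proj2 FL)]; ring.
        + exists (/ bnorm r); split; [exact Hi|].
          intros x; rewrite Rabs_mult, (Rabs_right (/ bnorm r)) by lra.
          specialize (FB x); apply Rmult_le_compat_l; [exact Hi|lra].
        + rewrite Fr, Rinv_l, bscal_1 by exact Hr; vec. }
    destruct Hphi as [phi [PL [[C [HC PB]] Pr]]].
    pose proof (abs_sum_ge0 X phi l) as HP.
    exists (fun x => bsub (Q x) (bscal (phi (Q x)) r)), (r :: l), (D + (C + D * abs_sum phi l)).
    assert (HC' : 0 <= C + D * abs_sum phi l) by nra.
    split; [|split; [|split; [nra|]]].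
    + split.
      * intros x y; rewrite QA, (proj1 PL); vec.
      * intros a x; rewrite QS, (proj2 PL); vec.
    + intros i Hi; destruct (Nat.eq_dec i n) as [->|Hn]; [exact Pr|].
      rewrite QZ, (linear_form_0 X _ PL) by lia; vec.
    + intros u UL x; rewrite (linear_form_sub X u _ _ UL), (proj2 UL).
      pose proof (HQ u UL x) as H1; pose proof (HQ phi PL x) as H2; pose proof (PB x) as H3.
      assert (H4 : Rabs (phi (Q x)) <= (C + D * abs_sum phi l) * bnorm x).
      { pose proof (Rabs_triang (phi x) (- (phi x - phi (Q x)))) as T.
        rewrite Rabs_Ropp in T.
        replace (phi x + - (phi x - phi (Q x))) with (phi (Q x)) in T by ring; lra. }
      pose proof (Rabs_triang (u x - u (Q x)) (phi (Q x) * u r)) as T.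
      rewrite Rabs_mult in T.
      replace (u x - (u (Q x) - phi (Q x) * u r))
        with (u x - u (Q x) + phi (Q x) * u r) by ring.
      apply Rle_trans with (1 := T).
      change (abs_sum u (r :: l)) with (Rabs (u r) + abs_sum u l).
      pose proof (Rabs_pos (u r)) as H5; pose proof (abs_sum_ge0 X u l) as H6.
      pose proof (bnorm_ge0 X x) as H7.
      apply Rmult_le_compat_r with (r := Rabs (u r)) in H4; [|exact H5].
      assert (H8 : 0 <= (D * Rabs (u r)) * bnorm x)
        by (apply Rmult_le_pos; [apply Rmult_le_pos|]; assumption).
      assert (H9 : 0 <= ((C + D * abs_sum phi l) * abs_sum u l) * bnorm x)
        by (apply Rmult_le_pos; [apply Rmult_le_pos|]; assumption).
      lra.
Qed.

Lemma minimal_witness (A : Type) (P : A -> Prop) (m : A -> nat) :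
  (exists a, P a) -> exists a, P a /\ forall b, P b -> (m a <= m b)%nat.
Proof.
  intros [a Ha]; apply NNPP; intro N.
  enough (H : forall n b, P b -> (n <= m b)%nat) by (specialize (H (S (m a)) a Ha); lia).
  induction n as [|n IH]; intros b Hb; [lia|].
  destruct (Nat.eq_dec n (m b)) as [E|E]; [|specialize (IH b Hb); lia].
  exfalso; apply N; exists b; split; [exact Hb|].
  intros c Hc; rewrite <- E; apply IH, Hc.
Qed.

(* Weak-star compactness of the ball: the neighbourhoods of its points [z], each given
   by the first [Nf z] vectors, contain a finite subcover.  Centres are picked greedily
   with [Nf] minimal among uncovered points: a weak-star limit of the centres would be
   uncovered too, which bounds [Nf] along the sequence, so two of them must be close. *)
Lemma tail_ball_cover (X : Banach) (d : nat -> X) (C eps : R) (k : nat)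
    (Nf : (X -> R) -> nat) (Q : nat -> X -> X) (l : nat -> list X) (D : nat -> R) :
  total d -> 0 <= C -> eps > 0 -> (forall n, corank_data d n (Q n) (l n) (D n)) ->
  exists F, (forall z, In z F -> tail_ball d C k z) /\
    forall w, tail_ball d C k w -> exists z, In z F /\
      exists eps', eps' < eps /\
        bounded_by (fun x => w x - z x - (w (Q (Nf z) x) - z (Q (Nf z) x))) eps'.
Proof.
  intros V HC He HQ.
  set (near := fun w z => exists eps', eps' < eps /\
    bounded_by (fun x => w x - z x - (w (Q (Nf z) x) - z (Q (Nf z) x))) eps').
  apply NNPP; intro N.
  set (bad := fun F w => tail_ball d C k w /\ forall z, In z F -> ~ near w z).
  (* A next centre is assigned to every list, with a dummy value for lists outside the ball, so that
     choice yields a function that can be iterated. *)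
  assert (Hbad : forall F, exists w, (forall z, In z F -> tail_ball d C k z) ->
    bad F w /\ forall w', bad F w' -> (Nf w <= Nf w')%nat).
  { intros F; destruct (classic (forall z, In z F -> tail_ball d C k z)) as [HF|HF];
      [|exists (fun _ => 0); tauto].
    destruct (minimal_witness _ (bad F) Nf) as [w Hw]; [|exists w; auto].
    apply NNPP; intro N'; apply N; exists F; split; [exact HF|].
    intros w Hw; apply NNPP; intro N''; apply N'; exists w; split; [exact Hw|].
    intros z Hz Hn; apply N''; exists z; split; [exact Hz|exact Hn]. }
  set (nw := fun F => proj1_sig (constructive_indefinite_description _ (Hbad F))).
  assert (Hnw : forall F, (forall z, In z F -> tail_ball d C k z) ->
    bad F (nw F) /\ forall w', bad F w' -> (Nf (nw F) <= Nf w')%nat).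
  { intros F; exact (proj2_sig (constructive_indefinite_description _ (Hbad F))). }
  clearbody nw; clear Hbad N.
  set (Fs := fix Fs n := match n with O => nil | S j => nw (Fs j) :: Fs j end).
  set (z := fun n => nw (Fs n)).
  assert (HFs : forall n y, In y (Fs n) -> tail_ball d C k y).
  { induction n as [|n IH]; simpl; [tauto|].
    intros y [<-|Hy]; [apply (Hnw (Fs n) IH)|apply IH, Hy]. }
  assert (Hz : forall n, bad (Fs n) (z n) /\
    forall w', bad (Fs n) w' -> (Nf (z n) <= Nf w')%nat) by (intros n; apply Hnw, HFs).
  assert (Mono : forall m n y, (m <= n)%nat -> In y (Fs m) -> In y (Fs n)).
  { intros m n y H; induction H; simpl; auto. }
  destruct (weak_star_compact X d z C) as [phi [g [Hphi [GL [GB Gcv]]]]];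
    [exact V|exact HC|intros n; apply (Hz n)|intros n; apply (Hz n)|].
  assert (Hu : forall n, linear_form (fun x => z (phi n) x - g x)).
  { intros n; apply linear_form_minus; [apply (Hz (phi n))|exact GL]. }
  assert (Small : forall m delta, delta > 0 -> exists J, forall j, (j >= J)%nat ->
    D m * abs_sum (fun x => z (phi j) x - g x) (l m) < delta).
  { intros m delta Hdelta.
    pose proof (proj1 (proj2 (proj2 (HQ m)))) as HD.
    destruct (abs_sum_cv X (fun n x => z (phi n) x - g x) (l m)) with
      (eps := delta / (D m + 1)) as [J HJ].
    - intros x; apply Un_cv_ext with (fun n => 1 * z (phi n) x + (-1) * g x);
        [intros; ring|].
      replace 0 with (1 * g x + (-1) * g x) by ring.
      apply (Un_cv_lin _ (fun _ => g x)); [apply Gcv|apply Un_cv_const].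
    - apply Rdiv_lt_0_compat; lra.
    - exists J; intros j Hj; specialize (HJ j Hj); unfold Rdist in HJ.
      rewrite Rminus_0_r in HJ; apply Rabs_def2 in HJ.
      pose proof (abs_sum_ge0 X (fun x => z (phi j) x - g x) (l m)).
      assert (E : (D m + 1) * (delta / (D m + 1)) = delta) by (field; lra).
      assert ((D m + 1) * abs_sum (fun x => z (phi j) x - g x) (l m) < delta).
      { rewrite <- E; apply Rmult_lt_compat_l; lra. }
      lra. }
  assert (Gt : tail_ball d C k g).
  { split; [exact GL|split; [exact GB|]].
    intros i Hi; apply UL_sequence with (1 := Gcv (d i)).
    apply Un_cv_ext with (fun _ => 0); [|apply Un_cv_const].
    intros n; symmetry; apply (Hz (phi n)), Hi. }
  (* If [g] were near a centre [y], the slack [eps - e'] would make late centres of the subsequence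
     near [y] as well, against their choice. The strict inequality in [near] provides this slack. *)
  assert (Gbad : forall n, bad (Fs n) g).
  { intros n; split; [exact Gt|].
    intros y Hy [e' [He' B]].
    destruct (Small (Nf y) (eps - e') ltac:(lra)) as [J HJ].
    set (j := Nat.max J n); specialize (HJ j ltac:(lia)).
    apply (proj1 (Hz (phi j))) with y.
    - apply Mono with (2 := Hy); pose proof (extraction_ge phi j Hphi); lia.
    - exists (e' + D (Nf y) * abs_sum (fun x => z (phi j) x - g x) (l (Nf y))).
      split; [lra|].
      pose proof (proj2 (proj2 (proj2 (HQ (Nf y)))) _ (Hu j)) as B2.
      apply bounded_by_ext with (2 := bounded_by_plus _ _ _ _ _ B B2).
      intros x; ring. }
  assert (Nb : forall n, (Nf (z n) <= Nf g)%nat) by (intros n; apply Hz, Gbad).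
  assert (Unif : forall M, exists J, forall m, (m <= M)%nat -> forall j, (j >= J)%nat ->
    D m * abs_sum (fun x => z (phi j) x - g x) (l m) < eps / 3).
  { induction M as [|M [J1 H1]].
    - destruct (Small O (eps / 3) ltac:(lra)) as [J HJ]; exists J; intros m Hm.
      replace m with O by lia; exact HJ.
    - destruct (Small (S M) (eps / 3) ltac:(lra)) as [J2 H2]; exists (Nat.max J1 J2).
      intros m Hm j Hj; destruct (Nat.eq_dec m (S M)) as [->|Hm'];
        [apply H2|apply H1]; lia. }
  (* From [J] on, each difference between a centre and [g] is within [eps / 3] of its projection,
     for every projection index up to [Nf g]. Two consecutive centres of the subsequence are then
     near each other. *)
  destruct (Unif (Nf g)) as [J HJ].
  set (y := z (phi J)).
  apply (proj1 (Hz (phi (S J)))) with y.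
  - apply Mono with (S (phi J)); [apply Hphi|left; reflexivity].
  - assert (Hy : (Nf y <= Nf g)%nat) by apply Nb.
    exists (2 * (eps / 3)); split; [lra|].
    pose proof (proj2 (proj2 (proj2 (HQ (Nf y)))) _ (Hu (S J))) as B1.
    pose proof (proj2 (proj2 (proj2 (HQ (Nf y)))) _ (Hu J)) as B2.
    pose proof (HJ _ Hy (S J) ltac:(lia)); pose proof (HJ _ Hy J ltac:(lia)).
    pose proof (bounded_by_minus _ _ _ _ _ B1 B2) as B3.
    apply bounded_by_weaken with (N := 2 * (eps / 3)) in B3; [|lra].
    apply bounded_by_ext with (2 := B3); intros x; unfold y; ring.
Qed.

Definition add_signed {X : Banach} (S : list (X -> R)) (z : X -> R) : list (X -> R) :=
  flat_map (fun A => [fun x => A x + z x; fun x => A x - z x]) S.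

Lemma in_add_signed (X : Banach) (S : list (X -> R)) (z B : X -> R) :
  In B (add_signed S z) <->
  exists A, In A S /\ (B = (fun x => A x + z x) \/ B = (fun x => A x - z x)).
Proof.
  unfold add_signed; rewrite in_flat_map; simpl; split.
  - intros [A [HA [H|[H|[]]]]]; exists A; auto.
  - intros [A [HA [H|H]]]; exists A; auto.
Qed.

(** [Nf z] counts the vectors that [w'] must annihilate for flips against all [A + z] and [A - z] to
    cost at most [eps]. The remainder [w'] is the projection of [w - z], within [eps] of it by the
    cover. Its norm is at most [C + C + eps <= 3 * C]. *)
Lemma level_exists (X : Banach) (d : nat -> X) (S : list (X -> R)) (C eps : R) (k : nat) :
  property_au_star X -> total d -> 1 <= C -> 0 < eps <= 1 ->
  (forall A, In A S -> in_dual A) ->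
  exists F, (forall z, In z F -> tail_ball d C k z) /\
    forall w, tail_ball d C k w -> exists z, In z F /\
      exists w', tail_ball d (3 * C) (k + 1) w' /\
        bounded_by (fun x => w x - z x - w' x) eps /\
        forall B M, In B (add_signed S z) -> 0 <= M ->
          (bounded_by (fun x => B x - w' x) M -> bounded_by (fun x => B x + w' x) (M + eps)) /\
          (bounded_by (fun x => B x + w' x) M -> bounded_by (fun x => B x - w' x) (M + eps)).
Proof.
  intros au V HC He HS.
  assert (HN : forall z, exists N, in_dual z -> (k + 1 <= N)%nat /\
    forall w B M, tail_ball d (3 * C) N w -> In B (add_signed S z) -> 0 <= M ->
    (bounded_by (fun x => B x - w x) M -> bounded_by (fun x => B x + w x) (M + eps)) /\
    (bounded_by (fun x => B x + w x) M -> bounded_by (fun x => B x - w x) (M + eps))).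
  { intros z; destruct (classic (in_dual z)) as [Dz|Dz]; [|exists O; tauto].
    destruct (au_star_uniform_list X d (add_signed S z) (3 * C) eps au V) as [N HN].
    - intros B HB; apply in_add_signed in HB; destruct HB as [A [HA [->| ->]]];
        [apply in_dual_plus|apply in_dual_minus]; auto.
    - lra.
    - exists (Nat.max N (k + 1)); intros _; split; [lia|].
      intros w B M W; apply HN, tail_ball_mono with (2 := W); lia. }
  set (Nf := fun z => proj1_sig (constructive_indefinite_description _ (HN z))).
  assert (HNf := fun z => proj2_sig (constructive_indefinite_description _ (HN z))).
  assert (HQ : forall n, exists p : (X -> X) * list X * R,
    corank_data d n (fst (fst p)) (snd (fst p)) (snd p)).
  { intros n; destruct (corank_exists X d n V) as [Q [l [D H]]]; exists (Q, l, D); exact H. }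
  set (q := fun n => proj1_sig (constructive_indefinite_description _ (HQ n))).
  assert (Hq := fun n => proj2_sig (constructive_indefinite_description _ (HQ n))).
  destruct (tail_ball_cover X d C eps k Nf (fun n => fst (fst (q n)))
    (fun n => snd (fst (q n))) (fun n => snd (q n))) as [F [F1 F2]];
    [exact V|lra|lra|exact Hq|].
  exists F; split; [exact F1|].
  intros w W; destruct (F2 w W) as [z [Hz [e' [He' B]]]].
  pose proof (F1 z Hz) as Z.
  destruct (HNf z (in_dual_intro _ _ _ (proj1 Z) (proj1 (proj2 Z)))) as [K1 K2].
  change (proj1_sig (constructive_indefinite_description _ (HN z))) with (Nf z) in K1, K2.
  destruct (Hq (Nf z)) as [[QA QS] [QZ _]].
  change (proj1_sig (constructive_indefinite_description _ (HQ (Nf z)))) with (q (Nf z))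
    in QA, QS, QZ.
  set (Q := fst (fst (q (Nf z)))) in *.
  destruct W as [WL [WB _]], Z as [ZL [ZB _]].
  set (w' := fun x => w (Q x) - z (Q x)).
  assert (B' : bounded_by (fun x => w x - z x - w' x) eps)
    by (apply bounded_by_weaken with (2 := B); lra).
  assert (W' : tail_ball d (3 * C) (Nf z) w').
  { split; [|split].
    - unfold w'; split; intros.
      + rewrite QA, (proj1 WL), (proj1 ZL); ring.
      + rewrite QS, (proj2 WL), (proj2 ZL); ring.
    - apply bounded_by_weaken with (C + C + eps); [lra|].
      apply bounded_by_ext with (2 := bounded_by_minus _ _ _ _ _
        (bounded_by_minus _ _ _ _ _ WB ZB) B').
      intros x; ring.
    - intros i Hi; unfold w'; rewrite QZ by exact Hi.
      rewrite !linear_form_0 by assumption; ring. }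
  exists z; split; [exact Hz|].
  exists w'; split; [apply tail_ball_mono with (2 := W'), K1|].
  split; [exact B'|].
  intros A M HA HM; apply K2; assumption.
Qed.

(** * Branches through finite levels and their signed sums *)

Definition list_sum {X : Banach} (zs : list (X -> R)) (x : X) : R :=
  fold_right (fun z s => z x + s) 0 zs.

Definition list_abs_sum {X : Banach} (zs : list (X -> R)) (x : X) : R :=
  fold_right (fun z s => Rabs (z x) + s) 0 zs.

(** The latest choice comes first, so the length of the tail is the level of the head. *)
Fixpoint is_branch {X : Banach} (L : nat -> list (X -> R)) (zs : list (X -> R)) : Prop :=
  match zs with
  | nil => True
  | z :: t => In z (L (length t)) /\ is_branch L t
  end.

Fixpoint signed_sums {X : Banach} (zs : list (X -> R)) : list (X -> R) :=
  match zs with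
  | nil => [fun _ => 0]
  | z :: t => add_signed (signed_sums t) z
  end.

(** The signs may depend on [x]: norm bounds on the finitely many signed sums thus become a
    pointwise bound on the sum of absolute values. *)
Lemma signed_sums_abs (X : Banach) (zs : list (X -> R)) (x : X) :
  exists A, In A (signed_sums zs) /\ A x = list_abs_sum zs x.
Proof.
  induction zs as [|z t [A [HA E]]]; simpl.
  - exists (fun _ => 0); split; [left|]; reflexivity.
  - destruct (Rle_or_lt 0 (z x)) as [H|H].
    + exists (fun y => A y + z y); split; [apply in_add_signed; exists A; auto|].
      rewrite E, Rabs_right by lra; unfold list_abs_sum; ring.
    + exists (fun y => A y - z y); split; [apply in_add_signed; exists A; auto|].
      rewrite E, Rabs_left by lra; unfold list_abs_sum; ring.
Qed.

(* The levels are chosen so that [w |-> - w] changes the norm of any signed sum of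
   earlier choices plus [w] by a summable error; flipping the signs one level at a time
   then costs at most [2 * eta] in total. *)
Lemma levels_exist (X : Banach) (d : nat -> X) (eta : R) :
  property_au_star X -> total d -> 0 < eta <= 1 ->
  exists L : nat -> list (X -> R),
    (forall k z, In z (L k) -> in_dual z /\ forall i, (i < k)%nat -> z (d i) = 0) /\
    forall xs, linear_form xs -> bounded_by xs 1 -> forall k,
      exists zs, is_branch L zs /\
        (exists w, tail_ball d (1 + 2 * eta) k w /\
           bounded_by (fun x => xs x - list_sum zs x - w x) eta) /\
        forall x, list_abs_sum zs x <= (1 + 2 * eta) * bnorm x.
Proof.
  intros au V He.
  (* These errors add up to [eta]. The radius is allowed to triple at each level, since a level only
     has to be finite. *)
  set (eps := fun k : nat => eta * (/ 2) ^ S k).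
  assert (Heps : forall k, 0 < eps k <= 1).
  { intros k; unfold eps; pose proof (pow_lt (/ 2) (S k) ltac:(lra)) as H.
    assert (H' : (/ 2) ^ S k <= 1).
    { rewrite <- (pow1 (S k)); apply pow_incr; lra. }
    nra. }
  assert (HC : forall k, 1 <= 3 ^ k) by (intros k; apply pow_R1_Rle; lra).
  assert (HF : forall (k : nat) (S : list (X -> R)), exists F,
    (forall A, In A S -> in_dual A) ->
    (forall z, In z F -> tail_ball d (3 ^ k) k z) /\
    forall w, tail_ball d (3 ^ k) k w -> exists z, In z F /\
      exists w', tail_ball d (3 * 3 ^ k) (k + 1) w' /\
        bounded_by (fun x => w x - z x - w' x) (eps k) /\
        forall B M, In B (add_signed S z) -> 0 <= M ->
          (bounded_by (fun x => B x - w' x) M -> bounded_by (fun x => B x + w' x) (M + eps k)) /\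
          (bounded_by (fun x => B x + w' x) M -> bounded_by (fun x => B x - w' x) (M + eps k))).
  { intros k S; destruct (classic (forall A, In A S -> in_dual A)) as [HS|HS];
      [|exists nil; tauto].
    destruct (level_exists X d S (3 ^ k) (eps k) k au V (HC k) (Heps k) HS) as [F H].
    exists F; auto. }
  set (lev := fun k S => proj1_sig (constructive_indefinite_description _ (HF k S))).
  assert (Hlev := fun k S => proj2_sig (constructive_indefinite_description _ (HF k S))).
  (* The levels may not depend on [xs], so level [k] must serve the signed sums along all branches;
     [Sg k] is this finite set, built together with the levels. *)
  set (Sg := fix Sg k := match k with
             | O => [fun _ : X => 0]
             | S j => flat_map (fun z => add_signed (Sg j) z) (lev j (Sg j)) end).
  assert (HSg : forall k A, In A (Sg k) -> in_dual A).
  { induction k as [|k IH].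
    - intros A [<-|[]]; apply in_dual_intro with 0; [split; intros; ring|].
      intros x; rewrite Rabs_R0; lra.
    - intros A HA; simpl in HA; apply in_flat_map in HA; destruct HA as [z [Hz HA]].
      destruct (proj1 (Hlev k (Sg k) IH) z Hz) as [ZL [ZB _]].
      pose proof (in_dual_intro _ _ _ ZL ZB) as Dz.
      apply in_add_signed in HA; destruct HA as [B [HB [->| ->]]];
        [apply in_dual_plus|apply in_dual_minus]; auto. }
  set (L := fun k => lev k (Sg k)).
  assert (HL := fun k => Hlev k (Sg k) (HSg k)).
  exists L; split.
  - intros k z Hz; destruct (proj1 (HL k) z Hz) as [ZL [ZB Z0]].
    split; [exact (in_dual_intro _ _ _ ZL ZB)|exact Z0].
  - intros xs XL XB.
    set (s := fun k : nat => eta * (1 - (/ 2) ^ k)).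
    assert (s1 : forall k, s (S k) = s k + eps k) by (intros k; unfold s, eps; simpl; field).
    assert (s0 : forall k, 0 <= s k <= eta).
    { intros k; unfold s; pose proof (pow_lt (/ 2) k ltac:(lra)) as H.
      assert (H' : (/ 2) ^ k <= 1) by (rewrite <- (pow1 k); apply pow_incr; lra).
      nra. }
    (* Passing to the next level costs [2 * eps k] in the norm bound: replacing [w] by [z + w']
       costs [eps k], and flipping [w'] alone costs [eps k] again. *)
    assert (Inv : forall k, exists zs, length zs = k /\ is_branch L zs /\
      exists w, tail_ball d (3 ^ k) k w /\
        bounded_by (fun x => xs x - list_sum zs x - w x) (s k) /\
        forall A, In A (signed_sums zs) -> In A (Sg k) /\
          bounded_by (fun x => A x + w x) (1 + 2 * s k) /\
          bounded_by (fun x => A x - w x) (1 + 2 * s k)).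
    { induction k as [|k [zs [Hlen [Hbr [w [W [Hsum HA]]]]]]].
      - exists nil; split; [reflexivity|split; [exact I|]].
        exists xs; split; [split; [exact XL|split; [exact XB|lia]]|].
        assert (E : s O = 0) by (unfold s; simpl; ring).
        rewrite E; split.
        + intros x; simpl; rewrite Rminus_0_r, Rminus_diag, Rabs_R0; lra.
        + intros A [<-|[]]; split; [left; reflexivity|].
          split; intros x; specialize (XB x).
          * rewrite Rplus_0_l; lra.
          * rewrite Rminus_0_l, Rabs_Ropp; lra.
      - destruct (proj2 (HL k) w W) as [z [Hz [w' [W' [Hh Hf]]]]].
        exists (z :: zs); split; [simpl; congruence|].
        split; [split; [rewrite Hlen; exact Hz|exact Hbr]|].
        exists w'; split; [replace (S k) with (k + 1)%nat by lia; rewrite pow_add, pow_1;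
          replace (3 ^ k * 3) with (3 * 3 ^ k) by ring; exact W'|].
        rewrite s1; split.
        + apply bounded_by_ext with (2 := bounded_by_plus _ _ _ _ _ Hsum Hh).
          intros x; unfold list_sum; simpl; ring.
        + pose proof (s0 k) as Hs; pose proof (Heps k) as Hek.
          intros B HB; simpl in HB; apply in_add_signed in HB.
          destruct HB as [A [HAs HB]]; destruct (HA A HAs) as [HSA [H1 H2]].
          assert (HB' : In B (add_signed (Sg k) z)) by (apply in_add_signed; exists A; auto).
          split; [simpl; apply in_flat_map; exists z; auto|].
          destruct (Hf B (1 + 2 * s k + eps k) HB' ltac:(lra)) as [F1 F2].
          destruct HB as [->| ->].
          * assert (K : bounded_by (fun x => A x + z x + w' x) (1 + 2 * s k + eps k)).
            { apply bounded_by_ext with (2 := bounded_by_minus _ _ _ _ _ H1 Hh).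
              intros x; ring. }
            split; [apply bounded_by_weaken with (2 := K)
                   |apply bounded_by_weaken with (2 := F2 K)]; lra.
          * assert (K : bounded_by (fun x => A x - z x - w' x) (1 + 2 * s k + eps k)).
            { apply bounded_by_ext with (2 := bounded_by_plus _ _ _ _ _ H2 Hh).
              intros x; ring. }
            split; [apply bounded_by_weaken with (2 := F1 K)
                   |apply bounded_by_weaken with (2 := K)]; lra. }
    intros k; destruct (Inv k) as [zs [_ [Hbr [w [[WL [_ W0]] [Hsum HA]]]]]].
    pose proof (s0 k) as Hs.
    exists zs; split; [exact Hbr|split].
    + exists w; split; [|apply bounded_by_weaken with (2 := Hsum); lra].
      split; [exact WL|split; [|exact W0]].
      (* [w] is half the difference of [A + w] and [A - w], so the crude radius [3 ^ k] improves to
         [1 + 2 * eta]. *)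
      intros x; destruct (signed_sums_abs X zs x) as [A [HAs _]].
      destruct (HA A HAs) as [_ [H1 H2]]; specialize (H1 x); specialize (H2 x).
      pose proof (bnorm_ge0 X x).
      assert (K : (1 + 2 * s k) * bnorm x <= (1 + 2 * eta) * bnorm x)
        by (apply Rmult_le_compat_r; lra).
      revert H1 H2; unfold Rabs; repeat destruct Rcase_abs; lra.
    + intros x; destruct (signed_sums_abs X zs x) as [A [HAs <-]].
      destruct (HA A HAs) as [_ [H1 H2]]; specialize (H1 x); specialize (H2 x).
      pose proof (bnorm_ge0 X x).
      assert (K : (1 + 2 * s k) * bnorm x <= (1 + 2 * eta) * bnorm x)
        by (apply Rmult_le_compat_r; lra).
      revert H1 H2; unfold Rabs; repeat destruct Rcase_abs; lra.
Qed.

(** * Uniformly small tails: excluding c_0 from the dual *)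

Lemma Rabs_eq_0 (r : R) : Rabs r = 0 -> r = 0.
Proof. unfold Rabs; destruct Rcase_abs; lra. Qed.

Lemma sum_nonneg (f : nat -> R) (n : nat) : (forall j, 0 <= f j) -> 0 <= sum_f_R0 f n.
Proof. intros H; apply cond_pos_sum, H. Qed.

Lemma sum_mono (f : nat -> R) (m n : nat) :
  (forall j, 0 <= f j) -> (m <= n)%nat -> sum_f_R0 f m <= sum_f_R0 f n.
Proof.
  intros H Hmn; induction Hmn as [|n Hmn IH]; [lra|].
  rewrite tech5; specialize (H (S n)); lra.
Qed.

Lemma sum_term_le (f : nat -> R) (j n : nat) :
  (forall i, 0 <= f i) -> (j <= n)%nat -> f j <= sum_f_R0 f n.
Proof.
  intros H Hj; apply Rle_trans with (sum_f_R0 f j); [|apply sum_mono; assumption].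
  destruct j as [|j]; [simpl; lra|].
  rewrite tech5; pose proof (sum_nonneg f j H); lra.
Qed.

(** The left side is the sum with the sign of its [i]-th term reversed. *)
Lemma sum_flip (f : nat -> R) (i n : nat) :
  (i <= n)%nat -> Rabs (sum_f_R0 f n - 2 * f i) <= sum_f_R0 (fun j => Rabs (f j)) n.
Proof.
  intros H.
  replace (sum_f_R0 f n - 2 * f i)
    with (sum_f_R0 (fun j => f j + (if Nat.eqb j i then (fun j => - 2 * f j) j else 0)) n).
  - apply Rle_trans with (1 := Rsum_abs _ _), sum_Rle; intros j _.
    destruct (Nat.eqb j i); [|rewrite Rplus_0_r; lra].
    replace (f j + -2 * f j) with (- f j) by ring; rewrite Rabs_Ropp; lra.
  - rewrite sum_plus, (sum_indicator i (fun j => - 2 * f j)).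
    destruct (Nat.leb_spec i n); [ring|lia].
Qed.

(** [y] sums the [u j] with [n < j <= m], each with the sign that makes it nonnegative at [x0]. *)
Lemma block_functional (X : Banach) (u : nat -> X -> R) (n m : nat) (x0 : X) :
  (forall j, linear_form (u j)) -> (n <= m)%nat ->
  exists y, linear_form y /\
    (forall x, Rabs (y x) <= sum_f_R0 (fun j => Rabs (u j x)) m
                             - sum_f_R0 (fun j => Rabs (u j x)) n) /\
    y x0 = sum_f_R0 (fun j => Rabs (u j x0)) m - sum_f_R0 (fun j => Rabs (u j x0)) n.
Proof.
  intros L H; induction H as [|m H [y [Y1 [Y2 Y3]]]].
  - exists (fun _ => 0); split; [split; intros; ring|].
    split; [intros x; rewrite Rabs_R0; lra|ring].
  - set (s := if Rle_dec 0 (u (S m) x0) then 1 else -1).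
    exists (fun x => 1 * y x + s * u (S m) x); split; [apply linear_form_comb; auto|split].
    + intros x; rewrite tech5, Rmult_1_l.
      pose proof (Rabs_triang (y x) (s * u (S m) x)) as T; specialize (Y2 x).
      rewrite Rabs_mult in T.
      replace (Rabs s) with 1 in T; [lra|].
      unfold s; destruct Rle_dec; [rewrite Rabs_R1|rewrite Rabs_left]; lra.
    + rewrite tech5, Rmult_1_l, Y3; unfold s.
      destruct Rle_dec; [rewrite Rabs_right|rewrite Rabs_left]; lra.
Qed.

(* No copy of c_0 sits in the dual: let [rho] be the infimum of the tail bounds, and take
   successive blocks of norm about [rho] whose sum [g] and all its sign changes have norm
   about [rho].  Then [g - 2 y i] has norm about [rho] while [g + 2 y i] has norm at
   least about [3 rho]. *)
Lemma au_star_tails (X : Banach) (d : nat -> X) (u : nat -> X -> R) (M tau : R) :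
  property_au_star X -> total d -> (forall j, linear_form (u j)) ->
  (forall i, exists J, forall j, (j >= J)%nat -> u j (d i) = 0) ->
  (forall m x, bnorm x <= 1 -> sum_f_R0 (fun j => Rabs (u j x)) m <= M) -> tau > 0 ->
  exists n, forall m, (m >= n)%nat -> forall x, bnorm x <= 1 ->
    sum_f_R0 (fun j => Rabs (u j x)) m - sum_f_R0 (fun j => Rabs (u j x)) n <= tau.
Proof.
  intros au V L Z HM Htau; apply NNPP; intro N.
  set (U := fun m x => sum_f_R0 (fun j => Rabs (u j x)) m) in *.
  assert (Um : forall m n x, (m <= n)%nat -> U m x <= U n x).
  { intros m n x H; apply sum_mono; [intros; apply Rabs_pos|exact H]. }
  set (E := fun r => exists n, forall m, (m >= n)%nat -> forall x, bnorm x <= 1 ->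
    U m x - U n x <= r).
  destruct (Rinf_spec E tau) as [R1 R2].
  - exists M, O; intros m _ x Hx.
    assert (0 <= U O x) by (apply sum_nonneg; intros; apply Rabs_pos).
    specialize (HM m x Hx); unfold U in *; lra.
  - intros r [n Hn]; apply Rnot_lt_le; intro Hr; apply N; exists n; intros m Hm x Hx.
    specialize (Hn m Hm x Hx); unfold U in *; lra.
  - set (rho := Rinf E) in *.
    assert (Hrho : 0 < rho).
    { apply Rlt_le_trans with tau; [exact Htau|].
      apply R2; intros r [n Hn]; apply Rnot_lt_le; intro Hr; apply N; exists n.
      intros m Hm x Hx; specialize (Hn m Hm x Hx); unfold U in *; lra. }
    (* The factors 5/4 here and 3/4 for the blocks are tuned to the final comparison: [4 * y K]
       exceeds [3 * rho] somewhere on the ball, but it is the difference of functionals of norm at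
       most [(5/4 + 1/4) * rho] and [5/4 * rho]. *)
    assert (H0 : exists n0, forall m, (m >= n0)%nat -> forall x, bnorm x <= 1 ->
      U m x - U n0 x <= 5/4 * rho).
    { apply NNPP; intro C; assert (5/4 * rho <= rho); [|lra].
      apply R2; intros r [n Hn]; apply Rnot_lt_le; intro Hr; apply C; exists n.
      intros m Hm x Hx; specialize (Hn m Hm x Hx); lra. }
    destruct H0 as [n0 Hn0].
    assert (Hb : forall n, exists p : nat * (X -> R), (n < fst p)%nat /\
      linear_form (snd p) /\ (forall x, Rabs (snd p x) <= U (fst p) x - U n x) /\
      exists x, bnorm x <= 1 /\ 3/4 * rho < snd p x).
    { intros n.
      assert (C : exists m, (m >= n)%nat /\ exists x, bnorm x <= 1 /\
        3/4 * rho < U m x - U n x).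
      { apply NNPP; intro C; assert (rho <= 3/4 * rho); [|lra].
        apply R1; exists n; intros m Hm x Hx; apply Rnot_lt_le; intro C'.
        apply C; exists m; split; [exact Hm|exists x; auto]. }
      destruct C as [m [Hm [x [Hx Hgt]]]].
      destruct (block_functional X u n m x L Hm) as [y [Y1 [Y2 Y3]]].
      exists (m, y); simpl; split; [|split; [exact Y1|split; [exact Y2|]]].
      - apply Nat.nle_gt; intro Hle; pose proof (Um m n x Hle); lra.
      - exists x; split; [exact Hx|]; unfold U in Hgt; lra. }
    set (bl := fun n => proj1_sig (constructive_indefinite_description _ (Hb n))).
    assert (Hbl : forall n, (n < fst (bl n))%nat /\
      linear_form (snd (bl n)) /\ (forall x, Rabs (snd (bl n) x) <= U (fst (bl n)) x - U n x) /\
      exists x, bnorm x <= 1 /\ 3/4 * rho < snd (bl n) x).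
    { intros n; exact (proj2_sig (constructive_indefinite_description _ (Hb n))). }
    clearbody bl.
    set (nn := fix nn i := match i with O => n0 | S j => fst (bl (nn j)) end).
    assert (Hnn : extraction nn) by (intros i; apply (Hbl (nn i))).
    set (y := fun i => snd (bl (nn i))).
    assert (YL : forall i, linear_form (y i)) by (intros i; apply (Hbl (nn i))).
    assert (YU : forall i x, Rabs (y i x) <= U (nn (S i)) x - U (nn i) x)
      by (intros i; apply (Hbl (nn i))).
    assert (YS : forall I x, sum_f_R0 (fun i => Rabs (y i x)) I <= U (nn (S I)) x - U n0 x).
    { intros I x; induction I as [|I IH]; [apply YU|].
      rewrite tech5; specialize (YU (S I) x); lra. }
    assert (nn0 : forall i, (n0 <= nn i)%nat).
    { induction i as [|i IH]; [apply le_n|]; specialize (Hnn i); lia. }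
    assert (YB : forall I x, bnorm x <= 1 ->
      sum_f_R0 (fun i => Rabs (y i x)) I <= 5/4 * rho).
    { intros I x Hx; specialize (Hn0 (nn (S I)) (nn0 _) x Hx); specialize (YS I x); lra. }
    assert (SL : forall I, linear_form (fun x => sum_f_R0 (fun i => y i x) I)).
    { induction I as [|I IH]; [apply YL|]; simpl; apply linear_form_plus; auto. }
    destruct (weak_star_compact X d (fun I x => sum_f_R0 (fun i => y i x) I) (5/4 * rho))
      as [phi [g [Hphi [GL [GB Gcv]]]]].
    + exact V.
    + lra.
    + exact SL.
    + intros I; apply bounded_by_unit; [apply SL|]; intros x Hx.
      apply Rle_trans with (1 := Rsum_abs _ _), YB, Hx.
    + assert (Y1 : forall i, bounded_by (y i) (5/4 * rho)).
      { intros i; apply bounded_by_unit; [apply YL|]; intros x Hx.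
        apply Rle_trans with (2 := YB i x Hx).
        apply (sum_term_le (fun i => Rabs (y i x))); [intros; apply Rabs_pos|apply le_n]. }
      assert (Y2L : forall i, linear_form (fun x => 2 * y i x)).
      { intros i; split; intros; [rewrite (proj1 (YL i))|rewrite (proj2 (YL i))]; ring. }
      assert (Y2B : forall i, bounded_by (fun x => 2 * y i x) (2 * (5/4 * rho))).
      { intros i x; rewrite Rabs_mult, Rabs_right by lra; specialize (Y1 i x); lra. }
      assert (W : weak_star_null (fun i x => 2 * y i x)).
      { split; [intros i; exact (in_dual_intro _ _ _ (Y2L i) (Y2B i))|].
        apply (pointwise_null X d _ (2 * (5/4 * rho)) V Y2L Y2B).
        intros i; destruct (Z i) as [J HJ]; exists J; intros k Hk.
        assert (Heq : forall m n, (n >= J)%nat -> (m >= n)%nat -> U m (d i) = U n (d i)).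
        { intros m n Hn Hm; induction Hm as [|m Hm IH]; [reflexivity|].
          unfold U; rewrite tech5; fold (U m (d i)).
          rewrite HJ, Rabs_R0 by lia; rewrite IH; unfold U; ring. }
        pose proof (extraction_ge nn k Hnn) as Hge; pose proof (Hnn k) as Hlt.
        specialize (YU k (d i)); rewrite (Heq (nn (S k)) (nn k)) in YU by lia.
        pose proof (Rabs_pos (y k (d i))).
        assert (Y0 : Rabs (y k (d i)) = 0) by lra.
        apply Rabs_eq_0 in Y0; rewrite Y0; ring. }
      pose proof (in_dual_intro _ _ _ GL GB) as GD.
      destruct (au g _ GD W (rho / 4) ltac:(lra)) as [K HK].
      specialize (HK K (le_n K)); unfold Rdist in HK; rewrite Rminus_0_r in HK.
      apply Rabs_def2 in HK.
      pose proof (in_dual_intro _ _ _ (Y2L K) (Y2B K)) as YD.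
      (* Subtracting [2 * y K] reverses one sign in every partial sum from [K] on, so the bound on
         sums of absolute values survives in the limit. *)
      assert (Gm : dual_norm (fun x => g x - 2 * y K x) <= 5/4 * rho).
      { apply dual_norm_le; [apply in_dual_minus; assumption|lra|].
        apply bounded_by_unit; [apply linear_form_minus; auto|].
        intros x Hx; apply Un_cv_abs_le with (1 := Gcv x).
        exists K; intros n Hn; pose proof (extraction_ge phi n Hphi).
        apply Rle_trans with (2 := YB (phi n) x Hx).
        apply (sum_flip (fun i => y i x)); lia. }
      destruct (proj2 (proj2 (proj2 (Hbl (nn K))))) as [x [Hx Hgt]].
      fold (y K) in Hgt.
      pose proof (in_dual_plus _ _ _ GD YD) as Dp.
      pose proof (in_dual_minus _ _ _ GD YD) as Dm.
      pose proof (dual_norm_bound _ _ Dp x) as B1.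
      pose proof (dual_norm_bound _ _ Dm x) as B2.
      pose proof (dual_norm_ge0 _ _ Dp); pose proof (dual_norm_ge0 _ _ Dm).
      pose proof (Rle_abs (g x + 2 * y K x)) as A1.
      pose proof (Rle_abs (- (g x - 2 * y K x))) as A2; rewrite Rabs_Ropp in A2.
      cbv beta in B1, B2.
      set (p := dual_norm (fun x => g x + 2 * y K x)) in *.
      set (q := dual_norm (fun x => g x - 2 * y K x)) in *.
      assert (p * bnorm x <= p) by nra; assert (q * bnorm x <= q) by nra.
      lra.
Qed.

(** * Order continuous sequence spaces *)

Section SequenceSpace.

(* [adm c n] says that the weights [c 0, ..., c n] are admissible; the norm of [a] is the
   supremum of [sum_(j <= n) c j * |a j|] over admissible weights. *)
Variable adm : (nat -> R) -> nat -> Prop.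
Hypothesis adm_pos : forall c n, adm c n -> forall j, 0 <= c j.
Hypothesis adm_coord : forall j, exists c n, adm c n /\ (j <= n)%nat /\ 0 < c j.
Hypothesis adm_bound : forall j, exists M, forall c n, adm c n -> (j <= n)%nat -> c j <= M.
Hypothesis adm_cut : forall c n m, adm c n -> adm (fun j => if Nat.leb j m then 0 else c j) n.

Definition pairing (c : nat -> R) (a : nat -> R) (n : nat) : R :=
  sum_f_R0 (fun j => c j * Rabs (a j)) n.

Definition pairing_le (a : nat -> R) (r : R) : Prop :=
  forall c n, adm c n -> pairing c a n <= r.

(** The second clause says that the tails of [a] tend to 0 in norm. It selects the sequences that
    are limits of their truncations, as the unit vector basis demands. *)
Definition order_continuous (a : nat -> R) : Prop :=
  (exists B, pairing_le a B) /\
  forall eps, eps > 0 -> exists J, forall c n, adm c n ->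
    (forall j, (j <= J)%nat -> c j = 0) -> pairing c a n <= eps.

Lemma pairing_abs_le (c a b : nat -> R) (n : nat) :
  (forall j, 0 <= c j) -> (forall j, Rabs (a j) <= Rabs (b j)) ->
  pairing c a n <= pairing c b n.
Proof.
  intros C H; apply sum_Rle; intros j _; apply Rmult_le_compat_l; [apply C|apply H].
Qed.

Lemma pairing_plus (c a b e : nat -> R) (n : nat) :
  (forall j, 0 <= c j) -> (forall j, Rabs (e j) <= Rabs (a j) + Rabs (b j)) ->
  pairing c e n <= pairing c a n + pairing c b n.
Proof.
  intros C H; unfold pairing; rewrite <- sum_plus; apply sum_Rle; intros j _.
  rewrite <- Rmult_plus_distr_l; apply Rmult_le_compat_l; [apply C|apply H].
Qed.

Lemma pairing_scal (c a : nat -> R) (s : R) (n : nat) :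
  pairing c (fun j => s * a j) n = Rabs s * pairing c a n.
Proof.
  unfold pairing; rewrite scal_sum; apply sum_eq; intros j _.
  rewrite Rabs_mult; ring.
Qed.

Lemma pairing_coord (c a : nat -> R) (j n : nat) :
  (forall j, 0 <= c j) -> (j <= n)%nat -> c j * Rabs (a j) <= pairing c a n.
Proof.
  intros C H; apply (sum_term_le (fun j => c j * Rabs (a j))); [|exact H].
  intros i; apply Rmult_le_pos; [apply C|apply Rabs_pos].
Qed.

Lemma pairing_ge0 (c a : nat -> R) (n : nat) : (forall j, 0 <= c j) -> 0 <= pairing c a n.
Proof.
  intros C; apply sum_nonneg; intros j; apply Rmult_le_pos; [apply C|apply Rabs_pos].
Qed.

Lemma order_continuous_plus (a b e : nat -> R) :
  order_continuous a -> order_continuous b ->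
  (forall j, Rabs (e j) <= Rabs (a j) + Rabs (b j)) -> order_continuous e.
Proof.
  intros [[A HA] CA] [[B HB] CB] H; split.
  - exists (A + B); intros c n Hc; specialize (HA c n Hc); specialize (HB c n Hc).
    pose proof (pairing_plus c a b e n (adm_pos c n Hc) H); lra.
  - intros eps He; destruct (CA (eps / 2)) as [J1 H1]; [lra|].
    destruct (CB (eps / 2)) as [J2 H2]; [lra|].
    exists (Nat.max J1 J2); intros c n Hc Hz.
    assert (pairing c a n <= eps / 2)
      by (apply H1; [exact Hc|intros j Hj; apply Hz; lia]).
    assert (pairing c b n <= eps / 2)
      by (apply H2; [exact Hc|intros j Hj; apply Hz; lia]).
    pose proof (pairing_plus c a b e n (adm_pos c n Hc) H); lra.
Qed.

Lemma order_continuous_scal (a : nat -> R) (s : R) :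
  order_continuous a -> order_continuous (fun j => s * a j).
Proof.
  intros [[A HA] CA]; pose proof (Rabs_pos s) as Hs; split.
  - exists (Rabs s * A); intros c n Hc; rewrite pairing_scal.
    apply Rmult_le_compat_l; [exact Hs|apply HA, Hc].
  - intros eps He; destruct (CA (eps / (Rabs s + 1))) as [J HJ];
      [apply Rdiv_lt_0_compat; lra|].
    exists J; intros c n Hc Hz; rewrite pairing_scal.
    specialize (HJ c n Hc Hz); pose proof (pairing_ge0 c a n (adm_pos c n Hc)).
    assert (E : (Rabs s + 1) * (eps / (Rabs s + 1)) = eps) by (field; lra).
    assert ((Rabs s + 1) * pairing c a n <= eps)
      by (rewrite <- E; apply Rmult_le_compat_l; lra).
    lra.
Qed.

Lemma order_continuous_finite (a : nat -> R) (j : nat) :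
  (forall i, i <> j -> a i = 0) -> order_continuous a.
Proof.
  intros H.
  assert (E : forall c n, pairing c a n = if Nat.leb j n then c j * Rabs (a j) else 0).
  { intros c n; unfold pairing; rewrite <- (sum_indicator j (fun j => c j * Rabs (a j))).
    apply sum_eq; intros i _; destruct (Nat.eqb_spec i j) as [->|Hi]; [reflexivity|].
    rewrite (H i Hi), Rabs_R0; ring. }
  split.
  - destruct (adm_bound j) as [M HM]; exists (Rabs M * Rabs (a j)); intros c n Hc.
    rewrite E; pose proof (Rabs_pos (a j)) as Ha; pose proof (Rabs_pos M).
    destruct (Nat.leb_spec j n) as [Hj|Hj]; [|apply Rmult_le_pos; assumption].
    apply Rmult_le_compat_r; [exact Ha|].
    apply Rle_trans with (1 := HM c n Hc Hj), Rle_abs.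
  - intros eps He; exists j; intros c n Hc Hz; rewrite E, (Hz j (le_n j)).
    destruct (Nat.leb j n); lra.
Qed.

Definition seq_carrier : Type := {a : nat -> R | order_continuous a}.

Definition seq_norm (a : nat -> R) : R :=
  epsilon (inhabits 0%R) (fun r => is_lub (fun t => exists c n, adm c n /\ t = pairing c a n) r).

Lemma seq_norm_lub (a : nat -> R) : order_continuous a ->
  is_lub (fun t => exists c n, adm c n /\ t = pairing c a n) (seq_norm a).
Proof.
  intros [[B HB] _]; unfold seq_norm; apply epsilon_spec.
  destruct (completeness (fun t => exists c n, adm c n /\ t = pairing c a n)) as [r Hr];
    [| |exists r; exact Hr].
  - exists B; intros t [c [n [Hc ->]]]; apply HB, Hc.
  - destruct (adm_coord O) as [c [n [Hc _]]]; exists (pairing c a n), c, n; auto.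
Qed.

Lemma pairing_le_norm (a c : nat -> R) (n : nat) :
  order_continuous a -> adm c n -> pairing c a n <= seq_norm a.
Proof. intros A Hc; apply (seq_norm_lub a A); exists c, n; auto. Qed.

Lemma seq_norm_le (a : nat -> R) (r : R) :
  order_continuous a -> pairing_le a r -> seq_norm a <= r.
Proof. intros A H; apply (seq_norm_lub a A); intros t [c [n [Hc ->]]]; apply H, Hc. Qed.

Lemma seq_norm_ge0 (a : nat -> R) : order_continuous a -> 0 <= seq_norm a.
Proof.
  intros A; destruct (adm_coord O) as [c [n [Hc _]]].
  apply Rle_trans with (2 := pairing_le_norm a c n A Hc), pairing_ge0, (adm_pos c n Hc).
Qed.

Lemma seq_coord_bound (j : nat) : exists K, 0 < K /\
  forall a, order_continuous a -> Rabs (a j) <= K * seq_norm a.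
Proof.
  destruct (adm_coord j) as [c [n [Hc [Hj Hp]]]].
  exists (/ c j); split; [apply Rinv_0_lt_compat, Hp|].
  intros a A; apply Rmult_le_reg_l with (c j); [exact Hp|].
  rewrite <- Rmult_assoc, Rinv_r, Rmult_1_l by lra.
  apply Rle_trans with (2 := pairing_le_norm a c n A Hc).
  apply pairing_coord; [apply (adm_pos c n Hc)|exact Hj].
Qed.

Lemma seq_norm_scal_le (a : nat -> R) (s : R) :
  order_continuous a -> seq_norm (fun j => s * a j) <= Rabs s * seq_norm a.
Proof.
  intros A; apply seq_norm_le; [apply order_continuous_scal, A|].
  intros c n Hc; rewrite pairing_scal.
  apply Rmult_le_compat_l; [apply Rabs_pos|apply pairing_le_norm; assumption].
Qed.

Lemma seq_norm_plus (a b e : nat -> R) :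
  order_continuous a -> order_continuous b ->
  (forall j, Rabs (e j) <= Rabs (a j) + Rabs (b j)) ->
  seq_norm e <= seq_norm a + seq_norm b.
Proof.
  intros A B H; apply seq_norm_le; [apply order_continuous_plus with a b; assumption|].
  intros c n Hc.
  pose proof (pairing_plus c a b e n (adm_pos c n Hc) H).
  pose proof (pairing_le_norm a c n A Hc); pose proof (pairing_le_norm b c n B Hc); lra.
Qed.

Lemma seq_ext (a b : seq_carrier) : (forall j, proj1_sig a j = proj1_sig b j) -> a = b.
Proof.
  destruct a as [a A], b as [b B]; simpl; intros H.
  assert (E : a = b) by (apply functional_extensionality, H); subst b.
  f_equal; apply proof_irrelevance.
Qed.

Definition seq_zero : seq_carrier :=
  exist _ (fun _ => 0) (order_continuous_finite (fun _ => 0) O (fun _ _ => eq_refl)).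

Definition seq_add (a b : seq_carrier) : seq_carrier :=
  exist _ (fun j => proj1_sig a j + proj1_sig b j)
    (order_continuous_plus _ _ _ (proj2_sig a) (proj2_sig b) (fun j => Rabs_triang _ _)).

Definition seq_scal (s : R) (a : seq_carrier) : seq_carrier :=
  exist _ (fun j => s * proj1_sig a j) (order_continuous_scal _ s (proj2_sig a)).

(** Coordinates converge because each is bounded by the norm. A pairing is a finite sum, so the
    Cauchy estimate passes to the limit uniformly over admissible weights, and the limit inherits
    order continuity from a nearby term. *)
Lemma seq_complete (u : nat -> seq_carrier) :
  (forall eps, eps > 0 -> exists N, forall m n, (m >= N)%nat -> (n >= N)%nat ->
     seq_norm (proj1_sig (seq_add (u m) (seq_scal (-1) (u n)))) < eps) ->
  exists l, Un_cv (fun n => seq_norm (proj1_sig (seq_add (u n) (seq_scal (-1) l)))) 0.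
Proof.
  intros H.
  assert (Cj : forall j, Cauchy_crit (fun n => proj1_sig (u n) j)).
  { intros j eps He; destruct (seq_coord_bound j) as [K [HK HB]].
    destruct (H (eps / K)) as [N HN]; [apply Rdiv_lt_0_compat; lra|].
    exists N; intros m n Hm Hn; specialize (HN m n Hm Hn).
    pose proof (HB _ (proj2_sig (seq_add (u m) (seq_scal (-1) (u n))))) as B.
    simpl in B, HN; unfold Rdist.
    replace (proj1_sig (u m) j - proj1_sig (u n) j)
      with (proj1_sig (u m) j + -1 * proj1_sig (u n) j) by ring.
    apply Rle_lt_trans with (1 := B).
    apply Rmult_lt_compat_l with (r := K) in HN; [|exact HK].
    replace (K * (eps / K)) with eps in HN by (field; lra); exact HN. }
  set (l := fun j => proj1_sig (R_complete _ (Cj j))).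
  assert (Hl : forall j, Un_cv (fun n => proj1_sig (u n) j) (l j))
    by (intros j; exact (proj2_sig (R_complete _ (Cj j)))).
  clearbody l.
  assert (D : forall eps, eps > 0 -> exists N, forall m, (m >= N)%nat ->
    pairing_le (fun j => proj1_sig (u m) j + -1 * l j) eps).
  { intros eps He; destruct (H eps He) as [N HN]; exists N; intros m Hm c n Hc.
    assert (CV : Un_cv (fun k => pairing c (fun j => proj1_sig (u m) j + -1 * proj1_sig (u k) j) n)
      (pairing c (fun j => proj1_sig (u m) j + -1 * l j) n)).
    { assert (C1 : forall j, Un_cv
        (fun k => c j * Rabs (proj1_sig (u m) j + -1 * proj1_sig (u k) j))
        (c j * Rabs (proj1_sig (u m) j + -1 * l j))).
      { intros j; apply CV_mult; [apply Un_cv_const|].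
        apply cv_cvabs, CV_plus; [apply Un_cv_const|].
        apply CV_mult; [apply Un_cv_const|apply Hl]. }
      unfold pairing; induction n as [|n' IH] in |- *; [apply C1|].
      exact (CV_plus _ _ _ _ IH (C1 (S n'))). }
    rewrite <- (Rminus_0_r (pairing c _ n)).
    apply Rle_trans with (1 := Rle_abs _).
    apply Un_cv_abs_le with (1 := CV); exists N; intros k Hk.
    rewrite Rminus_0_r, Rabs_right by (apply Rle_ge, pairing_ge0, (adm_pos c n Hc)).
    specialize (HN m k Hm Hk).
    pose proof (pairing_le_norm _ c n (proj2_sig (seq_add (u m) (seq_scal (-1) (u k)))) Hc).
    simpl in *; lra. }
  assert (P : forall m c n, adm c n ->
    pairing c l n <= pairing c (proj1_sig (u m)) n
                     + pairing c (fun j => proj1_sig (u m) j + -1 * l j) n).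
  { intros m c n Hc; apply pairing_plus; [apply (adm_pos c n Hc)|]; intros j.
    pose proof (Rabs_triang (proj1_sig (u m) j) (- (proj1_sig (u m) j + -1 * l j))) as T.
    rewrite Rabs_Ropp in T.
    replace (proj1_sig (u m) j + - (proj1_sig (u m) j + -1 * l j)) with (l j) in T by ring.
    exact T. }
  assert (OL : order_continuous l).
  { split.
    - destruct (D 1 ltac:(lra)) as [N HN]; specialize (HN N (le_n N)).
      destruct (proj2_sig (u N)) as [[B HB] _].
      exists (B + 1); intros c n Hc; specialize (P N c n Hc).
      specialize (HN c n Hc); specialize (HB c n Hc); lra.
    - intros eps He; destruct (D (eps / 2) ltac:(lra)) as [N HN]; specialize (HN N (le_n N)).
      destruct (proj2_sig (u N)) as [_ CN]; destruct (CN (eps / 2) ltac:(lra)) as [J HJ].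
      exists J; intros c n Hc Hz; specialize (P N c n Hc).
      specialize (HN c n Hc); specialize (HJ c n Hc Hz); lra. }
  exists (exist _ l OL); intros eps He.
  destruct (D (eps / 2) ltac:(lra)) as [N HN]; exists N; intros m Hm.
  set (z := seq_add (u m) (seq_scal (-1) (exist _ l OL))).
  unfold Rdist; rewrite Rminus_0_r, Rabs_right by (apply Rle_ge, seq_norm_ge0, (proj2_sig z)).
  apply Rle_lt_trans with (eps / 2); [|lra].
  apply seq_norm_le; [exact (proj2_sig z)|exact (HN m Hm)].
Qed.

Definition seq_space : Banach.
Proof.
  refine (@Build_Banach seq_carrier seq_zero seq_add (seq_scal (-1)) seq_scal
    (fun a => seq_norm (proj1_sig a)) _ _ _ _ _ _ _ _ _ _ _ seq_complete).
  - intros x y z; apply seq_ext; intros j; simpl; ring.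
  - intros x y; apply seq_ext; intros j; simpl; ring.
  - intros x; apply seq_ext; intros j; simpl; ring.
  - intros x; apply seq_ext; intros j; simpl; ring.
  - intros x; apply seq_ext; intros j; simpl; ring.
  - intros a b x; apply seq_ext; intros j; simpl; ring.
  - intros a x y; apply seq_ext; intros j; simpl; ring.
  - intros a b x; apply seq_ext; intros j; simpl; ring.
  - intros x Hx; apply seq_ext; intros j; simpl.
    destruct (seq_coord_bound j) as [K [_ HK]]; specialize (HK _ (proj2_sig x)).
    rewrite Hx, Rmult_0_r in HK; apply Rabs_eq_0.
    apply Rle_antisym; [exact HK|apply Rabs_pos].
  - intros a x; apply Rle_antisym; [apply seq_norm_scal_le, (proj2_sig x)|].
    destruct (Req_dec a 0) as [->|Ha].
    + rewrite Rabs_R0, Rmult_0_l; apply seq_norm_ge0, (proj2_sig (seq_scal 0 x)).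
    + pose proof (seq_norm_scal_le _ (/ a) (proj2_sig (seq_scal a x))) as H.
      replace (fun j => / a * proj1_sig (seq_scal a x) j) with (proj1_sig x) in H
        by (apply functional_extensionality; intros j; simpl; field; exact Ha).
      pose proof (Rabs_pos_lt a Ha) as Hp.
      apply Rmult_le_compat_l with (r := Rabs a) in H; [|lra].
      rewrite <- Rmult_assoc, <- Rabs_mult, Rinv_r, Rabs_R1, Rmult_1_l in H by exact Ha.
      exact H.
  - intros x y; apply seq_norm_plus; [apply (proj2_sig x)|apply (proj2_sig y)|].
    intros j; apply Rabs_triang.
Defined.

Definition seq_unit (j : nat) : seq_space :=
  exist _ (fun i => if Nat.eqb i j then 1 else 0)
    (order_continuous_finite _ j (fun i Hi =>
       match Nat.eqb_spec i j in Bool.reflect _ b return (if b then 1 else 0) = 0 with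
       | Bool.ReflectT _ E => False_ind _ (Hi E)
       | Bool.ReflectF _ _ => eq_refl
       end)).

Definition seq_coord (j : nat) (a : seq_space) : R := proj1_sig a j.

Lemma seq_coord_in_dual (j : nat) : in_dual (seq_coord j).
Proof.
  destruct (seq_coord_bound j) as [K [_ HK]].
  apply in_dual_intro with K; [split; reflexivity|].
  intros a; apply HK, (proj2_sig a).
Qed.

Lemma seq_coord_vsum (a : nat -> R) (n i : nat) :
  seq_coord i (vsum (fun j => bscal (a j) (seq_unit j)) n) = if Nat.leb i n then a i else 0.
Proof.
  rewrite vsum_form by apply in_dual_linear, seq_coord_in_dual.
  rewrite <- (sum_indicator i a); apply sum_eq; intros j _.
  change (a j * (if Nat.eqb i j then 1 else 0) = if Nat.eqb j i then a j else 0).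
  rewrite (Nat.eqb_sym i j); destruct (Nat.eqb j i); ring.
Qed.

Lemma seq_space_norm_mono (a b : seq_space) :
  (forall j, Rabs (seq_coord j a) <= Rabs (seq_coord j b)) -> bnorm a <= bnorm b.
Proof.
  intros H; apply seq_norm_le; [apply (proj2_sig a)|].
  intros c n Hc; apply Rle_trans with (2 := pairing_le_norm _ c n (proj2_sig b) Hc).
  apply pairing_abs_le; [apply (adm_pos c n Hc)|exact H].
Qed.

Lemma seq_space_unconditional : one_unconditional seq_unit.
Proof.
  intros n a eps He; apply seq_space_norm_mono; intros j.
  rewrite (seq_coord_vsum (fun j => eps j * a j)), seq_coord_vsum.
  destruct (Nat.leb j n); [|lra].
  rewrite Rabs_mult; destruct (He j) as [-> | ->]; [rewrite Rabs_R1|rewrite Rabs_left]; lra.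
Qed.

Lemma seq_space_basis : schauder_basis seq_unit seq_coord.
Proof.
  intros y; split.
  - intros eps He; destruct (proj2 (proj2_sig y) (eps / 2)) as [J HJ]; [lra|].
    exists J; intros n Hn; unfold Rdist.
    rewrite Rminus_0_r, Rabs_right by apply Rle_ge, bnorm_ge0.
    apply Rle_lt_trans with (eps / 2); [|lra].
    set (z := bsub (vsum (fun j => bscal (seq_coord j y) (seq_unit j)) n) y).
    apply seq_norm_le; [apply (proj2_sig z)|].
    intros c n' Hc.
    (* Up to sign the error is a tail of [y]: pairing it with [c] is pairing [y] with [c] cut at
       [n], hence the closure of [adm] under cuts. *)
    apply Rle_trans with (2 := HJ _ n' (adm_cut c n' n Hc)
      ltac:(intros j Hj; cbv beta; destruct (Nat.leb_spec j n); [reflexivity|lia])).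
    right; apply sum_eq; intros j _.
    change (proj1_sig z j) with (seq_coord j z); unfold z.
    rewrite linear_form_sub, seq_coord_vsum by apply in_dual_linear, seq_coord_in_dual.
    unfold seq_coord; destruct (Nat.leb j n).
    + rewrite Rminus_diag, Rabs_R0; ring.
    + rewrite Rminus_0_l, Rabs_Ropp; reflexivity.
  - intros a Ha j.
    destruct (seq_coord_in_dual j) as [_ [_ [K HK]]].
    apply Rminus_diag_uniq, Rabs_eq_0, Rle_antisym; [|apply Rabs_pos].
    apply Rnot_lt_le; intro C; pose proof (Rabs_pos K).
    destruct (Ha (Rabs (a j - seq_coord j y) / (Rabs K + 1))) as [N HN];
      [apply Rdiv_lt_0_compat; lra|].
    specialize (HN (Nat.max N j) ltac:(lia)); unfold Rdist in HN.
    rewrite Rminus_0_r, Rabs_right in HN by apply Rle_ge, bnorm_ge0.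
    set (z := bsub (vsum (fun j => bscal (a j) (seq_unit j)) (Nat.max N j)) y) in *.
    specialize (HK z); unfold z in HK at 1.
    rewrite linear_form_sub, seq_coord_vsum in HK by apply in_dual_linear, seq_coord_in_dual.
    destruct (Nat.leb_spec j (Nat.max N j)); [|lia].
    pose proof (bnorm_ge0 seq_space z); pose proof (Rle_abs K).
    apply Rmult_lt_compat_l with (r := Rabs K + 1) in HN; [|lra].
    replace ((Rabs K + 1) * (Rabs (a j - seq_coord j y) / (Rabs K + 1)))
      with (Rabs (a j - seq_coord j y)) in HN by (field; lra).
    nra.
Qed.

Lemma seq_space_pairing (a : seq_space) (c : nat -> R) (n : nat) :
  adm c n -> pairing c (fun j => seq_coord j a) n <= bnorm a.
Proof. apply pairing_le_norm, (proj2_sig a). Qed.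

Lemma seq_space_norm_le (a : seq_space) (r : R) :
  pairing_le (fun j => seq_coord j a) r -> bnorm a <= r.
Proof. apply seq_norm_le, (proj2_sig a). Qed.

End SequenceSpace.
(** * The embedding *)

Lemma in_dual_cv (Y : Banach) (f : Y -> R) (u : nat -> Y) (l : Y) :
  in_dual f -> conv_to u l -> Un_cv (fun n => f (u n)) (f l).
Proof.
  intros F H eps He; pose proof (dual_norm_ge0 _ _ F) as HD.
  destruct (H (eps / (dual_norm f + 1))) as [N HN]; [apply Rdiv_lt_0_compat; lra|].
  exists N; intros n Hn; specialize (HN n Hn); unfold Rdist in *.
  rewrite Rminus_0_r, Rabs_right in HN by apply Rle_ge, bnorm_ge0.
  rewrite <- (linear_form_sub _ _ _ _ (in_dual_linear _ _ F)).
  pose proof (dual_norm_bound _ _ F (bsub (u n) l)); pose proof (bnorm_ge0 Y (bsub (u n) l)).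
  apply Rmult_lt_compat_l with (r := dual_norm f + 1) in HN; [|lra].
  replace ((dual_norm f + 1) * (eps / (dual_norm f + 1))) with eps in HN by (field; lra).
  nra.
Qed.

(** Coefficients of a norm convergent expansion are recovered by evaluating at [e j], so uniqueness
    is automatic. *)
Lemma shrinking_intro (Y : Banach) (e : nat -> Y) (ef : nat -> Y -> R) :
  schauder_basis e ef -> (forall j, in_dual (ef j)) ->
  (forall f, in_dual f ->
     Un_cv (fun n => dual_norm (fun y => f y - sum_f_R0 (fun j => f (e j) * ef j y) n)) 0) ->
  shrinking ef.
Proof.
  intros B E H; split; [exact E|]; intros f F; exists (fun j => f (e j)).
  split; [apply H, F|]; intros b Hb j.
  apply Rminus_diag_uniq, Rabs_eq_0, Rle_antisym; [|apply Rabs_pos].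
  apply Rnot_lt_le; intro C; pose proof (bnorm_ge0 Y (e j)) as He.
  destruct (Hb (Rabs (b j - f (e j)) / (bnorm (e j) + 1))) as [N HN];
    [apply Rdiv_lt_0_compat; lra|].
  specialize (HN (Nat.max N j) ltac:(lia)); unfold Rdist in HN; rewrite Rminus_0_r in HN.
  set (n := Nat.max N j) in *.
  assert (G : in_dual (fun y => f y - sum_f_R0 (fun i => b i * ef i y) n))
    by (apply in_dual_minus; [exact F|apply in_dual_sum, E]).
  pose proof (dual_norm_bound _ _ G (e j)) as K; cbv beta in K.
  pose proof (Rle_abs (dual_norm (fun y => f y - sum_f_R0 (fun i => b i * ef i y) n))) as A.
  rewrite (sum_eq _ (fun i => if Nat.eqb i j then b i else 0)) in K.
  - rewrite sum_indicator in K; destruct (Nat.leb_spec j n); [|lia].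
    rewrite Rabs_minus_sym in K.
    apply Rmult_lt_compat_r with (r := bnorm (e j) + 1) in HN; [|lra].
    replace (Rabs (b j - f (e j)) / (bnorm (e j) + 1) * (bnorm (e j) + 1))
      with (Rabs (b j - f (e j))) in HN by (field; lra).
    pose proof (dual_norm_ge0 _ _ G); nra.
  - intros i _; rewrite (schauder_basis_biorthogonal Y e ef j i B).
    destruct (Nat.eqb i j); ring.
Qed.

Lemma sum_cut (f : nat -> R) (n m : nat) : (n <= m)%nat ->
  sum_f_R0 (fun j => if Nat.leb j n then 0 else f j) m = sum_f_R0 f m - sum_f_R0 f n.
Proof.
  intros H; induction H as [|m H IH].
  - rewrite Rminus_diag, (sum_eq _ (fun _ => 0)); [rewrite sum_cte; ring|].
    intros i Hi; destruct (Nat.leb_spec i n); [reflexivity|lia].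
  - rewrite !tech5, IH; destruct (Nat.leb_spec (S m) n); [lia|ring].
Qed.

Lemma bounded_sum_tails (f : nat -> R) (B tau : R) :
  (forall j, 0 <= f j) -> (forall n, sum_f_R0 f n <= B) -> tau > 0 ->
  exists n, forall m, (m >= n)%nat -> sum_f_R0 f m - sum_f_R0 f n <= tau.
Proof.
  intros P H Ht.
  destruct (growing_cv (sum_f_R0 f)) as [l Hl].
  - intros n; apply sum_mono; [exact P|lia].
  - exists B; intros r [n ->]; apply H.
  - destruct (CV_Cauchy _ (exist _ l Hl) tau Ht) as [N HN]; exists N; intros m Hm.
    specialize (HN m N Hm (le_n N)); unfold Rdist in HN.
    pose proof (Rle_abs (sum_f_R0 f m - sum_f_R0 f N)); lra.
Qed.

Section Embedding.

Variables (X : Banach) (d : nat -> X) (D : nat -> X -> R) (omega : nat -> R).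
Hypothesis au : property_au_star X.
Hypothesis d_total : total d.
Hypothesis D_dual : forall j, in_dual (D j).
Hypothesis D_null : forall i, exists J, forall j, (j >= J)%nat -> D j (d i) = 0.
Hypothesis omega_pos : forall j, 0 < omega j.

(* The summand [omega j] keeps the norm definite when [D j = 0]. *)
Definition weight (x : X) (j : nat) : R := Rabs (D j x) + omega j.

Definition admissible (c : nat -> R) (n : nat) : Prop :=
  (forall j, 0 <= c j) /\
  forall x, bnorm x <= 1 -> sum_f_R0 (fun j => c j * weight x j) n <= 1.

Lemma weight_pos (x : X) (j : nat) : 0 < weight x j.
Proof. unfold weight; pose proof (Rabs_pos (D j x)); specialize (omega_pos j); lra. Qed.

Lemma admissible_pos (c : nat -> R) (n : nat) : admissible c n -> forall j, 0 <= c j.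
Proof. intros H; apply H. Qed.

Lemma admissible_coord (j : nat) :
  exists c n, admissible c n /\ (j <= n)%nat /\ 0 < c j.
Proof.
  pose proof (dual_norm_ge0 _ _ (D_dual j)) as HD; pose proof (omega_pos j) as Ho.
  assert (P : 0 < / (dual_norm (D j) + omega j)) by (apply Rinv_0_lt_compat; lra).
  exists (fun i => if Nat.eqb i j then / (dual_norm (D j) + omega j) else 0), j.
  split; [split|split; [lia|rewrite Nat.eqb_refl; exact P]].
  - intros i; destruct (Nat.eqb i j); lra.
  - intros x Hx.
    rewrite (sum_eq _ (fun i => if Nat.eqb i j
      then (fun i => / (dual_norm (D j) + omega j) * weight x i) i else 0)).
    + rewrite sum_indicator, Nat.leb_refl.
      apply Rmult_le_reg_l with (dual_norm (D j) + omega j); [lra|].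
      rewrite <- Rmult_assoc, Rinv_r, Rmult_1_l, Rmult_1_r by lra.
      unfold weight; pose proof (dual_norm_bound _ _ (D_dual j) x).
      pose proof (bnorm_ge0 X x); nra.
    + intros i _; destruct (Nat.eqb i j); ring.
Qed.

(** At [x = 0] only [omega] remains in the weights, which leaves [c j * omega j <= 1]. *)
Lemma admissible_bound (j : nat) :
  exists M, forall c n, admissible c n -> (j <= n)%nat -> c j <= M.
Proof.
  exists (/ omega j); intros c n [Hc H] Hj; pose proof (omega_pos j) as Ho.
  specialize (H bzero); rewrite bnorm_zero in H; specialize (H Rle_0_1).
  pose proof (sum_term_le (fun j => c j * weight bzero j) j n) as T; cbv beta in T.
  assert (K : c j * weight bzero j <= 1).
  { apply Rle_trans with (2 := H), T; [|exact Hj].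
    intros i; apply Rmult_le_pos; [apply Hc|apply Rlt_le, weight_pos]. }
  apply Rmult_le_reg_r with (omega j); [exact Ho|].
  rewrite Rinv_l by lra; apply Rle_trans with (2 := K).
  apply Rmult_le_compat_l; [apply Hc|].
  unfold weight; pose proof (Rabs_pos (D j bzero)); lra.
Qed.

Lemma admissible_cut (c : nat -> R) (n m : nat) :
  admissible c n -> admissible (fun j => if Nat.leb j m then 0 else c j) n.
Proof.
  intros [Hc H]; split.
  - intros j; destruct (Nat.leb j m); [lra|apply Hc].
  - intros x Hx; apply Rle_trans with (2 := H x Hx), sum_Rle; intros j _.
    apply Rmult_le_compat_r; [apply Rlt_le, weight_pos|].
    specialize (Hc j); destruct (Nat.leb j m); lra.
Qed.

Definition emb_space : Banach :=
  seq_space admissible admissible_pos admissible_coord admissible_bound.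

Definition emb_unit : nat -> emb_space :=
  seq_unit admissible admissible_pos admissible_coord admissible_bound.

Definition emb_coord : nat -> emb_space -> R :=
  seq_coord admissible admissible_pos admissible_coord admissible_bound.

Lemma emb_basis : schauder_basis emb_unit emb_coord.
Proof. apply seq_space_basis, admissible_cut. Qed.

Lemma emb_coord_dual (j : nat) : in_dual (emb_coord j).
Proof. apply seq_coord_in_dual. Qed.

Lemma emb_coord_vsum (a : nat -> R) (n i : nat) :
  emb_coord i (vsum (fun j => bscal (a j) (emb_unit j)) n) = if Nat.leb i n then a i else 0.
Proof. apply seq_coord_vsum. Qed.

Lemma emb_pairing (a : emb_space) (c : nat -> R) (n : nat) :
  admissible c n -> pairing c (fun j => emb_coord j a) n <= bnorm a.
Proof. apply seq_space_pairing. Qed.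

(* A bounded functional satisfies the inequality defining admissibility, up to its norm:
   test it on the vector with coordinates [weight x j] of suitable signs. *)
Lemma emb_dual_weights (f : emb_space -> R) (m : nat) (x : X) :
  in_dual f -> bnorm x <= 1 ->
  sum_f_R0 (fun j => Rabs (f (emb_unit j)) * weight x j) m <= dual_norm f.
Proof.
  intros F Hx; pose proof (in_dual_linear _ _ F) as L.
  set (a := fun j => (if Rle_dec 0 (f (emb_unit j)) then 1 else -1) * weight x j).
  set (z := vsum (fun j => bscal (a j) (emb_unit j)) m).
  assert (E : sum_f_R0 (fun j => Rabs (f (emb_unit j)) * weight x j) m = f z).
  { unfold z; rewrite (vsum_form _ f _ m L); apply sum_eq; intros j _.
    rewrite (proj2 L); unfold a; destruct Rle_dec;
      [rewrite Rabs_right|rewrite Rabs_left]; lra. }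
  assert (Nz : bnorm z <= 1).
  { apply seq_space_norm_le; intros c n [Hc Hw]; apply Rle_trans with (2 := Hw x Hx).
    apply sum_Rle; intros j _; apply Rmult_le_compat_l; [apply Hc|].
    change (Rabs (emb_coord j z) <= weight x j); unfold z; rewrite emb_coord_vsum.
    pose proof (weight_pos x j) as Hp.
    destruct (Nat.leb j m); [|rewrite Rabs_R0; lra].
    unfold a; rewrite Rabs_mult, (Rabs_right (weight x j)) by lra.
    destruct Rle_dec; [rewrite Rabs_R1|rewrite Rabs_left]; lra. }
  rewrite E; apply Rle_trans with (1 := Rle_abs _).
  apply Rle_trans with (1 := dual_norm_bound _ _ F z).
  pose proof (dual_norm_ge0 _ _ F); nra.
Qed.

(** The weights split in two. The [omega] part is a convergent series independent of [x]; the other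
    part is the sum of the absolute values of [f (e j) * D j], which are bounded on the ball and
    vanish at each [d i] from some index on, so (au-star) makes its tails uniformly small. *)
Lemma emb_dual_tails (f : emb_space -> R) (tau : R) : in_dual f -> tau > 0 ->
  exists n, forall m, (m >= n)%nat -> forall x, bnorm x <= 1 ->
    sum_f_R0 (fun j => Rabs (f (emb_unit j)) * weight x j) m
    - sum_f_R0 (fun j => Rabs (f (emb_unit j)) * weight x j) n <= tau.
Proof.
  intros F Ht.
  set (b := fun j => f (emb_unit j)).
  assert (Sp : forall m x, sum_f_R0 (fun j => Rabs (b j) * weight x j) m
    = sum_f_R0 (fun j => Rabs (b j * D j x)) m + sum_f_R0 (fun j => Rabs (b j) * omega j) m).
  { intros m x; rewrite <- sum_plus; apply sum_eq; intros j _.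
    unfold weight; rewrite Rabs_mult; ring. }
  assert (Pu : forall x j, 0 <= Rabs (b j * D j x)) by (intros; apply Rabs_pos).
  assert (Po : forall j, 0 <= Rabs (b j) * omega j).
  { intros j; apply Rmult_le_pos; [apply Rabs_pos|apply Rlt_le, omega_pos]. }
  assert (W : forall m x, bnorm x <= 1 -> sum_f_R0 (fun j => Rabs (b j * D j x)) m
    + sum_f_R0 (fun j => Rabs (b j) * omega j) m <= dual_norm f).
  { intros m x Hx; rewrite <- Sp; apply emb_dual_weights; assumption. }
  destruct (au_star_tails X d (fun j x => b j * D j x) (dual_norm f) (tau / 2))
    as [n1 H1].
  - exact au.
  - exact d_total.
  - intros j; pose proof (in_dual_linear _ _ (D_dual j)) as L.
    split; intros; [rewrite (proj1 L)|rewrite (proj2 L)]; ring.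
  - intros i; destruct (D_null i) as [J HJ]; exists J; intros j Hj.
    rewrite HJ by exact Hj; ring.
  - intros m x Hx; specialize (W m x Hx).
    pose proof (sum_nonneg _ m Po); lra.
  - lra.
  - destruct (bounded_sum_tails (fun j => Rabs (b j) * omega j) (dual_norm f) (tau / 2))
      as [n2 H2].
    + exact Po.
    + intros n; specialize (W n bzero); rewrite bnorm_zero in W; specialize (W Rle_0_1).
      pose proof (sum_nonneg _ n (Pu bzero)); lra.
    + lra.
    + exists (Nat.max n1 n2); intros m Hm x Hx; fold b; rewrite !Sp.
      specialize (H1 m ltac:(lia) x Hx); specialize (H2 m ltac:(lia)).
      pose proof (sum_mono _ n1 (Nat.max n1 n2) (Pu x) ltac:(lia)).
      pose proof (sum_mono _ n2 (Nat.max n1 n2) Po ltac:(lia)); lra.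
Qed.

(** If the weighted tail of [|f (e j)|] is at most [tau] on the unit ball of [X], then this tail
    divided by [tau] is admissible. Pairing it with [y] bounds the tail of [f] at [y] by
    [tau * ||y||]. *)
Lemma emb_shrinking : shrinking emb_coord.
Proof.
  apply (shrinking_intro emb_space emb_unit emb_coord emb_basis emb_coord_dual).
  intros f F eps He; pose proof (in_dual_linear _ _ F) as L.
  destruct (emb_dual_tails f (eps / 2) F ltac:(lra)) as [n0 H0].
  exists n0; intros n Hn.
  assert (G : in_dual (fun y => f y - sum_f_R0 (fun j => f (emb_unit j) * emb_coord j y) n))
    by (apply in_dual_minus; [exact F|apply in_dual_sum, emb_coord_dual]).
  unfold Rdist; rewrite Rminus_0_r, Rabs_right by apply Rle_ge, dual_norm_ge0, G.
  apply Rle_lt_trans with (eps / 2); [|lra].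
  apply dual_norm_le; [exact G|lra|]; intros y.
  set (S := fun m => sum_f_R0 (fun j => f (emb_unit j) * emb_coord j y) m).
  apply Un_cv_abs_le with (u := S).
  - apply Un_cv_ext with (2 := in_dual_cv _ f _ y F (proj1 (emb_basis y))).
    intros m; rewrite (vsum_form _ f _ m L); apply sum_eq; intros j _.
    rewrite (proj2 L); ring.
  - exists n; intros m Hm; unfold S; rewrite <- sum_cut by exact Hm.
    apply Rle_trans with (1 := Rsum_abs _ _).
    set (c := fun j => if Nat.leb j n then 0 else / (eps / 2) * Rabs (f (emb_unit j))).
    assert (Hi : 0 < / (eps / 2)) by (apply Rinv_0_lt_compat; lra).
    assert (Hc : admissible c m).
    { split.
      - intros j; unfold c; destruct (Nat.leb j n); [lra|].
        apply Rmult_le_pos; [lra|apply Rabs_pos].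
      - intros x Hx.
        rewrite (sum_eq _ (fun j => (if Nat.leb j n then 0
          else Rabs (f (emb_unit j)) * weight x j) * / (eps / 2))).
        + rewrite <- scal_sum, sum_cut by exact Hm.
          apply Rmult_le_reg_l with (eps / 2); [lra|].
          rewrite <- Rmult_assoc, Rinv_r, Rmult_1_l, Rmult_1_r by lra.
          pose proof (H0 m ltac:(lia) x Hx).
          pose proof (sum_mono (fun j => Rabs (f (emb_unit j)) * weight x j) n0 n) as Mo.
          enough (sum_f_R0 (fun j => Rabs (f (emb_unit j)) * weight x j) n0
            <= sum_f_R0 (fun j => Rabs (f (emb_unit j)) * weight x j) n) by lra.
          apply Mo; [|exact Hn].
          intros j; apply Rmult_le_pos; [apply Rabs_pos|apply Rlt_le, weight_pos].
        + intros j _; unfold c; destruct (Nat.leb j n); ring. }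
    pose proof (emb_pairing y c m Hc) as P.
    apply Rmult_le_compat_l with (r := eps / 2) in P; [|lra].
    apply Rle_trans with (2 := P); right.
    unfold pairing; rewrite scal_sum; apply sum_eq; intros j _.
    unfold c; destruct (Nat.leb j n); [rewrite Rabs_R0; ring|].
    rewrite Rabs_mult; field; lra.
Qed.

Hypothesis d_dense : forall x eps, eps > 0 -> exists n, bnorm (bsub x (d n)) < eps.

Lemma evaluation_pairing (x : X) (c : nat -> R) (n : nat) :
  admissible c n -> pairing c (fun j => D j x) n <= bnorm x.
Proof.
  intros [Hc Hw].
  destruct (Req_dec (bnorm x) 0) as [Hx|Hx].
  - unfold pairing; rewrite (sum_eq _ (fun _ => 0)).
    + rewrite sum_cte; pose proof (bnorm_ge0 X x); lra.
    + intros j _; rewrite (bnorm_eq0 X x Hx).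
      rewrite (linear_form_0 _ _ (in_dual_linear _ _ (D_dual j))), Rabs_R0; ring.
  - pose proof (bnorm_ge0 X x) as Hp.
    assert (Hi : 0 < / bnorm x) by (apply Rinv_0_lt_compat; lra).
    assert (Hu : bnorm (bscal (/ bnorm x) x) <= 1).
    { rewrite bnorm_scal, Rabs_right by lra; right; field; exact Hx. }
    apply Rmult_le_reg_l with (/ bnorm x); [exact Hi|].
    rewrite Rinv_l by exact Hx; apply Rle_trans with (2 := Hw _ Hu).
    unfold pairing; rewrite scal_sum; apply sum_Rle; intros j _.
    rewrite Rmult_assoc; apply Rmult_le_compat_l; [apply Hc|].
    unfold weight; rewrite (proj2 (in_dual_linear _ _ (D_dual j))).
    rewrite Rabs_mult, (Rabs_right (/ bnorm x)) by lra.
    pose proof (omega_pos j); lra.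
Qed.

(** For [d i] close to [x], weights supported beyond the index where all [D j] vanish at [d i] see
    only [x - d i]. *)
Lemma evaluation_order_continuous (x : X) : order_continuous admissible (fun j => D j x).
Proof.
  split; [exists (bnorm x); intros c n Hc; apply evaluation_pairing, Hc|].
  intros eps He; destruct (d_dense x eps He) as [i Hi]; destruct (D_null i) as [J HJ].
  exists J; intros c n Hc Hz.
  apply Rle_trans with (pairing c (fun j => D j (bsub x (d i))) n).
  - apply sum_Rle; intros j _.
    destruct (Nat.le_gt_cases j J) as [Hj|Hj]; [rewrite Hz by exact Hj; lra|].
    rewrite linear_form_sub, (HJ j), Rminus_0_r
      by (apply in_dual_linear, D_dual) || lia; lra.
  - apply Rle_trans with (1 := evaluation_pairing _ c n Hc); lra.
Qed.

Definition evaluation (x : X) : emb_space :=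
  exist _ (fun j => D j x) (evaluation_order_continuous x).

Lemma evaluation_linear : is_linear evaluation.
Proof.
  split; intros; apply seq_ext; intros j; simpl; apply in_dual_linear, D_dual.
Qed.

Lemma evaluation_contractive (x : X) : bnorm (evaluation x) <= bnorm x.
Proof.
  apply seq_space_norm_le; intros c n Hc; exact (evaluation_pairing x c n Hc).
Qed.

Lemma emb_space_good : has_shrinking_1unc_basis emb_space.
Proof.
  exists emb_unit, emb_coord; split; [exact emb_basis|split; [|exact emb_shrinking]].
  apply seq_space_unconditional.
Qed.

End Embedding.

(** * Enumeration of the levels and the lower estimate *)

(** An index codes a level and a position in it; positions past the end of the list give the zero
    functional. *)
Definition level_functional {X : Banach} (L : nat -> list (X -> R)) (j : nat) : X -> R :=
  nth (snd (Cantor.of_nat j)) (L (fst (Cantor.of_nat j))) (fun _ => 0).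

Lemma cantor_box (A : nat) (B : nat -> nat) : exists J, forall k p,
  (k < A)%nat -> (p < B k)%nat -> (Cantor.to_nat (k, p) < J)%nat.
Proof.
  assert (H1 : forall k n, exists J, forall p, (p < n)%nat -> (Cantor.to_nat (k, p) < J)%nat).
  { intros k; induction n as [|n [J HJ]]; [exists O; lia|].
    exists (Nat.max J (S (Cantor.to_nat (k, n)))); intros p Hp.
    destruct (Nat.eq_dec p n) as [->|Hn]; [lia|]; specialize (HJ p ltac:(lia)); lia. }
  induction A as [|A [J HJ]]; [exists O; lia|].
  destruct (H1 A (B A)) as [J' HJ']; exists (Nat.max J J'); intros k p Hk Hp.
  destruct (Nat.eq_dec k A) as [->|Hn]; [specialize (HJ' p Hp); lia|].
  specialize (HJ k p ltac:(lia) Hp); lia.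
Qed.

Lemma level_functional_cases (X : Banach) (L : nat -> list (X -> R)) (j : nat) :
  In (level_functional L j) (L (fst (Cantor.of_nat j)))
  \/ level_functional L j = (fun _ => 0).
Proof.
  unfold level_functional.
  destruct (Nat.lt_ge_cases (snd (Cantor.of_nat j)) (length (L (fst (Cantor.of_nat j)))))
    as [H|H]; [left; apply nth_In, H|right; apply nth_overflow, H].
Qed.

(** Levels above [i] vanish at [d i]. The other levels have finitely many entries, all coded below
    [J]; their remaining codes give the default 0. *)
Lemma level_functional_null (X : Banach) (L : nat -> list (X -> R)) (d : nat -> X) (i : nat) :
  (forall k z, In z (L k) -> forall i, (i < k)%nat -> z (d i) = 0) ->
  exists J, forall j, (j >= J)%nat -> level_functional L j (d i) = 0.
Proof.
  intros H; destruct (cantor_box (S i) (fun k => length (L k))) as [J HJ].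
  exists J; intros j Hj.
  destruct (level_functional_cases X L j) as [Hin| ->]; [|reflexivity].
  destruct (Nat.le_gt_cases (fst (Cantor.of_nat j)) i) as [Hk|Hk]; [|exact (H _ _ Hin i Hk)].
  unfold level_functional; rewrite nth_overflow; [reflexivity|].
  apply Nat.nlt_ge; intros Hp.
  specialize (HJ (fst (Cantor.of_nat j)) (snd (Cantor.of_nat j)) ltac:(lia) Hp).
  rewrite <- surjective_pairing, Cantor.cancel_to_of in HJ; lia.
Qed.

Lemma sum_extend (f : nat -> R) (n m : nat) : (n <= m)%nat ->
  (forall j, (n < j)%nat -> f j = 0) -> sum_f_R0 f m = sum_f_R0 f n.
Proof.
  intros H Z; induction H as [|m H IH]; [reflexivity|].
  rewrite tech5, IH, Z by lia; ring.
Qed.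

(** [c] is the indicator of the codes of the choices. A branch visits each level once, so each new
    choice has a fresh code even when the same functional recurs. Arbitrary [g] lets the same
    weights serve for absolute values at different points. *)
Lemma branch_weights (X : Banach) (L : nat -> list (X -> R)) (zs : list (X -> R)) :
  is_branch L zs -> exists (c : nat -> R) (n : nat),
    (forall j, c j = 0 \/ c j = 1 /\ (fst (Cantor.of_nat j) < length zs)%nat /\ (j <= n)%nat) /\
    forall g : (X -> R) -> R,
      sum_f_R0 (fun j => c j * g (level_functional L j)) n
      = fold_right (fun z s => g z + s) 0 zs.
Proof.
  induction zs as [|z t IH]; simpl.
  - intros _; exists (fun _ => 0), O; split; [auto|]; intros g; simpl; ring.
  - intros [Hz Ht]; destruct (IH Ht) as [c [n [Hc Hg]]].
    destruct (In_nth _ _ (fun _ => 0) Hz) as [p [Hp Ez]].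
    set (j0 := Cantor.to_nat (length t, p)).
    assert (E0 : Cantor.of_nat j0 = (length t, p)) by apply Cantor.cancel_of_to.
    assert (D0 : level_functional L j0 = z).
    { unfold level_functional; rewrite E0; exact Ez. }
    assert (C0 : c j0 = 0).
    { destruct (Hc j0) as [H|[_ [H _]]]; [exact H|].
      rewrite E0 in H; simpl in H; lia. }
    exists (fun j => if Nat.eqb j j0 then 1 else c j), (Nat.max n j0); split.
    + intros j; destruct (Nat.eqb_spec j j0) as [->|Hj].
      * right; split; [reflexivity|]; rewrite E0; simpl; lia.
      * destruct (Hc j) as [H|[H1 [H2 H3]]]; [left; exact H|right]; lia || auto.
        split; [exact H1|lia].
    + intros g; rewrite (sum_eq _ (fun j => c j * g (level_functional L j)
        + (if Nat.eqb j j0 then (fun j => g (level_functional L j)) j else 0))).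
      * rewrite sum_plus, (sum_indicator j0 (fun j => g (level_functional L j))).
        destruct (Nat.leb_spec j0 (Nat.max n j0)); [|lia].
        rewrite (sum_extend _ n), Hg, D0; [ring|lia|].
        intros j Hj; destruct (Hc j) as [->|[_ [_ H']]]; [ring|lia].
      * intros j _; destruct (Nat.eqb_spec j j0) as [->|Hj]; [rewrite C0|]; ring.
Qed.

Lemma list_sum_abs (X : Banach) (zs : list (X -> R)) (x : X) :
  Rabs (list_sum zs x) <= list_abs_sum zs x.
Proof.
  unfold list_sum, list_abs_sum; induction zs as [|z t IH]; simpl; [rewrite Rabs_R0; lra|].
  apply Rle_trans with (1 := Rabs_triang _ _); lra.
Qed.

Lemma geometric_sum_le (eta : R) (n : nat) : 0 <= eta ->
  sum_f_R0 (fun j => eta * (/ 2) ^ S j) n <= eta.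
Proof.
  intros H.
  enough (E : sum_f_R0 (fun j => eta * (/ 2) ^ S j) n = eta * (1 - (/ 2) ^ S n)).
  { rewrite E; pose proof (pow_lt (/ 2) (S n) ltac:(lra)); nra. }
  induction n as [|n IH]; [simpl; field|].
  rewrite tech5, IH; simpl; field.
Qed.

(** For the lower bound, a functional norming [x] is replaced by the sum of a branch. The remainder
    [w] is negligible at [x] because it annihilates a close approximation of [x], and the branch sum
    is at most a pairing of [T x] with admissible weights, up to the factor [1 + 3 * eta]. *)
Lemma almost_isometric_embedding (X : Banach) (d : nat -> X) (eta : R) :
  property_au_star X -> (forall x eps, eps > 0 -> exists n, bnorm (bsub x (d n)) < eps) ->
  0 < eta < 1 ->
  exists (Y : Banach) (T : X -> Y), has_shrinking_1unc_basis Y /\ is_linear T /\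
    (forall x, bnorm (T x) <= bnorm x) /\
    forall x, (1 - eta) * bnorm x <= (1 + 3 * eta) * bnorm (T x).
Proof.
  intros au dense He; pose proof (dense_total X d dense) as V.
  destruct (levels_exist X d eta au V ltac:(lra)) as [L [HL HB]].
  set (D := level_functional L).
  set (omega := fun j : nat => eta * (/ 2) ^ S j).
  assert (DD : forall j, in_dual (D j)).
  { intros j; unfold D; destruct (level_functional_cases X L j) as [H| ->]; [apply (HL _ _ H)|].
    apply in_dual_intro with 0; [split; intros; ring|].
    intros x; rewrite Rabs_R0; lra. }
  assert (DN : forall i, exists J, forall j, (j >= J)%nat -> D j (d i) = 0).
  { intros i; apply level_functional_null; intros k z Hz; apply (HL k z Hz). }
  assert (OP : forall j, 0 < omega j).
  { intros j; apply Rmult_lt_0_compat; [lra|apply pow_lt; lra]. }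
  exists (emb_space X D omega DD OP), (evaluation X d D omega DD DN OP dense).
  split; [apply (emb_space_good X d D omega au V DD DN OP)|].
  split; [apply evaluation_linear|split; [apply evaluation_contractive|]].
  intros x; set (Tx := evaluation X d D omega DD DN OP dense x).
  apply Rnot_lt_le; intro C.
  set (gap := (1 - eta) * bnorm x - (1 + 3 * eta) * bnorm Tx).
  assert (Hgap : 0 < gap) by (unfold gap; lra).
  (* With [||w|| <= 1 + 2 * eta] and [w (d i) = 0], this precision gives [|w x| <= gap / 2]. *)
  destruct (dense x (gap / (2 * (1 + 2 * eta)))) as [i Hi]; [apply Rdiv_lt_0_compat; lra|].
  destruct (norming_functional X d x V) as [xs [XL [XB Xx]]].
  (* Level [S i], not [i]: the remainder must vanish at [d i] itself. *)
  destruct (HB xs XL XB (S i)) as [zs [Hbr [[w [[WL [WB W0]] Hsum]] Habs]]].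
  destruct (branch_weights X L zs Hbr) as [c [n [Hc Hg]]].
  fold D in Hg.
  assert (Hc01 : forall j, 0 <= c j <= 1) by (intros j; destruct (Hc j) as [->|[-> _]]; lra).
  (* The branch contributes [1 + 2 * eta] and the total mass of [omega] contributes [eta]. *)
  set (s := / (1 + 3 * eta)).
  assert (Hs : 0 < s) by (apply Rinv_0_lt_compat; lra).
  assert (Adm : admissible X D omega (fun j => s * c j) n).
  { split; [intros j; apply Rmult_le_pos; [lra|apply Hc01]|].
    intros y Hy.
    rewrite (sum_eq _ (fun j => (c j * Rabs (D j y) + c j * omega j) * s)).
    - rewrite <- scal_sum, sum_plus, (Hg (fun z => Rabs (z y))).
      fold (list_abs_sum zs y).
      assert (H1 : sum_f_R0 (fun j => c j * omega j) n <= eta).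
      { apply Rle_trans with (2 := geometric_sum_le eta n ltac:(lra)), sum_Rle.
        intros j _; specialize (Hc01 j); pose proof (OP j); unfold omega in *; nra. }
      specialize (Habs y).
      apply Rle_trans with (s * (1 + 3 * eta)); [|unfold s; right; field; lra].
      apply Rmult_le_compat_l; [lra|]; nra.
    - intros j _; unfold weight; ring. }
  assert (H1 : list_abs_sum zs x <= (1 + 3 * eta) * bnorm Tx).
  { pose proof (emb_pairing X D omega DD OP Tx _ n Adm) as P.
    replace (pairing (fun j => s * c j) (fun j => emb_coord X D omega DD OP j Tx) n)
      with (s * list_abs_sum zs x) in P.
    - apply Rmult_le_compat_l with (r := 1 + 3 * eta) in P; [|lra].
      replace ((1 + 3 * eta) * (s * list_abs_sum zs x)) with (list_abs_sum zs x) in P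
        by (unfold s; field; lra).
      exact P.
    - unfold list_abs_sum, pairing; rewrite <- (Hg (fun z => Rabs (z x))), scal_sum.
      apply sum_eq; intros j _.
      change (emb_coord X D omega DD OP j Tx) with (D j x); ring. }
  assert (H2 : Rabs (w x) <= gap / 2).
  { pose proof (WB (bsub x (d i))) as H.
    rewrite (linear_form_sub _ _ _ _ WL), W0, Rminus_0_r in H by lia.
    apply Rmult_lt_compat_l with (r := 1 + 2 * eta) in Hi; [|lra].
    replace ((1 + 2 * eta) * (gap / (2 * (1 + 2 * eta)))) with (gap / 2) in Hi
      by (field; lra).
    lra. }
  pose proof (list_sum_abs X zs x) as H3; specialize (Hsum x).
  cbv beta in Hsum; rewrite Xx in Hsum.
  pose proof (Rle_abs (list_sum zs x)); pose proof (Rle_abs (w x)).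
  pose proof (Rle_abs (bnorm x - list_sum zs x - w x)).
  unfold gap in *; lra.
Qed.

Theorem theorem4p2 (X : Banach) (hsep : separable X) :
  property_au_star X <->
  (forall delta : R, delta > 0 ->
     exists (Y : Banach) (Xd : Y -> Prop),
       has_shrinking_1unc_basis Y /\ is_subspace Xd /\ BM_dist_lt X Y Xd (1 + delta)).
Proof.
  split; [|apply au_star_of_embeddings].
  intros au delta Hdelta; destruct hsep as [d dense].
  (* The requirement [1 + 3 * eta < (1 + delta) * (1 - eta)] amounts to
     [(4 + delta) * eta < delta]. *)
  set (eta := delta / (5 + delta)).
  assert (Eeta : eta * (5 + delta) = delta) by (unfold eta; field; lra).
  assert (He : 0 < eta < 1).
  { assert (0 < eta) by (apply Rdiv_lt_0_compat; lra). nra. }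
  destruct (almost_isometric_embedding X d eta au dense He) as [Y [T [HY [TL [T1 T2]]]]].
  exists Y, (fun y => exists x, T x = y); split; [exact HY|split].
  - split; [|split].
    + exists bzero; rewrite <- (bscal_0 X bzero), (proj2 TL); apply bscal_0.
    + intros y z [x <-] [x' <-]; exists (badd x x'); apply TL.
    + intros a y [x <-]; exists (bscal a x); apply TL.
  - assert (Hi : 0 < / (1 - eta)) by (apply Rinv_0_lt_compat; lra).
    exists T, 1, ((1 + 3 * eta) * / (1 - eta)).
    split; [exact TL|split; [intros x; exists x; reflexivity|]].
    split; [intros y H; exact H|split; [lra|split; [nra|split; [|split]]]].
    + intros x; rewrite Rmult_1_l; apply T1.
    + intros x; apply Rmult_le_reg_l with (1 - eta); [lra|].
      apply Rle_trans with (1 := T2 x); right; field; lra.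
    + rewrite Rmult_1_l; apply Rmult_lt_reg_r with (1 - eta); [lra|].
      rewrite Rmult_assoc, Rinv_l, Rmult_1_r by lra; lra.
Qed.
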